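(* Let $X$ be a positive random variable with distribution $H$. For $0<p\le 1$ let $Y_p$ be a Bernoulli$(p)$ random variable independent of $X$. Then the distribution of $XY_p$ is $H^{(p)}(dv):=pH(dv)+(1-p)\delta_0(dv)$. Put $\Phi(t):=\mathbb{E}[\log(|t-X|)\,\mathbb{I}(X\ne t)]$, so that $\Phi^{(p)}(t):=\mathbb{E}[\log(|t-XY_p|)\,\mathbb{I}(XY_p\neq t)]=p\Phi(t)+(1-p)\log(t)\,\mathbb{I}(t\ne 0)$ for $t \geq 0$. Then for every $\theta>0$, $$M_\theta(H^{(p)})\overset{d}{=}M_{p\theta}(H)\,B_{\theta p,\theta(1-p)}\qquad\text{and}\qquad G_\theta M_\theta(H^{(p)})\overset{d}{=}G_{\theta p}M_{\theta p}(H).$$ Hence GGC$(\theta,H^{(p)})$ = GGC$(\theta p,H)$ for all $\theta>0$ and $0<p<1$. As special cases: (i) $M_1(H^{(p)})\overset{d}{=}M_p(H)B_{p,1-p}$, and for $0<p<1$ this random variable has density (for $x>0$) $$\frac1\pi\,x^{-(1-p)}\sin\big(\pi p[1-H(x)]\big)\,e^{-p\Phi(x)},\qquad H(x)=\int_0^xH(dy).$$ (ii) $M_{1/p}(H^{(p)})\overset{d}{=}M_1(H)\,B_{1,(1-p)/p}$.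
   Context: $\overset{d}{=}$ is equality in distribution; in a product of random variables the factors are independent. $G_a$ is a Gamma random variable with shape $a$ and scale 1; $B_{a,b}$ is a Beta$(a,b)$ random variable (with $B_{a,0}=1$). For a probability measure $H$ on $[0,\infty)$ with $\int\log(1+x)H(dx)<\infty$ (standing assumption) and $\theta>0$, $M_\theta(H)=\int_0^\infty xP_{0,\theta}(dx)$ is the mean of a Dirichlet process $P_{0,\theta}$ with shape measure $\theta H$; its law is characterized by $\mathbb{E}[(1+\lambda M_\theta(H))^{-\theta}]=\exp(-\theta\int_0^\infty\log(1+\lambda x)H(dx))$, $\lambda>0$. GGC$(\theta,H)$ (generalized gamma convolution) is the law of a nonnegative random variable with Laplace transform $\lambda\mapsto\exp(-\theta\int_0^\infty\log(1+\lambda x)H(dx))$, i.e. the law of $G_\theta M_\theta(H)$. *)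

(* Defs.v *)
From HB Require Import structures.
From mathcomp Require Import all_boot all_order all_algebra.
From mathcomp Require Import all_classical all_reals all_analysis.
From mathcomp Require Import measurable_realfun.

Set Implicit Arguments.
Unset Strict Implicit.
Unset Printing Implicit Defensive.

Import Order.TTheory GRing.Theory Num.Theory.
Import numFieldNormedType.Exports.

Local Open Scope classical_set_scope.
Local Open Scope ring_scope.

Section laws.
Context {R : realType}.

Definition has_law d (T : measurableType d) (P : probability T R)
    d' (U : measurableType d') (X : {RV P >-> U}) (mu : set U -> \bar R) : Prop :=
  forall A, measurable A -> distribution P X A = mu A.
Arguments has_law {d T} P {d' U} X mu.

Definition eq_law d1 (T1 : measurableType d1) (P1 : probability T1 R)
    d2 (T2 : measurableType d2) (P2 : probability T2 R)
    d' (U : measurableType d') (X : {RV P1 >-> U}) (Y : {RV P2 >-> U}) : Prop :=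
  has_law P1 X (distribution P2 Y).
Arguments eq_law {d1 T1} P1 {d2 T2} P2 {d' U} X Y.

Definition independent_RV d (T : measurableType d) (P : probability T R)
    (X Y : {RV P >-> R}) : Prop :=
  forall A B : set R, measurable A -> measurable B ->
    P (X @^-1` A `&` Y @^-1` B) = (P (X @^-1` A) * P (Y @^-1` B))%E.
Arguments independent_RV {d T} P X Y.

(* Taking some of the B i equal to setT gives the product rule for every
   subfamily. *)
Definition mutually_independent_RV d (T : measurableType d)
    (P : probability T R) n (Z : 'I_n -> {RV P >-> R}) : Prop :=
  forall B : 'I_n -> set R, (forall i, measurable (B i)) ->
    P (\bigcap_i (Z i @^-1` B i)) = (\prod_(i < n) P (Z i @^-1` B i))%E.
Arguments mutually_independent_RV {d T} P {n} Z.

Local Notation leb := (@lebesgue_measure R).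

Definition Gamma_fun (a : R) : R :=
  \int[leb]_(x in `]0%R, +oo[) (x `^ (a - 1) * expR (- x)).

Definition Beta_fun (a b : R) : R :=
  \int[leb]_(x in `]0%R, 1%R[) (x `^ (a - 1) * (1 - x) `^ (b - 1)).

(* Gamma law with shape a and scale 1, degenerate at 0 when a = 0. *)
Definition gamma_law (a : R) : set R -> \bar R :=
  if 0 < a then
    fun A => (\int[leb]_(x in A `&` `]0%R, +oo[)
                (x `^ (a - 1) * expR (- x) / Gamma_fun a)%:E)%E
  else \d_(0%R : R).

(* Beta(a, b) law for real a > 0 and b >= 0 (the library's beta_prob only has
   natural number parameters), degenerate at 1 when b = 0. *)
Definition beta_law (a b : R) : set R -> \bar R :=
  if 0 < b then
    fun A => (\int[leb]_(x in A `&` `]0%R, 1%R[)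
                (x `^ (a - 1) * (1 - x) `^ (b - 1) / Beta_fun a b)%:E)%E
  else \d_(1%R : R).

(* The Bernoulli(p) law carried by {0, 1}, seen as a subset of R. *)
Definition bernoulli_law (p : R) : set R -> \bar R :=
  pushforward (bernoulli_prob p) (fun b : bool => b%:R : R).

End laws.
Arguments has_law {R d T} P {d' U} X mu.
Arguments eq_law {R d1 T1} P1 {d2 T2} P2 {d' U} X Y.
Arguments independent_RV {R d T} P X Y.
Arguments mutually_independent_RV {R d T} P {n} Z.

(* H^(p) = p H + (1 - p) delta_0; as for bernoulli_prob, the value for p
   outside [0, 1] is a default that makes it a probability for every p. *)
Section thinning.
Context {R : realType}.
Variables (p : R) (H : probability R R).
Local Open Scope ereal_scope.

Definition thinning : set R -> \bar R := fun A =>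
  if (0 <= p <= 1)%R then p%:E * H A + (1 - p)%:E * \d_(0%R : R) A
  else \d_(0%R : R) A.

Let thinning0 : thinning set0 = 0.
Proof. by rewrite /thinning !measure0 !mule0 adde0; case: ifP. Qed.

Let thinning_ge0 A : 0 <= thinning A.
Proof.
rewrite /thinning; case: ifP => [/andP[p0 p1]|_]; last exact: measure_ge0.
by rewrite adde_ge0// mule_ge0 ?lee_fin ?subr_ge0.
Qed.

Let thinning_semi_sigma_additive : semi_sigma_additive thinning.
Proof.
rewrite /thinning.
case: (boolP (0 <= p <= 1)%R) => [/andP[p0 p1]|_]; last first.
  exact: (@measure_semi_sigma_additive _ _ _ (dirac (0%R : R))).
have q0 : (0 <= 1 - p)%R by rewrite subr_ge0.
set mu := measure_add (mscale (NngNum p0) H)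
                      (mscale (NngNum q0) (\d_(0%R : R))).
suff -> : (fun A => p%:E * H A + (1 - p)%:E * \d_(0%R : R) A) = mu.
  exact: measure_semi_sigma_additive.
by apply/funext => A; rewrite /mu measure_addE.
Qed.

HB.instance Definition _ := isMeasure.Build _ _ _ thinning
  thinning0 thinning_ge0 thinning_semi_sigma_additive.

Let thinning_setT : thinning setT = 1.
Proof.
rewrite /thinning !probability_setT !mule1 -EFinD.
by rewrite addrC subrK; case: ifP.
Qed.

HB.instance Definition _ :=
  Measure_isProbability.Build _ _ _ thinning thinning_setT.

End thinning.

Section dirichlet.
Context {R : realType}.

(* Dirichlet(alpha_0, ..., alpha_(n-1)) law, allowing null parameters, as the
   joint law of normalized independent Gamma variables (Ferguson, 1973). *)
Definition is_dirichlet_law n (alpha : 'I_n -> R)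
    (nu : set (n.-tuple R) -> \bar R) : Prop :=
  exists (d : measure_display) (T : measurableType d) (Q : probability T R)
         (Z : 'I_n -> {RV Q >-> R}),
    [/\ forall i, has_law Q (Z i) (gamma_law (alpha i)),
        mutually_independent_RV Q Z &
        forall U, measurable U ->
          nu U = Q ((fun w => [tuple Z i w / \sum_(j < n) Z j w | i < n])
                      @^-1` U)].

(* D, a random probability measure on R, is a Dirichlet process with shape
   measure theta * H: its values on any finite measurable partition have a
   Dirichlet law. *)
Definition dirichlet_process d (T : measurableType d) (P : probability T R)
    (theta : R) (H : probability R R)
    (D : R.-pker T ~> R) : Prop :=
  forall n (A : 'I_n -> set R),
    (forall i, measurable (A i)) -> trivIset setT A -> \bigcup_i A i = setT ->
    is_dirichlet_law (fun i => theta * fine (H (A i)))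
      (pushforward P (fun w => [tuple fine (D w (A i)) | i < n])).

(* The mean of the random probability measure D.  It is real-valued: where the
   integral is infinite (a null event for a Dirichlet process under the
   logarithmic moment condition on H) its value is 0. *)
Definition random_mean d (T : measurableType d)
    (D : R.-pker T ~> R) : T -> R :=
  fun w => \int[D w]_(x in `[0%R, +oo[) x.

Section random_mean_measurable.
Context d (T : measurableType d) (D : R.-pker T ~> R).

Lemma measurable_random_mean : measurable_fun setT (random_mean D).
Proof.
pose k (z : T * R) : \bar R := (Num.max 0 z.2)%:E.
have k0 z : (0 <= k z)%E by rewrite lee_fin le_max lexx.
have mk : measurable_fun setT k.
  by apply/measurable_EFinP; exact: measurable_maxr.
have mI := @measurable_fun_integral_finite_kernel _ _ _ _ _ k D k0 mk.
rewrite (_ : random_mean D = fine \o (fun w => \int[D w]_y k (w, y))%E).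
  exact: measurableT_comp.
apply/funext => w; rewrite /random_mean /Rintegral/= integral_mkcond.
congr fine; apply: eq_integral => x _; rewrite /k patchE mem_setE in_itv/= andbT.
by case: leP => // /ltW/max_idPl ->.
Qed.

HB.instance Definition _ :=
  isMeasurableFun.Build _ _ _ _ (random_mean D) measurable_random_mean.

End random_mean_measurable.

(* M_s(K) and M_t(H) * B_{a,b} have the same law, where B_{a,b} is independent
   of M_t(H). *)
Definition mean_eq_law_mean_beta (s : R) (K : probability R R)
    (t : R) (H : probability R R) (a b : R) : Prop :=
  forall (d1 : measure_display) (T1 : measurableType d1)
         (P1 : probability T1 R) (D1 : R.-pker T1 ~> R)
         (d2 : measure_display) (T2 : measurableType d2)
         (P2 : probability T2 R) (D2 : R.-pker T2 ~> R)
         (B : {RV P2 >-> R}),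
    dirichlet_process P1 s K D1 ->
    dirichlet_process P2 t H D2 ->
    has_law P2 B (beta_law a b) ->
    independent_RV P2 (random_mean D2) B ->
    eq_law P1 P2 (random_mean D1) (random_mean D2 \* B).

(* G_s M_s(K) and G_t M_t(H) have the same law. *)
Definition gamma_mean_eq_law (s : R) (K : probability R R)
    (t : R) (H : probability R R) : Prop :=
  forall (d1 : measure_display) (T1 : measurableType d1)
         (P1 : probability T1 R) (D1 : R.-pker T1 ~> R)
         (G1 : {RV P1 >-> R})
         (d2 : measure_display) (T2 : measurableType d2)
         (P2 : probability T2 R) (D2 : R.-pker T2 ~> R)
         (G2 : {RV P2 >-> R}),
    dirichlet_process P1 s K D1 -> has_law P1 G1 (gamma_law s) ->
    independent_RV P1 G1 (random_mean D1) ->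
    dirichlet_process P2 t H D2 -> has_law P2 G2 (gamma_law t) ->
    independent_RV P2 G2 (random_mean D2) ->
    eq_law P1 P2 (G1 \* random_mean D1) (G2 \* random_mean D2).

(* GGC(theta, H), as a set of laws (with at most one element, up to the values
   on non-measurable sets). *)
Definition GGC (theta : R) (H : probability R R) :
    set (probability R R) :=
  [set mu : probability R R | mu `[0%R, +oo[%classic = 1%E /\
    forall lambda : R, 0 < lambda ->
      (\int[mu]_(x in `[0%R, +oo[) (expR (- (lambda * x)))%:E =
       expeR (- (theta%:E *
         \int[H]_(x in `[0%R, +oo[) (ln (1 + lambda * x))%:E)))%E].

(* Phi(t) = E[log|t - X| ; X <> t], possibly equal to -oo. *)
Definition log_potential d (T : measurableType d) (P : probability T R)
    (X : T -> R) (t : R) : \bar R :=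
  ('E_P[fun w => (ln `|t - X w| * (X w != t)%:R)%R])%E.

End dirichlet.

(* Main.v *)
(* Let h >= 0 be simple. For a Dirichlet process D with shape theta H, the
   integral of h against D is distributed as V / S, where S is a total of
   independent Gamma variables, V a weighted sum of them, and S is independent
   of V / S. Hence
     E[(1 + s int h dD)^(-theta)] = E[e^(-s V)] = exp(-theta int ln(1 + s h) dH),
   and E[(int h dD)^j] times the rising factorial of theta is E[V^j]. If
   h 0 = 0, thinning H multiplies the exponent by p; so the moments of int h dD
   under the two processes differ by the ratio of two rising factorials, which
   is a moment of the Beta law. Bounded variables are determined by their
   moments, and increasing simple approximations of the identity give the law
   of the mean. The identities for Gamma multiples and the generalized gamma
   convolutions follow by comparing Laplace transforms.
   When theta = 1, S is exponential, and conditioning E[cos (t (V - x S))] on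
   V / S gives
     E[(1 + t^2 (M - x)^2)^(-1)] = exp(-1/2 int ln(1 + t^2 (y - x)^2))
                                     cos(int arctan(t (y - x)))
   where y is integrated against the thinned law. Multiplied by t / pi, the left
   side is a Poisson kernel applied to the law of M, and the right side tends
   to the density as t goes to infinity. By Jensen's inequality the right side
   is dominated by the Riesz potential int |y - x|^(-p) H(dy), which is locally
   integrable; since M has no atoms, integrals over intervals converge to
   probabilities. *)

(* A Dirichlet process is given only through its values on finite partitions, and its mean may be
   infinite on a null event, where [random_mean] takes the value 0. Simple functions keep every
   identity on a finite partition; the logarithmic moment removes the null event in the limit. The
   transform E[(1 + s M)^(-theta)] alone would call for an inversion theorem for generalized
   Stieltjes transforms, and the two means come with different exponents. Moments of bounded
   approximations avoid both, since the Beta factor appears there as a plain quotient. The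
   numerators V of the two processes are compared through their Laplace transforms, so the processes
   need no common probability space. Complex powers are replaced by pairs of real integrals of
   cosine and sine, the modulus and argument of 1 - i y entering through ln (1 + y^2) and atan y.
   The normalizing constants of the Gamma and Beta laws are never evaluated: changes of variable and
   recursions carry them along. For the density, intervals stay away from 0, where the atom of the
   thinned law makes the bound blow up, and the mass at 0 is treated apart. *)
Require Import Defs.
From HB Require Import structures.
From mathcomp Require Import all_boot all_order all_algebra.
From mathcomp Require Import all_classical all_reals all_analysis.
From mathcomp Require Import measurable_realfun.
From mathcomp Require Import ring lra.

Set Implicit Arguments.
Unset Strict Implicit.
Unset Printing Implicit Defensive.

Import Order.TTheory GRing.Theory Num.Theory.
Import numFieldNormedType.Exports.

Local Open Scope classical_set_scope.
Local Open Scope ring_scope.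

(** * Uniqueness of measures, bounded convergence and densities *)

Section measure_tools.
Context {R : realType}.

(** Rectangles form a pi-system that generates the product sigma-algebra, and the whole space is
    itself a rectangle of finite mass, so a constant sequence serves as the exhaustion in
    [measure_unique]. *)
Lemma measure_rect_unique d1 d2 (T1 : measurableType d1) (T2 : measurableType d2)
    (m1 m2 : {measure set (T1 * T2) -> \bar R}) :
  (m1 setT < +oo)%E ->
  (forall A B, measurable A -> measurable B -> m1 (A `*` B) = m2 (A `*` B)) ->
  forall W, measurable W -> m1 W = m2 W.
Proof.
move=> foo m12 W mW.
pose C : set (set (T1 * T2)) :=
  [set C | exists A, measurable A /\ exists B, measurable B /\ C = A `*` B].
apply: (measure_unique C (fun=> setT)) => //.
- rewrite measurable_prod_measurableType //; congr (<<s _ >>).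
  rewrite predeqE; split => [[A mA [B mB <-]]|[A [mA [B [mB ->]]]]].
    by exists A; split => //; exists B.
  by exists A => //; exists B.
- move=> /= _ _ [X1 [mX1 [X2 [mX2 ->]]]] [Y1 [mY1 [Y2 [mY2 ->]]]].
  rewrite -setXI; exists (X1 `&` Y1); split; first exact: measurableI.
  by exists (X2 `&` Y2); split => //; exact: measurableI.
- move=> _; exists setT; split => //; exists setT; split => //.
  by rewrite setXTT.
- by rewrite bigcup_const.
- by move=> A [A1 [mA1 [A2 [mA2 ->]]]]; exact: m12.
Qed.

Lemma measure_ray_unique (m1 m2 : {measure set R -> \bar R}) :
  (m1 setT < +oo)%E ->
  (forall a : R, m1 `]a, +oo[%classic = m2 `]a, +oo[%classic) ->
  forall A, measurable A -> m1 A = m2 A.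
Proof.
move=> foo m12 A mA.
apply: (measure_unique (@RGenOInfty.G R) (fun n => `](- n%:R), +oo[%classic)) => //.
- exact: RGenOInfty.measurableE.
- move=> _ _ [x ->] [y ->]; exists (Num.max x y).
  by apply/seteqP; split => z /=; rewrite !in_itv/= !andbT gt_max;
    [case=> -> ->|case/andP].
- by move=> n; eexists.
- apply/seteqP; split => // x _; exists (Num.truncn `|x|).+1 => //=.
  rewrite in_itv/= andbT ltrNl (le_lt_trans _ (truncnS_gt _))//.
  by rewrite -normrN ler_norm.
- by move=> _ [x ->].
- by move=> k; rewrite (le_lt_trans _ foo)// le_measure// inE.
Qed.

Lemma measurable_preimageT d1 d2 (T1 : measurableType d1) (T2 : measurableType d2)
    (f : T1 -> T2) A : measurable_fun setT f -> measurable A -> measurable (f @^-1` A).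
Proof. by move=> mf mA; rewrite -[X in measurable X]setTI; exact: mf. Qed.

Lemma bounded_integrable d (T : measurableType d)
    (P : {finite_measure set T -> \bar R}) (f : T -> R) (M : R) :
  measurable_fun setT f -> (forall w, `|f w| <= M) ->
  P.-integrable setT (EFin \o f).
Proof.
move=> mf fM; apply: measurable_bounded_integrable => //.
  by rewrite ltey_eq fin_num_measure.
exists M; split; first exact: num_real.
move=> x Mx w _ /=; by rewrite (le_trans (fM w))// ltW.
Qed.

Lemma bounded_cvg_integral d (T : measurableType d)
    (P : {finite_measure set T -> \bar R}) (f_ : nat -> T -> R) (f : T -> R) (M : R) :
  (forall n, measurable_fun setT (f_ n)) -> measurable_fun setT f ->
  (forall n w, `|f_ n w| <= M) ->
  {ae P, forall w, f_ n w @[n --> \oo] --> f w} ->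
  (\int[P]_w (f_ n w)%:E)%E @[n --> \oo] --> (\int[P]_w (f w)%:E)%E.
Proof.
move=> mf_ mf fM fcvg.
have iM : P.-integrable setT (EFin \o cst M) by exact: finite_measure_integrable_cst.
have [] := @dominated_convergence _ _ _ P _ measurableT
    (fun n w => (f_ n w)%:E) (EFin \o f) (EFin \o cst M) => //.
- by move=> n; exact/measurable_EFinP.
- exact/measurable_EFinP.
- apply: filterS fcvg => w fw _; apply/fine_cvgP; split; first exact: nearW.
  exact: fw.
- by apply: aeW => w n _; rewrite lee_fin.
Qed.

Import HBNNSimple.

(** The Gamma and Beta laws, and the restriction of a probability to an event, are known only on
    sets. Linearity carries the density formula to the simple approximations of [f], and monotone
    convergence to [f] itself. *)
Lemma ge0_integral_density d (T : measurableType d)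
    (mu nu : {measure set T -> \bar R}) (g : T -> R) :
  measurable_fun setT g -> (forall x, 0 <= g x) ->
  (forall A, measurable A -> mu A = \int[nu]_(x in A) (g x)%:E)%E ->
  forall f : T -> \bar R, measurable_fun setT f -> (forall x, 0 <= f x)%E ->
  (\int[mu]_x f x = \int[nu]_x (f x * (g x)%:E))%E.
Proof.
move=> mg g0 mug f mf f0.
pose f_ := nnsfun_approx measurableT mf.
have fnf x : (fun n => (f_ n x)%:E) @ \oo --> f x by exact: cvg_nnsfun_approx.
have ndf x : {homo (fun n => (f_ n x)%:E) : n m / (n <= m)%N >-> (n <= m)%E}.
  by move=> m n mn; rewrite lee_fin; exact/lefP/nd_nnsfun_approx.
transitivity (limn (fun n => \int[mu]_x (f_ n x)%:E))%E.
  rewrite -monotone_convergence//.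
  - by apply: eq_integral => x _; apply/esym/cvg_lim => //; exact: fnf.
  - by move=> n; exact/measurable_EFinP/measurable_funP.
  - by move=> n x _; rewrite lee_fin.
transitivity (limn (fun n => \int[nu]_x ((f_ n x)%:E * (g x)%:E)))%E; last first.
  rewrite -monotone_convergence//.
  - apply: eq_integral => x _; apply/cvg_lim => //.
    by apply: cvgeZr => //; exact: fnf.
  - by move=> n; apply: emeasurable_funM; apply/measurable_EFinP => //; exact/measurable_funP.
  - by move=> n x _; rewrite mule_ge0// lee_fin.
  - by move=> x _ m n mn; apply: lee_wpmul2r; [rewrite lee_fin|exact: ndf].
congr (limn _); apply/funext => n.
have fE x : (f_ n x)%:E = (\sum_(k \in range (f_ n)) (k * \1_(f_ n @^-1` [set k]) x)%:E)%E.
  by rewrite fsumEFin// -fimfunE.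
under eq_integral do rewrite fE.
have ind0 r x : (0 <= (r * \1_(f_ n @^-1` [set r]) x)%:E)%E.
  by rewrite EFinM nnfun_muleindic_ge0.
rewrite ge0_integral_fsum//; last first.
  by move=> r; apply/measurable_EFinP/measurable_funM.
under [RHS]eq_integral => x _.
  rewrite fE ge0_mule_fsuml; last by move=> r; exact: ind0.
  over.
rewrite ge0_integral_fsum//; last 2 first.
  - move=> r; by apply/emeasurable_funM; apply/measurable_EFinP => //; exact: measurable_funM.
  - by move=> r x _; rewrite mule_ge0 ?ind0 ?lee_fin.
apply: eq_fsbigr => r /set_mem[x _ <-].
under eq_integral do rewrite EFinM.
rewrite ge0_integralZl//; [|exact/measurable_EFinP|by rewrite lee_fin].
under [RHS]eq_integral do rewrite EFinM -muleA.
rewrite ge0_integralZl//; [|by apply: emeasurable_funM; exact/measurable_EFinP|by move=> z _; rewrite mule_ge0// lee_fin|by rewrite lee_fin].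
rewrite integral_indic// setIT mug//; congr (_ * _)%E.
rewrite integral_mkcond; apply: eq_integral => y _; rewrite patchE indicE.
by case: ifPn; rewrite ?mul1e ?mul0e.
Qed.

End measure_tools.

(** * Moments and Laplace transforms determine laws *)

Section moments.
Context {R : realType}.

Lemma ler_1BMn_expr (x : R) n : 0 <= x <= 1 -> 1 - n%:R * x <= (1 - x) ^+ n.
Proof.
move=> /andP[x0 x1]; elim: n => [|n ih]; first by rewrite mul0r subr0 expr0.
rewrite exprS (le_trans _ (ler_wpM2l _ ih)) ?subr_ge0//.
rewrite -natr1; have : 0 <= n%:R * x * x by rewrite !mulr_ge0.
nra.
Qed.

Lemma ler_expr_1DMn (x : R) n : 0 <= x -> 1 + n%:R * x <= (1 + x) ^+ n.
Proof.
move=> x0; elim: n => [|n ih]; first by rewrite mul0r addr0 expr0.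
rewrite exprS (le_trans _ (ler_wpM2l _ ih)) ?addr_ge0//.
rewrite -natr1; have : 0 <= n%:R * x * x by rewrite !mulr_ge0.
nra.
Qed.

(** Multiply by [(1 + x)^n]: the product [(1 - x^2)^n] is at most 1, and Bernoulli's inequality
    bounds [(1 + x)^n] from below. *)
Lemma ler_expr_1B (x : R) n : 0 <= x <= 1 -> (1 - x) ^+ n <= (1 + n%:R * x)^-1.
Proof.
move=> /andP[x0 x1].
rewrite -[leRHS]mul1r ler_pdivlMr; last by rewrite ltr_pwDl// mulr_ge0.
rewrite (le_trans (ler_wpM2l _ (ler_expr_1DMn _ x0))) ?exprn_ge0 ?subr_ge0//.
by rewrite -exprMn exprn_ile1//; nra.
Qed.

(** With [r = t^2] and [1/t = 1 + h], Bernoulli's inequality gives [n t^n <= 1/h]; the remaining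
    factor [t^n] still tends to 0. *)
Lemma cvg_natr_geometric (r : R) : 0 <= r < 1 -> n%:R * r ^+ n @[n --> \oo] --> 0.
Proof.
move=> /andP[r0 r1].
have [->|rn0] := eqVneq r 0.
  apply/cvg_ballP => e e0; near=> n; rewrite expr0n.
  have -> : (n == 0%N) = false by apply/negbTE; rewrite -lt0n; near: n; exists 1%N.
  by rewrite mulr0; exact: ballxx.
have {rn0}rp : 0 < r by rewrite lt_neqAle eq_sym rn0.
pose t := Num.sqrt r.
have t0 : 0 < t by rewrite sqrtr_gt0.
have t1 : t < 1 by rewrite -sqrtr1 ltr_sqrt.
have rE : r = t * t by rewrite -expr2 sqr_sqrtr// ltW.
pose h := t^-1 - 1.
have h0 : 0 < h by rewrite subr_gt0 invf_gt1.
have nt n : n%:R * t ^+ n <= h^-1.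
  rewrite -[leRHS]mul1r ler_pdivlMr// mulrAC -ler_pdivlMr ?exprn_gt0// mul1r -exprVn.
  have -> : t^-1 = 1 + h by rewrite /h addrC subrK.
  by rewrite (le_trans _ (ler_expr_1DMn n (ltW h0)))// lerDr.
apply: (@squeeze_cvgr _ _ _ _ (fun=> 0) (fun n => h^-1 * t ^+ n)).
- apply: nearW => n; rewrite mulr_ge0//= ?exprn_ge0//.
  by rewrite rE exprMn mulrA ler_wpM2r// exprn_ge0// ltW.
- exact: cvg_cst.
- rewrite -[X in _ --> X](mulr0 h^-1); apply: cvgM; first exact: cvg_cst.
  by apply: cvg_expr; rewrite ger0_norm// ltW.
Unshelve. all: by end_near. Qed.

(* [(1 - u^n)^N] with [N] slightly larger than [a^-n] is a polynomial
   approximation of the indicator of [u < a] on [0, 1]. *)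
Let sharp (a u : R) n : R := (1 - u ^+ n) ^+ (Num.truncn (n%:R / a ^+ n)).+1.

(** Below [a], Bernoulli's inequality leaves an error [n (u/a)^n + u^n], the last term coming from
    rounding the exponent up. From [a] on, the exponent times [u^n] is at least [n], so the value is
    at most [1/(n+1)]; the factor [n] in the exponent is what settles [u = a]. *)
Let cvg_sharp (a u : R) : 0 < a <= 1 -> 0 <= u <= 1 ->
  sharp a u n @[n --> \oo] --> ((u < a)%R%:R : R).
Proof.
move=> /andP[a0 a1] /andP[u0 u1].
have un n : 0 <= u ^+ n <= 1 by rewrite exprn_ge0//= exprn_ile1.
have sharp0 n : 0 <= sharp a u n.
  by rewrite exprn_ge0// subr_ge0; have /andP[] := un n.
have [ua|au] := ltP u a.
  apply: (@squeeze_cvgr _ _ _ _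
    (fun n => 1 - (n%:R * (u / a) ^+ n + u ^+ n)) (fun=> 1)).
  - apply: nearW => n; apply/andP; split; last first.
      by rewrite exprn_ile1 ?subr_ge0 ?lerBlDr ?lerDl//; have /andP[] := un n.
    rewrite (le_trans _ (ler_1BMn_expr _ (un n)))// lerD2l lerN2 -natr1 mulrDl mul1r lerD2r.
    have : 0 <= n%:R / a ^+ n by rewrite divr_ge0 ?exprn_ge0// ltW.
    move=> /truncn_itv/andP[h _]; rewrite (le_trans (ler_wpM2r _ h))//.
      by have /andP[] := un n.
    by rewrite expr_div_n mulrAC mulrA.
  - rewrite -[X in _ --> X]subr0 -[X in _ --> _ - X](addr0 0).
    apply: cvgB; first exact: cvg_cst.
    apply: cvgD; first by apply: cvg_natr_geometric; rewrite divr_ge0//= ?ltW// ltr_pdivrMr ?mul1r.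
    by apply: cvg_expr; rewrite ger0_norm// (lt_le_trans ua).
  - exact: cvg_cst.
apply: (@squeeze_cvgr _ _ _ _ (fun=> 0) (fun n => (n.+1%:R)^-1)).
- apply: nearW => n; rewrite sharp0//= (le_trans (ler_expr_1B _ (un n)))//.
  rewrite lef_pV2 ?posrE ?ltr_pwDl//; last by rewrite mulr_ge0//; have /andP[] := un n.
  rewrite -natr1 addrC lerD2l.
  have : n%:R / a ^+ n <= (Num.truncn (n%:R / a ^+ n)).+1%:R.
    by rewrite ltW// truncnS_gt.
  move=> h; rewrite (le_trans _ (ler_wpM2r _ h))//; last by have /andP[] := un n.
  by rewrite -mulrA ler_peMr// ler_pdivlMl ?exprn_gt0// mulr1 lerXn2r ?nnegrE// ltW.
- exact: cvg_cst.
- exact: cvg_harmonic.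
Qed.

(** Each [sharp a u n] is a polynomial in [u], hence has the same integral on both sides, and it
    converges boundedly to the indicator of [u < a]. These explicit polynomials take the place of
    Weierstrass approximation. *)
Lemma moment_lt d1 d2 (T1 : measurableType d1) (T2 : measurableType d2)
    (P1 : {finite_measure set T1 -> \bar R}) (P2 : {finite_measure set T2 -> \bar R})
    (U1 : T1 -> R) (U2 : T2 -> R) :
  measurable_fun setT U1 -> measurable_fun setT U2 ->
  (forall w, 0 <= U1 w <= 1) -> (forall w, 0 <= U2 w <= 1) ->
  (forall k, \int[P1]_w (U1 w ^+ k)%:E = \int[P2]_w (U2 w ^+ k)%:E)%E ->
  forall a, 0 < a <= 1 -> P1 [set w | U1 w < a] = P2 [set w | U2 w < a].
Proof.
move=> mU1 mU2 U101 U201 mom a a01.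
have polyE d (T : measurableType d) (P : {finite_measure set T -> \bar R})
    (U : T -> R) (p : {poly R}) : measurable_fun setT U ->
    (forall w, 0 <= U w <= 1) ->
    (\int[P]_w (p.[U w])%:E = \sum_(i < size p) (p`_i)%:E * \int[P]_w (U w ^+ i)%:E)%E.
  move=> mU U01.
  have iU k : P.-integrable setT (EFin \o (fun w => U w ^+ k)).
    apply: (@bounded_integrable _ _ _ _ _ 1); first exact: measurable_funX.
    by move=> w; have /andP[u0 u1] := U01 w; rewrite ger0_norm ?exprn_ge0 ?exprn_ile1.
  under eq_integral do rewrite horner_coef -sumEFin.
  rewrite integral_sum//; last first.
    by move=> i; exact: (integrableZl measurableT p`_i (iU i)).
  by apply: eq_bigr => i _; exact: (integralZl measurableT (iU i) p`_i).
have cvgP d (T : measurableType d) (P : {finite_measure set T -> \bar R})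
    (U : T -> R) : measurable_fun setT U -> (forall w, 0 <= U w <= 1) ->
    (\int[P]_w (sharp a (U w) n)%:E)%E @[n --> \oo] --> P [set w | U w < a].
  move=> mU U01.
  have mUa : measurable [set w | U w < a].
    rewrite (_ : mkset _ = U @^-1` `]-oo, a[); first exact: measurable_preimageT.
    by apply/seteqP; split => w /=; rewrite in_itv.
  have -> : P [set w | U w < a] = (\int[P]_w (\1_[set w | U w < a] w)%:E)%E.
    by rewrite integral_indic// setIT.
  apply: (@bounded_cvg_integral _ _ _ _ _ _ 1) => //.
  - by move=> n; apply: measurable_funX; apply: measurable_funB => //; exact: measurable_funX.
  - move=> n w; have /andP[u0 u1] := U01 w.
    rewrite ger0_norm ?exprn_ge0 ?exprn_ile1 ?subr_ge0 ?exprn_ile1//.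
    by rewrite lerBlDr lerDl exprn_ge0.
  - apply: aeW => w; have := @cvg_sharp a (U w) a01 (U01 w).
    by rewrite indicE mem_setE.
have h1 := cvgP _ _ P1 _ mU1 U101; have h2 := cvgP _ _ P2 _ mU2 U201.
rewrite -(cvg_lim (@ereal_hausdorff _) h1) -(cvg_lim (@ereal_hausdorff _) h2).
congr (limn _); apply/funext => n.
pose p : {poly R} := (1 - 'X^n) ^+ (Num.truncn (n%:R / a ^+ n)).+1.
have pE u : sharp a u n = p.[u] by rewrite /p !hornerE.
under eq_integral do rewrite pE; under [RHS]eq_integral do rewrite pE.
rewrite !polyE//; apply: eq_bigr => i _; congr (_ * _)%E; exact: mom.
Qed.

(* [expR (- X)] takes values in [0, 1], so this is uniqueness of moments. *)
Lemma laplace_unique d1 d2 (T1 : measurableType d1) (T2 : measurableType d2)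
    (P1 : {finite_measure set T1 -> \bar R}) (P2 : {finite_measure set T2 -> \bar R})
    (X1 : T1 -> R) (X2 : T2 -> R) :
  measurable_fun setT X1 -> measurable_fun setT X2 ->
  P1 (X1 @^-1` `]-oo, 0[) = 0%E -> P2 (X2 @^-1` `]-oo, 0[) = 0%E ->
  (forall k : nat, \int[P1]_w (expR (- (k%:R * X1 w)))%:E =
                   \int[P2]_w (expR (- (k%:R * X2 w)))%:E)%E ->
  forall A, measurable A -> P1 (X1 @^-1` A) = P2 (X2 @^-1` A).
Proof.
move=> mX1 mX2 P10 P20 lap.
(* Clamping at 0 bounds [U] by 1 everywhere; since negative values form a null event on both sides,
   it changes no integral. *)
pose U (x : R) := expR (- Num.max 0 x).
have mU : measurable_fun setT U.
  by apply: measurableT_comp => //; apply: measurableT_comp => //; exact: measurable_maxr.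
have U01 x : 0 <= U x <= 1.
  by rewrite expR_ge0//= -expR0 ler_expR lerNl oppr0 le_max lexx.
have UE d (T : measurableType d) (P : {finite_measure set T -> \bar R}) (X : T -> R) k :
    measurable_fun setT X -> P (X @^-1` `]-oo, 0[) = 0%E ->
    (\int[P]_w (U (X w) ^+ k)%:E = \int[P]_w (expR (- (k%:R * X w)))%:E)%E.
  move=> mX P0; apply: ae_eq_integral => //.
  - by apply/measurable_EFinP; apply: measurable_funX; exact: measurableT_comp.
  - apply/measurable_EFinP; apply: measurableT_comp => //.
    by apply: measurableT_comp => //; exact: measurable_funM.
  - exists (X @^-1` `]-oo, 0[); split => //; first exact: measurable_preimageT.
    move=> w /=; rewrite in_itv/=; apply: contra_notT; rewrite -leNgt => x0 _.
    by rewrite /U max_r// -expRM_natl mulrN.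
have rayE a : 0 < a <= 1 -> P1 [set w | U (X1 w) < a] = P2 [set w | U (X2 w) < a].
  by apply: moment_lt => [||w|w|k]; rewrite ?UE//; exact: measurableT_comp.
have mT : P1 setT = P2 setT.
  have := lap 0%N.
  under eq_integral do rewrite mul0r oppr0 expR0.
  under [RHS]eq_integral do rewrite mul0r oppr0 expR0.
  by rewrite !integral_cst// !mul1e.
apply: (@measure_ray_unique R (pushforward P1 X1) (pushforward P2 X2)) => //.
  rewrite ltey_eq; apply/orP; left.
  exact: (fin_num_measure P1 _ (measurable_preimageT mX1 measurableT)).
move=> a.
rewrite -[LHS]/(P1 (X1 @^-1` `]a, +oo[)) -[RHS]/(P2 (X2 @^-1` `]a, +oo[)).
(* A ray starting at [a >= 0] is the event [U < e^(-a)], with [e^(-a)] in ]0, 1]; a ray starting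
   below 0 has full mass. *)
have [a0|a0] := leP 0 a.
  have E d (T : measurableType d) (X : T -> R) :
      X @^-1` `]a, +oo[ = [set w | U (X w) < expR (- a)].
    apply/seteqP; split => w /=; rewrite in_itv/= andbT /U ltr_expR ltrN2 lt_max.
      by move=> ->; rewrite orbT.
    by move=> /orP[|//]; rewrite ltNge a0.
  by rewrite !E; apply: rayE; rewrite expR_gt0/= -expR0 ler_expR lerNl oppr0.
have full d (T : measurableType d) (P : {finite_measure set T -> \bar R}) (X : T -> R) :
    measurable_fun setT X ->
    P (X @^-1` `]-oo, 0[) = 0%E -> P (X @^-1` `]a, +oo[) = P setT.
  move=> mX P0; rewrite -(preimage_setT X) -(setvU `]a, +oo[%classic) preimage_setU measureU//; last 3 first.
    - by apply: measurable_preimageT => //; exact: measurableC.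
    - exact: measurable_preimageT.
    - by rewrite -preimage_setI setICl preimage_set0.
  rewrite [X in (X + _)%E](_ : _ = 0%E) ?add0e//.
  apply/eqP; rewrite eq_le measure_ge0 andbT -P0 le_measure ?inE//.
  - by apply: measurable_preimageT => //; exact: measurableC.
  - exact: measurable_preimageT.
  - by rewrite setCitvr => x /=; rewrite !in_itv/= => /le_lt_trans; exact.
exact: (etrans (full _ _ _ _ mX1 P10) (etrans mT (esym (full _ _ _ _ mX2 P20)))).
Qed.

End moments.

(** * Independence and integrals of products *)

Section independence.
Context {R : realType} d (T : measurableType d) (Q : probability T R).

Definition indep d1 d2 (U1 : measurableType d1) (U2 : measurableType d2)
    (X : T -> U1) (Y : T -> U2) : Prop :=
  forall A B, measurable A -> measurable B ->
    (Q (X @^-1` A `&` Y @^-1` B) = Q (X @^-1` A) * Q (Y @^-1` B))%E.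

(** Independence identifies the joint law with the product of the marginals; Tonelli's theorem then
    makes the second variable an independent copy, integrated for a frozen value of the first. *)
Lemma indep_integral d1 d2 (U1 : measurableType d1) (U2 : measurableType d2)
    (X : T -> U1) (Y : T -> U2) (f : U1 * U2 -> \bar R) :
  measurable_fun setT X -> measurable_fun setT Y -> indep X Y ->
  measurable_fun setT f -> (forall z, 0 <= f z)%E ->
  (\int[Q]_w f (X w, Y w) = \int[Q]_w \int[Q]_w' f (X w, Y w'))%E.
Proof.
move=> mX mY XY mf f0.
pose X' : {mfun T >-> U1} := HB.pack X (isMeasurableFun.Build _ _ _ _ _ mX).
pose Y' : {mfun T >-> U2} := HB.pack Y (isMeasurableFun.Build _ _ _ _ _ mY).
have mXY : measurable_fun setT (fun w => (X w, Y w)) by exact: measurable_fun_pair.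
pose XY' : {mfun T >-> (U1 * U2)%type} :=
  HB.pack (fun w => (X w, Y w)) (isMeasurableFun.Build _ _ _ _ _ mXY).
rewrite -[LHS](@ge0_integral_distribution _ _ _ _ _ Q XY' f)//.
rewrite (@eq_measure_integral _ _ _ _ (distribution Q X' \x distribution Q Y')%E); last first.
  move=> A mA _; apply/esym.
  apply: (@product_measure_unique _ _ _ _ _ (distribution Q X') (distribution Q Y')) => //.
rewrite fubini_tonelli1//.
rewrite ge0_integral_distribution//; last 2 first.
- exact: measurable_fun_fubini_tonelli_F.
- by move=> x; exact: integral_ge0.
apply: eq_integral => w _ /=; rewrite /fubini_F ge0_integral_distribution//.
by apply: measurableT_comp => //; exact: pair1_measurable.
Qed.

Lemma indep_ge0_mul d1 d2 (U1 : measurableType d1) (U2 : measurableType d2)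
    (X : T -> U1) (Y : T -> U2) (f : U1 -> \bar R) (g : U2 -> \bar R) :
  measurable_fun setT X -> measurable_fun setT Y -> indep X Y ->
  measurable_fun setT f -> measurable_fun setT g ->
  (forall x, 0 <= f x)%E -> (forall x, 0 <= g x)%E ->
  (\int[Q]_w (f (X w) * g (Y w)) = \int[Q]_w f (X w) * \int[Q]_w g (Y w))%E.
Proof.
move=> mX mY XY mf mg f0 g0.
rewrite (@indep_integral _ _ _ _ _ _ (fun z => f z.1 * g z.2)%E)//; last 2 first.
- by apply: emeasurable_funM; exact: measurableT_comp.
- by move=> z; rewrite mule_ge0.
under eq_integral => w _.
  rewrite /= ge0_integralZl//; last exact: measurableT_comp.
  over.
rewrite ge0_integralZr//; first exact: measurableT_comp.
exact: integral_ge0.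
Qed.

(** Adding [M] makes both factors nonnegative; expanding [(f + M) (g + M)] and cancelling the linear
    terms recovers the signed case. *)
Lemma indep_bounded_mul d1 d2 (U1 : measurableType d1) (U2 : measurableType d2)
    (X : T -> U1) (Y : T -> U2) (f : U1 -> R) (g : U2 -> R) (M : R) :
  measurable_fun setT X -> measurable_fun setT Y -> indep X Y ->
  measurable_fun setT f -> measurable_fun setT g ->
  (forall x, `|f x| <= M) -> (forall x, `|g x| <= M) ->
  \int[Q]_w (f (X w) * g (Y w)) = \int[Q]_w f (X w) * \int[Q]_w g (Y w).
Proof.
move=> mX mY XY mf mg fM gM.
have mfX : measurable_fun setT (f \o X) by exact: measurableT_comp.
have mgY : measurable_fun setT (g \o Y) by exact: measurableT_comp.
have fM0 x : 0 <= f x + M by have := fM x; rewrite ler_norml => /andP[]; lra.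
have gM0 x : 0 <= g x + M by have := gM x; rewrite ler_norml => /andP[]; lra.
have iF : Q.-integrable setT (EFin \o (f \o X)).
  by apply: (@bounded_integrable _ _ _ _ _ M) => // w; exact: fM.
have iG : Q.-integrable setT (EFin \o (g \o Y)).
  by apply: (@bounded_integrable _ _ _ _ _ M) => // w; exact: gM.
have iFG : Q.-integrable setT (EFin \o (fun w => f (X w) * g (Y w))).
  apply: (@bounded_integrable _ _ _ _ _ (M * M)); first exact: measurable_funM.
  by move=> w; rewrite normrM ler_pM.
have ic c : Q.-integrable setT (EFin \o cst c) by exact: finite_measure_integrable_cst.
have intc c : \int[Q]_w c = c.
  by rewrite Rintegral_cst//= probability_setT mulr1.
have h : \int[Q]_w ((f (X w) + M) * (g (Y w) + M)) =
    \int[Q]_w (f (X w) + M) * \int[Q]_w (g (Y w) + M).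
  rewrite /Rintegral -fineM; last 2 first.
  - by apply: integrable_fin_num => //; exact: integrableD iF (ic M).
  - by apply: integrable_fin_num => //; exact: integrableD iG (ic M).
  congr fine.
  apply: (@indep_ge0_mul _ _ _ _ X Y (fun x => (f x + M)%:E) (fun x => (g x + M)%:E)) => //.
  - exact/measurable_EFinP/measurable_funD.
  - exact/measurable_EFinP/measurable_funD.
have hf : \int[Q]_w (f (X w) + M) = \int[Q]_w f (X w) + M.
  by rewrite (RintegralD measurableT iF (ic M)) intc.
have hg : \int[Q]_w (g (Y w) + M) = \int[Q]_w g (Y w) + M.
  by rewrite (RintegralD measurableT iG (ic M)) intc.
rewrite hf hg in h.
have : \int[Q]_w ((f (X w) + M) * (g (Y w) + M)) =
   \int[Q]_w (f (X w) * g (Y w)) + M * (\int[Q]_w f (X w) + \int[Q]_w g (Y w)) + M * M.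
  transitivity (\int[Q]_w (f (X w) * g (Y w) + M * (f (X w) + g (Y w)) + M * M)).
    by apply: eq_Rintegral => w _; ring.
  have iS : Q.-integrable setT (EFin \o (fun w => f (X w) + g (Y w))).
    exact: (integrableD measurableT iF iG).
  have iMS : Q.-integrable setT (EFin \o (fun w => M * (f (X w) + g (Y w)))).
    exact: (integrableZl measurableT M iS).
  rewrite (RintegralD measurableT (integrableD measurableT iFG iMS) (ic (M * M))) intc.
  rewrite (RintegralD measurableT iFG iMS) (RintegralZl M measurableT iS).
  by rewrite (RintegralD measurableT iF iG).
rewrite h => {}h; have := h; lra.
Qed.

End independence.

(** * Partial sums are independent of the next variable *)

Section partial_sums.
Context {R : realType} d (T : measurableType d) (Q : probability T R).
Variables (n : nat) (Z : nat -> T -> R) (y : nat -> R).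
Hypothesis mZ : forall i, measurable_fun setT (Z i).
Hypothesis indZ : forall B : nat -> set R, (forall i, measurable (B i)) ->
  (Q (\big[setI/setT]_(0 <= i < n) (Z i @^-1` B i)) =
   \prod_(0 <= i < n) Q (Z i @^-1` B i))%E.

Definition wsum k w := \sum_(0 <= i < k) y i * Z i w.
Definition tsum k w := \sum_(0 <= i < k) Z i w.

Lemma measurable_wsum k : measurable_fun setT (wsum k).
Proof. by apply: measurable_sum => i; exact: measurable_funM. Qed.

Lemma measurable_tsum k : measurable_fun setT (tsum k).
Proof. exact: measurable_sum. Qed.

Let mVS k : measurable_fun setT (fun w => (wsum k w, tsum k w)).
Proof. by apply: measurable_fun_pair; [exact: measurable_wsum|exact: measurable_tsum]. Qed.

(** The induction needs the untouched tail in the statement: the next variable is split off from it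
    and merged into the sums. Weighted sum and total travel as a pair, since their joint behaviour
    is needed for their ratio. *)
Lemma indep_sums_tail k : (k <= n)%N ->
  forall (U : set (R * R)) (B : nat -> set R), measurable U ->
  (forall i, measurable (B i)) ->
  (Q ((fun w => (wsum k w, tsum k w)) @^-1` U `&`
      \big[setI/setT]_(k <= i < n) (Z i @^-1` B i)) =
   Q ((fun w => (wsum k w, tsum k w)) @^-1` U) *
   \prod_(k <= i < n) Q (Z i @^-1` B i))%E.
Proof.
elim: k => [_ U B mU mB|k ih kn U B mU mB].
  have [U0|U0] := pselect (U (0, 0)).
    rewrite [X in Q (X `&` _)](_ : _ = setT); last first.
      by apply/seteqP; split => w //= _; rewrite /wsum /tsum !big_geq.
    rewrite [X in (Q X * _)%E](_ : _ = setT); last first.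
      by apply/seteqP; split => w //= _; rewrite /wsum /tsum !big_geq.
    by rewrite setTI probability_setT mul1e indZ.
  rewrite [X in Q (X `&` _)](_ : _ = set0); last first.
    by apply/seteqP; split => w //=; rewrite /wsum /tsum !big_geq.
  rewrite [X in (Q X * _)%E](_ : _ = set0); last first.
    by apply/seteqP; split => w //=; rewrite /wsum /tsum !big_geq.
  by rewrite set0I measure0 mul0e.
have {}ih := ih (ltnW kn).
set C := \big[setI/setT]_(k.+1 <= i < n) _.
set c := (\prod_(k.+1 <= i < n) _)%E.
have mC : measurable C.
  by apply: bigsetI_measurable => i _; exact: measurable_preimageT.
pose F w := ((wsum k w, tsum k w), Z k w).
have mF : measurable_fun setT F by exact: measurable_fun_pair.
pose F' : {mfun T >-> ((R * R) * R)%type} :=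
  HB.pack F (isMeasurableFun.Build _ _ _ _ _ mF).
pose g (z : (R * R) * R) := (z.1.1 + y k * z.2, z.1.2 + z.2).
have mg : measurable_fun setT g.
  apply: measurable_fun_pair; apply: measurable_funD.
  - exact: (measurableT_comp measurable_fst measurable_fst).
  - by apply: measurable_funM => //; exact: measurable_snd.
  - exact: (measurableT_comp measurable_snd measurable_fst).
  - exact: measurable_snd.
have gF w : g (F w) = (wsum k.+1 w, tsum k.+1 w).
  by rewrite /g /F /wsum /tsum/= !big_nat_recr.
have rect (A : set (R * R)) (D : set R) (E : nat -> set R) : measurable A -> measurable D ->
    (forall i, measurable (E i)) ->
    (Q (F @^-1` (A `*` D) `&` \big[setI/setT]_(k.+1 <= i < n) (Z i @^-1` E i)) =
    Q ((fun w => (wsum k w, tsum k w)) @^-1` A) * (Q (Z k @^-1` D) *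
      \prod_(k.+1 <= i < n) Q (Z i @^-1` E i)))%E.
  move=> mA mD mE.
  have mDE i : measurable (if i == k then D else E i) by case: ifP.
  have := ih A _ mA mDE.
  rewrite !(big_ltn kn) eqxx setIA.
  under eq_big_nat => i /andP[ki _] do rewrite gtn_eqF//.
  under [X in (_ * (_ * X))%E]eq_big_nat => i /andP[ki _] do rewrite gtn_eqF//.
  exact.
have QT : (\prod_(k.+1 <= i < n) Q (Z i @^-1` setT) = 1)%E.
  by apply: big1_seq => i _; rewrite preimage_setT probability_setT.
have QCT : \big[setI/setT]_(k.+1 <= i < n) (Z i @^-1` setT) = setT.
  by apply: big1_seq => i _; rewrite preimage_setT.
have cfin : c \is a fin_num.
  by rewrite /c; elim/big_rec : _ => // i x _ xf; rewrite fin_numM// fin_num_measure//; exact: measurable_preimageT.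
have c0 : (0 <= c)%E by apply: prode_ge0 => i _.
(* Both sides are finite measures in [W]. On rectangles they agree by applying [rect] twice, once to
   the events [B] and once to trivial ones. The new pair of sums is the image of [F] under the
   measurable map [g]. *)
have m12 (W : set ((R * R) * R)) : measurable W ->
    Q (F @^-1` W `&` C) = (c * Q (F @^-1` W))%E.
  move=> mW.
  have scaleE D : mscale (NngNum (fine_ge0 c0)) (distribution Q F') D =
      (c * Q (F @^-1` D))%E by rewrite /mscale/= fineK.
  rewrite -scaleE.
  apply: (@measure_rect_unique _ _ _ _ _ (pushforward (mrestr Q mC) F')
    (mscale (NngNum (fine_ge0 c0)) (distribution Q F'))) => //.
  - rewrite ltey_eq; apply/orP; left; apply: (fin_num_measure Q).
    by apply: measurableI => //; exact: measurable_preimageT.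
  - move=> A D mA mD; transitivity (c * Q (F @^-1` (A `*` D)))%E; last exact/esym/scaleE.
    transitivity (Q (F @^-1` (A `*` D) `&` C)); first by [].
    rewrite /C rect//.
    have := @rect A D (fun=> setT) mA mD (fun=> measurableT).
    rewrite QT QCT setIT mule1 => ->.
    by rewrite muleA muleC.
have := m12 (g @^-1` U) (measurable_preimageT mg mU).
rewrite muleC (_ : F @^-1` (g @^-1` U) = (fun w => (wsum k.+1 w, tsum k.+1 w)) @^-1` U)//.
by apply/seteqP; split => w /=; rewrite gF.
Qed.

Lemma indep_sums k : (k < n)%N -> indep Q (fun w => (wsum k w, tsum k w)) (Z k).
Proof.
move=> kn A B mA mB.
have mBT i : measurable (if i == k then B else [set: R]) by case: ifP.
have := @indep_sums_tail k (ltnW kn) A _ mA mBT.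
rewrite !(big_ltn kn) eqxx.
under eq_big_nat => i /andP[ki _] do rewrite gtn_eqF//.
under [X in (_ * (_ * X))%E]eq_big_nat => i /andP[ki _] do rewrite gtn_eqF//.
rewrite [X in _ `&` (_ `&` X)](_ : _ = setT); last first.
  by apply: big1_seq => i _; rewrite preimage_setT.
rewrite [X in (_ * (_ * X))%E](_ : _ = 1%E); last first.
  by apply: big1_seq => i _; rewrite preimage_setT probability_setT.
by rewrite setIT mule1.
Qed.

End partial_sums.

(** * Derivatives, measurability and scaling of Lebesgue measure *)

Section real_auxiliary.
Context {R : realType}.

Lemma is_derive_comp1 (f g : R -> R) (x b c : R) :
  is_derive (g x) 1 f b -> is_derive x 1 g c -> is_derive x 1 (fun z => f (g z)) (b * c).
Proof. by move=> hf hg; exact: is_derive1_comp. Qed.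

Lemma is_derive_affine (c e x : R) : is_derive x 1 (fun z => c + e * z) e.
Proof.
have h : is_derive x (1 : R) (cst c + (e \*: id)) (0 + e *: (1 : R)) by exact: is_deriveD.
by apply: is_derive_eq h _; rewrite add0r /GRing.scale/= mulr1.
Qed.

Lemma is_derive_mul (f g : R -> R) (x b c : R) :
  is_derive x 1 f b -> is_derive x 1 g c ->
  is_derive x 1 (fun z => f z * g z) (f x * c + g x * b).
Proof. by move=> hf hg; exact: is_deriveM. Qed.

Lemma is_derive_add (f g : R -> R) (x b c : R) :
  is_derive x 1 f b -> is_derive x 1 g c -> is_derive x 1 (fun z => f z + g z) (b + c).
Proof. by move=> hf hg; exact: is_deriveD. Qed.

Lemma is_derive_sub (f g : R -> R) (x b c : R) :
  is_derive x 1 f b -> is_derive x 1 g c -> is_derive x 1 (fun z => f z - g z) (b - c).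
Proof. by move=> hf hg; exact: is_deriveB. Qed.

Lemma measurable_cos : measurable_fun setT (@cos R).
Proof. apply: continuous_measurable_fun; exact: continuous_cos. Qed.

Lemma measurable_sin : measurable_fun setT (@sin R).
Proof. apply: continuous_measurable_fun; exact: continuous_sin. Qed.

Lemma measurable_atan : measurable_fun setT (@atan R).
Proof. apply: continuous_measurable_fun => x; exact: continuous_atan. Qed.

(** The inverse is discontinuous at 0, where its value is 0; the formula [x (|x|^(-1))^2] reproduces
    that value and involves only measurable powers. *)
Lemma measurable_inv : measurable_fun setT (@GRing.inv R).
Proof.
have -> : @GRing.inv R = (fun x => x * (`|x| `^ (-1)) ^+ 2).
  apply/funext => x; have [->|x0] := eqVneq x 0; first by rewrite invr0 mul0r.
  rewrite powR_inv1// exprVn -normrX ger0_norm ?sqr_ge0// expr2 invfM mulrA divff// mul1r//.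
apply: measurable_funM => //; apply: measurable_funX.
exact: (measurableT_comp (measurable_powR (-1)) (@normr_measurable R setT)).
Qed.

(** The image of Lebesgue measure under [x / c], multiplied by [1/c], gives []x, y]] its length, so
    it is Lebesgue measure. *)
Lemma ge0_integral_lebesgue_scale (c : R) (h : R -> \bar R) : 0 < c ->
  measurable_fun setT h -> (forall x, 0 <= h x)%E ->
  (\int[lebesgue_measure]_x h (x / c)%R = c%:E * \int[lebesgue_measure]_x h x)%E.
Proof.
move=> c0 mh h0.
pose phi (x : R) : measurableTypeR R := x / c.
have mphi : measurable_fun setT phi by exact: mulrr_measurable.
have c'0 : 0 <= c^-1 by rewrite invr_ge0 ltW.
have lebE A : measurable A ->
    lebesgue_measure A = (c^-1%:E * lebesgue_measure (phi @^-1` A))%E.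
  move=> mA.
  apply: (@lebesgue_measure_unique R (mscale (NngNum c'0) (pushforward lebesgue_measure phi))) => //.
  move=> _ [[x y]] _ <-.
  transitivity (c^-1%:E * lebesgue_measure (phi @^-1` [set` `]x, y]%R]))%E; last by [].
  have -> : phi @^-1` [set` `]x, y]%R] = [set` `](x * c), (y * c)]%R].
    by apply/seteqP; split => z /=; rewrite /phi !in_itv/= ltr_pdivlMr// ler_pdivrMr.
  rewrite !lebesgue_measure_itv/= !lte_fin ltr_pM2r//.
  case: ifP => _; last by rewrite mule0.
  by rewrite -!EFinD -EFinM -mulrBl mulrC mulfK// gt_eqF.
transitivity (\int[pushforward lebesgue_measure phi]_x h x)%E.
  by rewrite ge0_integral_pushforward.
transitivity (\int[mscale (NngNum (ltW c0)) lebesgue_measure]_x h x)%E.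
  apply: eq_measure_integral => A mA _.
  transitivity (c%:E * lebesgue_measure A)%E; last by [].
  by rewrite lebE// muleA -EFinM divff ?mul1e// gt_eqF.
by rewrite ge0_integral_mscale.
Qed.

End real_auxiliary.

(** * Laplace and trigonometric transforms of one Gamma variable *)

Section gamma.
Context {R : realType} d (T : measurableType d) (Q : probability T R).
Variables (Z : {RV Q >-> R}) (a : R).
Hypotheses (a0 : 0 <= a) (hZ : has_law Q Z (gamma_law a)).

Lemma gamma_lt0 : Q (Z @^-1` `]-oo, 0%R[) = 0%E.
Proof.
rewrite -[LHS]/(distribution Q Z _) hZ// /gamma_law; case: ifP => _.
  rewrite (_ : _ `&` _ = set0) ?integral_set0//.
  by apply/seteqP; split => x //= []; rewrite !in_itv/= andbT => /lt_trans/[apply]; rewrite ltxx.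
by rewrite diracE memNset//= in_itv/= ltxx.
Qed.

Let g (x : R) : R := (x `^ (a - 1) * expR (- x) / Gamma_fun a) * \1_(`]0, +oo[%classic : set R) x.

Let mg : measurable_fun setT g.
Proof.
apply: measurable_funM; last by exact: measurable_indic.
apply: measurable_funM => //; apply: measurable_funM; first exact: measurable_powR.
by apply: measurableT_comp => //; exact: measurable_funN.
Qed.

Let g0 x : 0 <= g x.
Proof.
rewrite mulr_ge0// divr_ge0//; first by rewrite mulr_ge0 ?powR_ge0 ?expR_ge0.
by apply: Rintegral_ge0 => z _; rewrite mulr_ge0 ?powR_ge0 ?expR_ge0.
Qed.

Let ge0_integral_gamma (f : R -> \bar R) : 0 < a ->
  measurable_fun setT f -> (forall x, 0 <= f x)%E ->
  (\int[Q]_w f (Z w) = \int[lebesgue_measure]_x (f x * (g x)%:E))%E.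
Proof.
move=> ap mf f0.
pose Z' : {mfun T >-> measurableTypeR R} := HB.pack (Z : T -> measurableTypeR R)
  (isMeasurableFun.Build _ _ T (measurableTypeR R) Z (measurable_funPT Z)).
rewrite -[LHS](@ge0_integral_distribution _ _ _ _ _ Q Z' f)//.
apply: (@ge0_integral_density R _ _ (distribution Q Z') lebesgue_measure g) => //.
move=> A mA; rewrite -[LHS]/(distribution Q Z A) hZ// /gamma_law ap integral_mkcondr.
by apply: eq_integral => x _; rewrite /g patchE indicE; case: ifP => _; rewrite ?mulr1 ?mulr0.
Qed.

(** Substituting [x = (1 + s) u] in the density shows that weighting by [e^(-s x)] amounts to
    dividing the variable by [1 + s], at the cost of a factor [(1 + s)^(-a)]. The Laplace transform,
    the trigonometric transforms and the moments of Gamma variables all derive from this identity.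
    For [a = 0] both sides equal [f 0]. *)
Lemma gamma_scaling (f : R -> \bar R) (s : R) : -1 < s ->
  measurable_fun setT f -> (forall x, 0 <= f x)%E ->
  (\int[Q]_w (f (Z w) * (expR (- (s * Z w)))%:E) =
   (expR (- (a * ln (1 + s))))%:E * \int[Q]_w f (Z w / (1 + s))%R)%E.
Proof.
move=> s1 mf f0; have c0 : 0 < 1 + s by lra.
have mexp : measurable_fun setT (fun x : R => expR (- (s * x))).
  by apply: measurableT_comp => //; apply: measurableT_comp.
have mfe : measurable_fun setT (fun x : R => f x * (expR (- (s * x)))%:E)%E.
  by apply: emeasurable_funM => //; exact/measurable_EFinP.
have mdiv : measurable_fun setT (fun x : R => x / (1 + s)) by exact: mulrr_measurable.
have mfs : measurable_fun setT (fun x : R => f (x / (1 + s))%R).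
  by apply: (measurableT_comp mf).
have [ap|] := boolP (0 < a); last first.
  rewrite -leNgt => aN; have ae : a = 0 by apply/eqP; rewrite eq_le aN.
  have lawE (h : R -> \bar R) : measurable_fun setT h -> (forall x, 0 <= h x)%E ->
      (\int[Q]_w h (Z w) = h 0%R)%E.
    move=> mh h0; rewrite -[LHS](ge0_integral_distribution Z mh h0).
    transitivity (\int[\d_(0%R : R)]_x h x)%E; last by rewrite integral_dirac// diracT mul1e.
    apply: eq_measure_integral => A mA _.
    by transitivity (gamma_law a A); [exact: hZ|rewrite /gamma_law ae ltxx].
  rewrite (lawE (fun x => f x * (expR (- (s * x)))%:E)%E)//; last by move=> x; rewrite mule_ge0// lee_fin expR_ge0.
  by rewrite (lawE (fun x => f (x / (1 + s))%R))// ae !mul0r mulr0 oppr0 expR0 mule1 mul1e.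
rewrite (ge0_integral_gamma ap mfe); last by move=> x; rewrite mule_ge0// lee_fin expR_ge0.
rewrite (ge0_integral_gamma ap mfs)//.
pose h u := (f u * (g ((1 + s) * u))%:E)%E.
have mh : measurable_fun setT h.
  apply: emeasurable_funM => //; apply/measurable_EFinP; apply: measurableT_comp => //.
have h0 u : (0 <= h u)%E by rewrite mule_ge0 ?lee_fin.
have -> : (\int[lebesgue_measure]_x (f (x / (1 + s))%R * (g x)%:E) =
    \int[lebesgue_measure]_x h (x / (1 + s))%R)%E.
  by apply: eq_integral => x _; rewrite /h mulrCA divff ?mulr1// gt_eqF.
rewrite ge0_integral_lebesgue_scale// muleA -ge0_integralZl//; last first.
  by rewrite -EFinM lee_fin mulr_ge0 ?expR_ge0 ?ltW.
apply: eq_integral => x _; rewrite /h -muleA [RHS]muleCA; congr (_ * _)%E.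
rewrite -!EFinM; congr EFin; rewrite /g !indicE !mem_setE !in_itv/= !andbT pmulr_rgt0//.
have [x0|x0] := boolP (0 < x); last by rewrite !mulr0.
rewrite !mulr1.
rewrite powRM ?ltW// /powR (gt_eqF c0) (gt_eqF x0).
have -> : expR (- (a * ln (1 + s))) * (1 + s) = expR (- ((a - 1) * ln (1 + s))).
  by rewrite -[X in _ * X]lnK ?posrE// -expRD; congr expR; ring.
have -> : expR (- ((1 + s) * x)) = expR (- (s * x)) * expR (- x).
  by rewrite -expRD; congr expR; ring.
rewrite [in RHS]expRN.
have : expR ((a - 1) * ln (1 + s)) != 0 by rewrite gt_eqF// expR_gt0.
set A := expR ((a - 1) * ln (1 + s)); set B := expR ((a - 1) * ln x) => A0.
by rewrite !mulrA mulVf// mul1r; ring.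
Qed.

Lemma gamma_laplace (s : R) : -1 < s ->
  (\int[Q]_w (expR (- (s * Z w)))%:E = (expR (- (a * ln (1 + s))))%:E)%E.
Proof.
move=> s1; have := @gamma_scaling (cst 1%E) s s1 (measurable_cst _).
rewrite [X in (_ * X)%E](_ : _ = 1%E); last first.
  by rewrite [LHS]integral_cst//= probability_setT mule1.
rewrite mule1 => <- //.
by apply: eq_integral => w _; rewrite mul1e.
Qed.

Let mexpZ s : measurable_fun setT (fun w => expR (- (s * Z w))).
Proof.
apply: measurableT_comp => //; apply: measurableT_comp => //.
exact: measurable_funM.
Qed.

Let integrable_expZ s : -1 < s -> Q.-integrable setT (EFin \o (fun w => expR (- (s * Z w)))).
Proof.
move=> s1; apply/integrableP; split; first exact/measurable_EFinP.
under eq_integral do rewrite /= ger0_norm ?expR_ge0//.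
by rewrite gamma_laplace// ltry.
Qed.

Let mcosZ t b : measurable_fun setT (fun w => cos (t * Z w + b)).
Proof.
apply: measurableT_comp; first exact: measurable_cos.
by apply: measurable_funD => //; exact: measurable_funM.
Qed.

Let integrable_expcosZ s t b : -1 < s ->
  Q.-integrable setT (EFin \o (fun w => expR (- (s * Z w)) * cos (t * Z w + b))).
Proof.
move=> s1; apply: (le_integrable _ _ _ (integrable_expZ s1)) => //.
  by apply/measurable_EFinP; exact: measurable_funM.
by move=> w _ /=; rewrite lee_fin normrM ler_piMr// cos_max.
Qed.

Let gamma_scaling_cos s t b : -1 < s ->
  \int[Q]_w (expR (- (s * Z w)) * cos (t * Z w + b)) =
  expR (- (a * ln (1 + s))) * \int[Q]_w cos (t / (1 + s) * Z w + b).
Proof.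
move=> s1.
have icos u : Q.-integrable setT (EFin \o (fun w => cos (u * Z w + b))).
  apply: (@bounded_integrable _ _ _ _ _ 1) => // w; exact: cos_max.
(* The scaling identity is stated for nonnegative functions, hence [1 + cos]. *)
have h := @gamma_scaling (fun x => (1 + cos (t * x + b))%:E) s s1.
have m1cos : measurable_fun [set: R] (fun x => (1 + cos (t * x + b))%:E).
  apply/measurable_EFinP/measurable_funD => //; apply: measurableT_comp; first exact: measurable_cos.
  by apply: measurable_funD => //; apply: measurable_funM => //; exact: measurable_id.
have cosge x : -1 <= cos x :> R by have := cos_max x; rewrite ler_norml => /andP[].
have {}h := h m1cos (ltac:(by move=> x; rewrite lee_fin; have := cosge (t * x + b); lra)).
have L : \int[Q]_w ((1 + cos (t * Z w + b)) * expR (- (s * Z w))) =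
    expR (- (a * ln (1 + s))) + \int[Q]_w (expR (- (s * Z w)) * cos (t * Z w + b)).
  transitivity (\int[Q]_w (expR (- (s * Z w)) + expR (- (s * Z w)) * cos (t * Z w + b))).
    by apply: eq_Rintegral => w _; ring.
  rewrite RintegralD//; [|exact: integrable_expZ|exact: integrable_expcosZ].
  by rewrite {1}/Rintegral gamma_laplace.
have L' : \int[Q]_w (1 + cos (t * (Z w / (1 + s)) + b)) =
    1 + \int[Q]_w cos (t / (1 + s) * Z w + b).
  rewrite (_ : (fun w => _) = (fun w => cst 1 w + cos (t / (1 + s) * Z w + b))); last first.
    by apply/funext => w /=; congr (_ + cos (_ + _)); rewrite mulrA mulrAC.
  rewrite RintegralD//; last exact: finite_measure_integrable_cst.
  by rewrite Rintegral_cst//= probability_setT mulr1.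
move: h => /(congr1 fine); rewrite fineM//; last first.
  rewrite (_ : (fun w => _) = (fun w => (cst 1 w + cos (t / (1 + s) * Z w + b))%:E)); last first.
    by apply/funext => w /=; congr (_ + cos (_ + _))%:E; rewrite mulrA mulrAC.
  apply: integrable_fin_num => //.
  exact: integrableD (finite_measure_integrable_cst _ 1 measurableT) (icos _).
rewrite -/(Rintegral _ _ _) -/(Rintegral _ _ _) L' /= => h.
have : \int[Q]_w ((1 + cos (t * Z w + b)) * expR (- (s * Z w))) =
  expR (- (a * ln (1 + s))) * (1 + \int[Q]_w cos (t / (1 + s) * Z w + b)) by [].
by rewrite L mulrDr mulr1 => /addrI.
Qed.

(* Differentiating E[e^(- u r Z) cos ((t + v r) Z + b)] at r = 0; the two cases
   used are (u, v) = (1, 0) and (0, 1). *)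
Let derive_expcos (u v t b : R) : `|u| <= 1 -> `|v| <= 1 ->
  is_derive (0 : R) 1 (fun r => \int[Q]_w (expR (- (u * r * Z w)) * cos ((t + v * r) * Z w + b)))
    (\int[Q]_w (Z w * (- (u * cos (t * Z w + b)) - v * sin (t * Z w + b)))).
Proof.
move=> u1 v1.
pose f (r : R) w := expR (- (u * r * Z w)) * cos ((t + v * r) * Z w + b).
pose f' (r : R) w := expR (- (u * r * Z w)) * (Z w *
   (- (u * cos ((t + v * r) * Z w + b)) - v * sin ((t + v * r) * Z w + b))).
have df r w : is_derive r (1 : R) (f ^~ w) (f' r w).
  have h1 : is_derive r (1 : R) (fun r => expR (- (u * r * Z w))) (expR (- (u * r * Z w)) * (- (u * Z w))).
    have -> : (fun r => expR (- (u * r * Z w))) = (fun r => expR (0 + - (u * Z w) * r)).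
      by apply/funext => z; congr expR; ring.
    have -> : expR (- (u * r * Z w)) = expR (0 + - (u * Z w) * r) by congr expR; ring.
    by apply: is_derive_comp1; exact: is_derive_affine.
  have h2 : is_derive r (1 : R) (fun r => cos ((t + v * r) * Z w + b))
     (- sin ((t + v * r) * Z w + b) * (v * Z w)).
    have -> : (fun r => cos ((t + v * r) * Z w + b)) = (fun r => cos ((t * Z w + b) + (v * Z w) * r)).
      by apply/funext => z; congr cos; ring.
    have -> : sin ((t + v * r) * Z w + b) = sin ((t * Z w + b) + (v * Z w) * r) by congr sin; ring.
    by apply: is_derive_comp1; exact: is_derive_affine.
  apply: (is_derive_eq (is_derive_mul h1 h2)).
  by rewrite /f'; ring.
(* For [|r| < 1/4] the exponential is at most [e^(|Z|/4)], [|Z|] is at most [4 e^(|Z|/4)] and the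
   trigonometric factor at most 2, whence [8 e^(|Z|/2)]. The exponents [1/2] and [-1/2] lie in the
   range [s > -1] where the Laplace transform is finite. *)
pose G w := 8 * (expR (- (2^-1 * Z w)) + expR (- (- 2^-1 * Z w))).
have G0 w : 0 <= G w by rewrite mulr_ge0// addr_ge0 ?expR_ge0.
have iG : Q.-integrable setT (EFin \o G).
  apply: (@integrableZl _ _ _ Q _ measurableT 8 (EFin \o (fun w => expR (- (2^-1 * Z w)) + expR (- (- 2^-1 * Z w))))).
  have s1 : (-1 : R) < 2^-1 by lra.
  have s2 : (-1 : R) < - 2^-1 by lra.
  exact: (integrableD measurableT (integrable_expZ s1) (integrable_expZ s2)).
have I0 : `](- 4^-1), 4^-1[%classic (0 : R).
  by rewrite /= in_itv/=; apply/andP; split; lra.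
have intf x : `](- 4^-1 : R), 4^-1[%classic x -> Q.-integrable setT (EFin \o f x).
  rewrite /= in_itv/= => /andP[x1 x2].
  apply: (@integrable_expcosZ (u * x) (t + v * x) b).
  have : `|u * x| <= 4^-1.
    by rewrite normrM -[leRHS]mul1r ler_pM// ler_norml; apply/andP; split; lra.
  rewrite ler_norml => /andP[]; lra.
have pf r w : partial1of2 f r w = f' r w.
  by rewrite partial1of2E; exact: derive_val.
have der x w : `](- 4^-1 : R), 4^-1[%classic x -> [set: T] w -> derivable (f^~ w) x 1.
  by move=> _ _; have := df x w => /@ex_derive.
have ub x w : `](- 4^-1 : R), 4^-1[%classic x -> [set: T] w -> `|partial1of2 f x w| <= G w.
  rewrite /= in_itv/= => /andP[x1 x2] _; rewrite pf /f' normrM ger0_norm ?expR_ge0//.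
  have hu : `|u * x| <= 4^-1.
    by rewrite normrM -[leRHS]mul1r ler_pM// ler_norml; apply/andP; split; lra.
  set c := cos _; set s := sin _.
  have hcs : `|- (u * c) - v * s| <= 2.
    rewrite (le_trans (ler_normB _ _))// normrN !normrM.
    have h1 : `|u| * `|c| <= 1 by rewrite -[leRHS]mul1r ler_pM// cos_max.
    have h2 : `|v| * `|s| <= 1 by rewrite -[leRHS]mul1r ler_pM// sin_max.
    lra.
  have e1 : expR (- (u * x * Z w)) <= expR (4^-1 * `|Z w|).
    by rewrite ler_expR (le_trans (ler_norm _))// normrN normrM ler_wpM2r.
  have e2 : `|Z w| <= 4 * expR (4^-1 * `|Z w|).
    have := expR_ge1Dx (4^-1 * `|Z w|); lra.
  rewrite normrM.
  have e3 : expR (- (u * x * Z w)) * (`|Z w| * `|- (u * c) - v * s|) <=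
      expR (4^-1 * `|Z w|) * (4 * expR (4^-1 * `|Z w|) * 2).
    apply: ler_pM; [exact: expR_ge0|by rewrite mulr_ge0|exact: e1|by apply: ler_pM].
  rewrite (le_trans e3)// /G.
  have -> : expR (4^-1 * `|Z w|) * (4 * expR (4^-1 * `|Z w|) * 2) = 8 * expR (2^-1 * `|Z w|).
    have -> : 2^-1 * `|Z w| = 4^-1 * `|Z w| + 4^-1 * `|Z w| by field.
    by rewrite expRD; ring.
  rewrite ler_pM2l//.
  have [z0|z0] := leP 0 (Z w).
    by rewrite ger0_norm// mulNr opprK lerDr expR_ge0.
  by rewrite ltr0_norm// mulrN lerDl expR_ge0.
apply: DeriveDef.
  exact: (@derivable_under_integral _ _ _ Q f setT measurableT 0 _ _ I0 intf der G G0 iG ub).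
rewrite -derive1E (@differentiation_under_integral _ _ _ Q f setT measurableT 0 _ _ I0 intf der G G0 iG ub).
apply: eq_Rintegral => w _; rewrite pf /f' mulr0 mul0r oppr0 expR0 mul1r mulr0 addr0//.
Qed.

(** The phase [b] treats both transforms at once: [b = 0] gives the cosine and [b = - pi / 2] the
    sine. *)
Let C t b : R := \int[Q]_w cos (t * Z w + b).

Let integrable_Zsin t b : Q.-integrable setT (EFin \o (fun w => Z w * sin (t * Z w + b))).
Proof.
have s1 : (-1 : R) < 2^-1 by lra.
have s2 : (-1 : R) < - 2^-1 by lra.
pose G w := 2 * (expR (- (2^-1 * Z w)) + expR (- (- 2^-1 * Z w))).
have iG : Q.-integrable setT (EFin \o G).
  exact: (@integrableZl _ _ _ Q _ measurableT 2 _ (integrableD measurableT (integrable_expZ s1) (integrable_expZ s2))).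
apply: (le_integrable measurableT _ _ iG).
  apply/measurable_EFinP; apply: measurable_funM => //.
  apply: measurableT_comp; first exact: measurable_sin.
  by apply: measurable_funD => //; exact: measurable_funM.
move=> w _ /=; rewrite lee_fin normrM [leRHS]ger0_norm; last by rewrite mulr_ge0// addr_ge0 ?expR_ge0.
have := sin_max (t * Z w + b); set s := sin _ => hs.
have e2 : `|Z w| <= 2 * expR (2^-1 * `|Z w|) by have := expR_ge1Dx (2^-1 * `|Z w|); lra.
rewrite (le_trans (ler_piMr _ hs))// (le_trans e2)// /G ler_pM2l//.
have [z0|z0] := leP 0 (Z w).
  by rewrite ger0_norm// mulNr opprK lerDr expR_ge0.
by rewrite ltr0_norm// mulrN lerDl expR_ge0.
Qed.

Let derive_C t b : is_derive t (1 : R) (C ^~ b) (- \int[Q]_w (Z w * sin (t * Z w + b))).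
Proof.
have n0 : `|0 : R| <= 1 by rewrite normr0.
have n1 : `|1 : R| <= 1 by rewrite normr1.
have h := @derive_expcos 0 1 t b n0 n1.
have fE : (fun r => \int[Q]_w (expR (- (0 * r * Z w)) * cos ((t + 1 * r) * Z w + b))) =
   (fun r => C (t + 1 * r) b).
  by apply/funext => r; apply: eq_Rintegral => w _; rewrite !mul0r oppr0 expR0 mul1r.
rewrite fE in h.
have h2 : is_derive t (1 : R) (fun s => s - t) 1.
  have -> : (fun s => s - t) = (fun s => - t + 1 * s) by apply/funext => s; ring.
  exact: is_derive_affine.
have tt : t - t = 0 by rewrite subrr.
rewrite -[X in is_derive X]tt in h.
have := @is_derive_comp1 _ (fun r => C (t + 1 * r) b) (fun s => s - t) t _ _ h h2.
have -> : (fun z => C (t + 1 * (z - t)) b) = C ^~ b.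
  by apply/funext => z; congr C; ring.
move=> h3; apply: is_derive_eq h3 _; rewrite mulr1.
rewrite -[RHS]mulN1r -(RintegralZl (-1) measurableT (integrable_Zsin t b)).
by apply: eq_Rintegral => w _; ring.
Qed.

(** By [gamma_scaling_cos], [E[e^(-r Z) cos (t Z + b)]] equals [(1 + r)^(-a) C (t / (1 + r)) b]; the
    identity compares the derivatives of these two expressions at [r = 0]. *)
Let stein t b : \int[Q]_w (Z w * cos (t * Z w + b)) =
  a * C t b - t * \int[Q]_w (Z w * sin (t * Z w + b)).
Proof.
have n0 : `|0 : R| <= 1 by rewrite normr0.
have n1 : `|1 : R| <= 1 by rewrite normr1.
have h := @derive_expcos 1 0 t b n1 n0.
pose psi (r : R) := expR (- (a * ln (1 + r))) * C (t / (1 + r)) b.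
have dpsi : is_derive (0 : R) 1 psi (- (a * C t b) + t * \int[Q]_w (Z w * sin (t * Z w + b))).
  have h1 : is_derive (0 : R) (1 : R) (fun r => expR (0 + - a * ln (1 + 1 * r)))
      (expR (0 + - a * ln (1 + 1 * 0)) * (- a * ((1 + 1 * 0)^-1 * 1))).
    apply: is_derive_comp1.
    apply: (@is_derive_comp1 _ (fun z => 0 + - a * z)); first exact: is_derive_affine.
    apply: is_derive_comp1; last exact: is_derive_affine.
    by apply: is_derive1_ln; rewrite mulr0 addr0.
  have h2 : is_derive (0 : R) (1 : R) (fun r => C (t / (1 + 1 * r)) b)
      ((- \int[Q]_w (Z w * sin (t * Z w + b))) * - t).
    apply: (@is_derive_comp1 _ (C ^~ b)).
      by rewrite mulr0 addr0 divr1; exact: derive_C.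
    have -> : (fun r : R => t / (1 + 1 * r)) = (fun r : R => 0 + t * (1 + 1 * r)^-1).
      by apply/funext => r; rewrite add0r.
    have -> : - t = t * (- (1 + 1 * 0) ^- 2 *: (1 : R)).
      by rewrite mulr0 addr0 expr1n invr1 /GRing.scale/= mulr1 mulrN1.
    apply: (@is_derive_comp1 _ (fun z => 0 + t * z)); first exact: is_derive_affine.
    apply: is_deriveV; first by rewrite mulr0 addr0 oner_eq0.
    exact: is_derive_affine.
  have := is_derive_mul h1 h2.
  have -> : (fun z => expR (0 + - a * ln (1 + 1 * z)) * C (t / (1 + 1 * z)) b) = psi.
    by apply/funext => z; rewrite /psi !mul1r add0r mulNr.
  move=> h3; apply: is_derive_eq h3 _.
  by rewrite !mulr0 !addr0 ln1 mulr0 addr0 expR0 invr1 !mulr1; ring.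
have nearE : \forall r \near (0 : R), (fun r => \int[Q]_w (expR (- (1 * r * Z w)) * cos ((t + 0 * r) * Z w + b))) r = psi r.
  apply/nbhs_ballP; exists 1 => //= r; rewrite /ball/= sub0r normrN ltr_norml => /andP[r1 _].
  by rewrite mul1r mul0r addr0; exact: gamma_scaling_cos.
have {}h := near_eq_is_derive nearE h.
have := etrans (esym (@derive_val _ _ _ _ _ _ _ h)) (@derive_val _ _ _ _ _ _ _ dpsi).
have -> : \int[Q]_w (Z w * (- (1 * cos (t * Z w + b)) - 0 * sin (t * Z w + b))) =
    - \int[Q]_w (Z w * cos (t * Z w + b)).
  have -> : (fun w => Z w * cos (t * Z w + b)) =
      (fun w => Z w * sin (t * Z w + (b + pi / 2))).
    by apply/funext => w; rewrite addrA sinDpihalf.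
  rewrite -[RHS]mulN1r -(RintegralZl (-1) measurableT (integrable_Zsin t (b + pi / 2))).
  by apply: eq_Rintegral => w _; rewrite addrA sinDpihalf; ring.
by move=> /(congr1 -%R); rewrite opprK => ->; ring.
Qed.

Let ECos t := \int[Q]_w cos (t * Z w).
Let ESin t := \int[Q]_w sin (t * Z w).

Let CE t : C t 0 = ECos t.
Proof. by apply: eq_Rintegral => w _; rewrite addr0. Qed.

Let CS t : C t (- (pi / 2)) = ESin t.
Proof. by apply: eq_Rintegral => w _; rewrite cosBpihalf. Qed.

(** At the phases 0 and [- pi / 2], [stein] is a linear system in [E[Z cos (t Z)]] and
    [E[Z sin (t Z)]] of determinant [1 + t^2]. Its solution is the real form of
    [phi' = i a phi / (1 - i t)] for the characteristic function [phi]. *)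
Let derive_ECosSin t :
  is_derive t (1 : R) ECos (- (a * (ESin t + t * ECos t) / (1 + t ^+ 2))) /\
  is_derive t (1 : R) ESin (a * (ECos t - t * ESin t) / (1 + t ^+ 2)).
Proof.
pose P := \int[Q]_w (Z w * cos (t * Z w)); pose M := \int[Q]_w (Z w * sin (t * Z w)).
have MN : \int[Q]_w (Z w * sin (t * Z w + - (pi / 2))) = - P.
  have iP : Q.-integrable setT (EFin \o (fun w => Z w * cos (t * Z w))).
    have := @integrable_Zsin t (pi / 2).
    by under eq_fun do rewrite sinDpihalf.
  transitivity (-1 * P); last by rewrite mulN1r.
  rewrite /P -(RintegralZl (-1) measurableT iP).
  by apply: eq_Rintegral => w _; rewrite sinBpihalf; ring.
have M0 : \int[Q]_w (Z w * sin (t * Z w + 0)) = M.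
  by apply: eq_Rintegral => w _; rewrite addr0.
have hC := @derive_C t 0; rewrite M0 in hC.
have hS := @derive_C t (- (pi / 2)); rewrite MN opprK in hS.
have e1 : P = a * ECos t - t * M.
  rewrite -CE -M0 -stein; by apply: eq_Rintegral => w _; rewrite addr0.
have e2 : M = a * ESin t + t * P.
  rewrite -CS -[P]opprK -MN mulrN -stein; by apply: eq_Rintegral => w _; rewrite cosBpihalf.
have t2 : 1 + t ^+ 2 != 0 by rewrite gt_eqF// ltr_pwDl// sqr_ge0.
split.
- have <- : C ^~ 0 = ECos by apply/funext => z; exact: CE.
  apply: is_derive_eq hC _; congr (- _).
  apply: (mulIf t2); rewrite mulfVK//.
  by rewrite CE mulrDr mulr1 {1}e2 e1; ring.
- have <- : C ^~ (- (pi / 2)) = ESin by apply/funext => z; exact: CS.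
  apply: is_derive_eq hS _.
  apply: (mulIf t2); rewrite mulfVK//.
  by rewrite CS mulrDr mulr1 {1}e1 e2; ring.
Qed.

Let Edec t := expR (a / 2 * ln (1 + t * t)).
Let psi t := a * atan t.

Let one_sqr_gt0 (t : R) : 0 < 1 + t * t.
Proof. by rewrite ltr_pwDl// -expr2 sqr_ge0. Qed.

Let derive_Edec t : is_derive t (1 : R) Edec (Edec t * (a / 2 * ((1 + t * t)^-1 * (t + t)))).
Proof.
have hid : is_derive t (1 : R) (fun z : R => z) 1 by exact: is_derive_id.
have h1 : is_derive t (1 : R) (fun z : R => 1 + z * z) (t + t).
  have := is_derive_add (is_derive_cst (1 : R) t (1 : R)) (is_derive_mul hid hid).
  by move=> h; apply: is_derive_eq h _; rewrite !mulr1 add0r.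
apply: is_derive_comp1.
have h2 : is_derive t (1 : R) (fun z : R => ln (1 + z * z)) ((1 + t * t)^-1 * (t + t)).
  by apply: is_derive_comp1 => //; exact: is_derive1_ln.
have := is_derive_mul (is_derive_cst (a / 2) t (1 : R)) h2.
by move=> h; apply: is_derive_eq h _; rewrite /cst mulr0 addr0.
Qed.

(** [U] and [V] are the real and imaginary parts of [(1 - i t)^a] times the characteristic function;
    [Edec] and [- psi] are the modulus and argument of the power. The differential equation makes
    both constant. *)
Let U t := Edec t * (ECos t * cos (psi t) + ESin t * sin (psi t)).
Let V t := Edec t * (ESin t * cos (psi t) - ECos t * sin (psi t)).

Let UV_const t : U t = 1 /\ V t = 0.
Proof.
have U0 : U 0 = 1.
  rewrite /U /Edec /psi mulr0 addr0 ln1 mulr0 expR0 atan0 mulr0 cos0 sin0 mulr0 addr0 mulr1 mul1r.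
  rewrite /ECos; under eq_Rintegral do rewrite mul0r cos0.
  by rewrite Rintegral_cst//= probability_setT mulr1.
have V0 : V 0 = 0.
  rewrite /V /psi atan0 !mulr0 cos0 sin0 mulr0 subr0 mulr1.
  rewrite /ESin; under eq_Rintegral do rewrite mul0r sin0.
  by rewrite Rintegral_cst//= mul0r mulr0.
have dcs (s : R) : is_derive s (1 : R) (fun z => cos (psi z)) (- sin (psi s) * (a / (1 + s * s))) /\
    is_derive s (1 : R) (fun z => sin (psi z)) (cos (psi s) * (a / (1 + s * s))).
  by split; apply: is_derive_comp1.
rewrite -U0 -V0; split.
  apply: is_derive_0_is_cst => s.
  have [hC hS] := derive_ECosSin s; have [hc hs] := dcs s.
  have h := is_derive_mul (derive_Edec s)
    (is_derive_add (is_derive_mul hC hc) (is_derive_mul hS hs)).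
  apply: is_derive_eq h _; rewrite expr2; field.
  by rewrite -expr2 gt_eqF// expr2.
apply: is_derive_0_is_cst => s.
have [hC hS] := derive_ECosSin s; have [hc hs] := dcs s.
have h := is_derive_mul (derive_Edec s)
  (is_derive_sub (is_derive_mul hS hc) (is_derive_mul hC hs)).
apply: is_derive_eq h _; rewrite expr2; field.
by rewrite -expr2 gt_eqF// expr2.
Qed.

Lemma gamma_cos t : \int[Q]_w cos (t * Z w) =
  expR (- (a / 2 * ln (1 + t ^+ 2))) * cos (a * atan t).
Proof.
have [hU hV] := UV_const t; rewrite -/(ECos t) -/(psi t) expRN expr2 -/(Edec t).
have E0 : Edec t != 0 by rewrite gt_eqF// expR_gt0.
apply: (mulfI E0); rewrite mulrA divff// mul1r.
have cs := cos2Dsin2 (psi t).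
transitivity (Edec t * ECos t * (cos (psi t) ^+ 2 + sin (psi t) ^+ 2)); first by rewrite cs mulr1.
transitivity (cos (psi t) * U t - sin (psi t) * V t); first by rewrite /U /V; ring.
by rewrite hU hV; ring.
Qed.

Lemma gamma_sin t : \int[Q]_w sin (t * Z w) =
  expR (- (a / 2 * ln (1 + t ^+ 2))) * sin (a * atan t).
Proof.
have [hU hV] := UV_const t; rewrite -/(ESin t) -/(psi t) expRN expr2 -/(Edec t).
have E0 : Edec t != 0 by rewrite gt_eqF// expR_gt0.
apply: (mulfI E0); rewrite mulrA divff// mul1r.
have cs := cos2Dsin2 (psi t).
transitivity (Edec t * ESin t * (cos (psi t) ^+ 2 + sin (psi t) ^+ 2)); first by rewrite cs mulr1.
transitivity (sin (psi t) * U t + cos (psi t) * V t); first by rewrite /U /V; ring.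
by rewrite hU hV; ring.
Qed.

End gamma.

(** * Sums of independent Gamma variables *)

Section gamma_sums.
Context {R : realType} d (T : measurableType d) (Q : probability T R).
Variables (n : nat) (Z : nat -> {RV Q >-> R}) (alpha : nat -> R).
Hypothesis alpha_ge0 : forall i, 0 <= alpha i.
Hypothesis lawZ : forall i, (i < n)%N -> has_law Q (Z i) (gamma_law (alpha i)).
Hypothesis indZ : forall B : nat -> set R, (forall i, measurable (B i)) ->
  (Q (\big[setI/setT]_(0 <= i < n) (Z i @^-1` B i)) =
   \prod_(0 <= i < n) Q (Z i @^-1` B i))%E.

Let Zf i : T -> R := Z i.
Let mZ i : measurable_fun setT (Zf i).
Proof. exact: measurable_funPT. Qed.

Local Notation V y := (wsum Zf y).
Local Notation S := (tsum Zf).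

Let indVS y k : (k < n)%N -> indep Q (fun w => (V y k w, S k w)) (Zf k).
Proof. exact: indep_sums. Qed.

Let VS_recr y k w : V y k.+1 w = V y k w + y k * Zf k w /\ S k.+1 w = S k w + Zf k w.
Proof. by rewrite /wsum /tsum !big_nat_recr. Qed.

Let mV y k : measurable_fun setT (V y k). Proof. exact: measurable_wsum. Qed.
Let mS k : measurable_fun setT (S k). Proof. exact: measurable_tsum. Qed.

(** Weighting by [e^(-s S)] rescales every summand at once, hence the pair of sums jointly. The
    induction freezes the earlier sums, rescales [Z k] alone by [gamma_scaling], and applies the
    induction hypothesis to the average over [Z k]. *)
Lemma gamma_sums_scaling y k (f : R -> R -> \bar R) (s : R) : (k <= n)%N -> -1 < s ->
  measurable_fun setT (fun z : R * R => f z.1 z.2) -> (forall u v, 0 <= f u v)%E ->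
  (\int[Q]_w (f (V y k w) (S k w) * (expR (- (s * S k w)))%:E) =
   (expR (- ((\sum_(0 <= i < k) alpha i) * ln (1 + s))))%:E *
   \int[Q]_w f (V y k w / (1 + s))%R (S k w / (1 + s))%R)%E.
Proof.
move=> + s1; elim: k f => [f _ mf f0|k ih f kn mf f0].
  rewrite big_geq// mul0r oppr0 expR0 mul1e; apply: eq_integral => w _.
  by rewrite /wsum /tsum !big_geq// mulr0 oppr0 expR0 mule1 !mul0r.
have {}ih := ih _ (ltnW kn).
have mfst2 : measurable_fun setT (fun z : (R * R) * R => z.1.1).
  exact: (measurableT_comp measurable_fst measurable_fst).
have msnd2 : measurable_fun setT (fun z : (R * R) * R => z.1.2).
  exact: (measurableT_comp measurable_snd measurable_fst).
have mexp d' (T' : measurableType d') (g : T' -> R) : measurable_fun setT g ->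
    measurable_fun setT (fun z => (expR (- (s * g z)))%:E).
  move=> mg; apply/measurable_EFinP; apply: measurableT_comp => //.
  by apply: measurableT_comp => //; exact: measurable_funM.
have mpair d' (T' : measurableType d') (g h : T' -> R) : measurable_fun setT g ->
    measurable_fun setT h -> measurable_fun setT (fun z => f (g z) (h z)).
  move=> mg mh; apply: (@measurableT_comp _ _ _ _ _ _ (fun z : R * R => f z.1 z.2) _ (fun z => (g z, h z))) => //.
  exact: measurable_fun_pair.
have mVSk : measurable_fun setT (fun w => (V y k w, S k w)).
  exact: measurable_fun_pair.
pose F (z : (R * R) * R) := (f (z.1.1 + y k * z.2)%R (z.1.2 + z.2)%R *
  ((expR (- (s * z.1.2)))%:E * (expR (- (s * z.2)))%:E))%E.
have mF : measurable_fun setT F.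
  apply: emeasurable_funM; last by apply: emeasurable_funM; exact: mexp.
  by apply: mpair; apply: measurable_funD => //; exact: measurable_funM.
have F0 z : (0 <= F z)%E by rewrite mule_ge0// mule_ge0// lee_fin expR_ge0.
transitivity (\int[Q]_w F ((V y k w, S k w), Zf k w))%E.
  apply: eq_integral => w _; rewrite /F/=; have [-> ->] := VS_recr y k w.
  by rewrite -EFinM -expRD; congr (_ * (expR _)%:E)%E; ring.
rewrite (indep_integral mVSk (mZ k) (indVS y kn) mF F0).
pose f2 (u v : R) : \bar R := (\int[Q]_w f (u + y k * (Zf k w / (1 + s)))%R (v + Zf k w / (1 + s))%R)%E.
have f20 u v : (0 <= f2 u v)%E by apply: integral_ge0.
have mdiv : measurable_fun setT (fun w => Zf k w / (1 + s)).
  exact: measurable_funM (mZ k) (measurable_cst _).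
pose F2 (z : (R * R) * T) :=
   f (z.1.1 + y k * (Zf k z.2 / (1 + s)))%R (z.1.2 + Zf k z.2 / (1 + s))%R.
have mF2 : measurable_fun setT F2.
  have m1 : measurable_fun setT (fun z : (R * R) * T => Zf k z.2 / (1 + s)).
    exact: (measurableT_comp mdiv measurable_snd).
  apply: mpair; apply: measurable_funD => //.
  - exact: (measurableT_comp measurable_fst measurable_fst).
  - exact: measurable_funM.
  - exact: (measurableT_comp measurable_snd measurable_fst).
have mf2 : measurable_fun setT (fun z : R * R => f2 z.1 z.2).
  exact: (measurable_fun_fubini_tonelli_F (m2 := Q) F2 mF2 (fun z => f0 _ _)).
have inner w : (\int[Q]_w' F ((V y k w, S k w), Zf k w') =
   (expR (- (alpha k * ln (1 + s))))%:E * (f2 (V y k w) (S k w) * (expR (- (s * S k w)))%:E))%E.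
  have mfz : measurable_fun setT (fun z : R => f (V y k w + y k * z) (S k w + z)).
    by apply: mpair; apply: measurable_funD => //; exact: measurable_funM.
  rewrite /F/=.
  under eq_integral do rewrite muleCA.
  have mG : measurable_fun setT (fun w' => f (V y k w + y k * Zf k w')%R (S k w + Zf k w')%R *
      (expR (- (s * Zf k w')))%:E)%E.
    by apply: emeasurable_funM; [exact: (measurableT_comp mfz (mZ k))|exact: mexp].
  have G0 w' : (0 <= f (V y k w + y k * Zf k w')%R (S k w + Zf k w')%R *
      (expR (- (s * Zf k w')))%:E)%E by rewrite mule_ge0// lee_fin expR_ge0.
  rewrite ge0_integralZl_EFin ?expR_ge0//.
  rewrite (gamma_scaling (alpha_ge0 k) (lawZ kn) s1 mfz)//.
  by rewrite muleCA; congr (_ * _)%E; rewrite muleC.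
under eq_integral do rewrite inner.
have mG2 : measurable_fun setT (fun w => f2 (V y k w) (S k w) * (expR (- (s * S k w)))%:E)%E.
  by apply: emeasurable_funM; [exact: (measurableT_comp mf2 mVSk)|apply: mexp; exact: mS].
have G20 w : (0 <= f2 (V y k w) (S k w) * (expR (- (s * S k w)))%:E)%E.
  by rewrite mule_ge0// lee_fin expR_ge0.
rewrite ge0_integralZl_EFin ?expR_ge0//.
rewrite (ih f2 mf2 f20) muleA -EFinM -expRD big_nat_recr//=; congr (_ * _)%E.
  by congr (expR _)%:E; ring.
pose F3 (z : (R * R) * R) := f ((z.1.1 + y k * z.2) / (1 + s))%R ((z.1.2 + z.2) / (1 + s))%R.
have mF3 : measurable_fun setT F3.
  by apply: mpair; apply: measurable_funM => //; apply: measurable_funD => //; exact: measurable_funM.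
transitivity (\int[Q]_w \int[Q]_w' F3 ((V y k w, S k w), Zf k w'))%E.
  apply: eq_integral => w _; rewrite /f2 /F3/=; apply: eq_integral => w' _.
  by congr f; rewrite mulrDl// mulrA.
rewrite -(indep_integral mVSk (mZ k) (indVS y kn) mF3 (fun z => f0 _ _)).
by apply: eq_integral => w _; rewrite /F3/=; have [-> ->] := VS_recr y k w.
Qed.

Lemma gamma_sums_laplace y k : (k <= n)%N -> (forall i, -1 < y i) ->
  (\int[Q]_w (expR (- V y k w))%:E =
   (expR (- (\sum_(0 <= i < k) alpha i * ln (1 + y i))))%:E)%E.
Proof.
move=> + y1; elim: k => [_|k ih kn].
  rewrite big_geq// oppr0 expR0; under eq_integral do rewrite /wsum big_geq// oppr0 expR0.
  by rewrite integral_cst//= probability_setT mule1.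
have mVSk : measurable_fun setT (fun w => (V y k w, S k w)).
  exact: measurable_fun_pair.
have mN (c : R) : measurable_fun [set: R] (fun z : R => (expR (- (c * z)))%:E).
  apply/measurable_EFinP; apply: measurableT_comp => //.
  by apply: measurableT_comp => //; exact: measurable_funM.
have mN1 : measurable_fun setT (fun z : R * R => (expR (- z.1))%:E).
  apply/measurable_EFinP; apply: measurableT_comp => //.
  by apply: measurableT_comp => //; exact: measurable_fst.
transitivity (\int[Q]_w ((expR (- (V y k w, S k w).1))%:E * (expR (- (y k * Zf k w)))%:E))%E.
  apply: eq_integral => w _; have [-> _] := VS_recr y k w.
  by rewrite opprD expRD EFinM.
rewrite (indep_ge0_mul mVSk (mZ k) (indVS y kn) mN1 (mN (y k))); last 2 first.
- by move=> z; rewrite lee_fin expR_ge0.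
- by move=> z; rewrite lee_fin expR_ge0.
rewrite ih ?(ltnW kn)// (gamma_laplace (alpha_ge0 k) (lawZ kn) (y1 k)) -EFinM -expRD.
by rewrite big_nat_recr//= opprD.
Qed.

(** [damp] and [phase] are the modulus and the argument of the product of the factors
    [(1 - i y j)^(- alpha j)]. *)
Let damp y k := expR (- (2^-1 * \sum_(0 <= i < k) alpha i * ln (1 + y i ^+ 2))).
Let phase y k := \sum_(0 <= i < k) alpha i * atan (y i).

Lemma gamma_sums_trig y k : (k <= n)%N ->
  \int[Q]_w cos (V y k w) = damp y k * cos (phase y k) /\
  \int[Q]_w sin (V y k w) = damp y k * sin (phase y k).
Proof.
elim: k => [_|k ih kn].
  rewrite /damp /phase !big_geq// mulr0 oppr0 expR0 cos0 sin0 mulr0 mulr1; split.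
    under eq_Rintegral do rewrite /wsum big_geq// cos0.
    by rewrite Rintegral_cst//= probability_setT mulr1.
  under eq_Rintegral do rewrite /wsum big_geq// sin0.
  by rewrite Rintegral_cst//= mul0r.
have {ih} [ihc ihs] := ih (ltnW kn).
have mVSk : measurable_fun setT (fun w => (V y k w, S k w)).
  exact: measurable_fun_pair.
have m1 (g : R -> R) : measurable_fun setT g -> measurable_fun setT (fun z : R * R => g z.1).
  by move=> mg; exact: (measurableT_comp mg measurable_fst).
have m2 (g : R -> R) : measurable_fun setT g -> measurable_fun setT (fun z : R => g (y k * z)).
  by move=> mg; apply: measurableT_comp => //; exact: measurable_funM.
have prodE (g h : R -> R) : measurable_fun setT g -> measurable_fun setT h ->
    (forall x, `|g x| <= 1) -> (forall x, `|h x| <= 1) ->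
    \int[Q]_w (g (V y k w) * h (y k * Zf k w)) =
    \int[Q]_w g (V y k w) * \int[Q]_w h (y k * Zf k w).
  move=> mg mh g1 h1.
  by apply: (@indep_bounded_mul _ _ _ Q _ _ _ _ _ _ (fun z : R * R => g z.1) (fun z => h (y k * z)) 1 mVSk (mZ k) (indVS y kn) (m1 g mg) (m2 h mh)).
have iprod (g h : R -> R) : measurable_fun setT g -> measurable_fun setT h ->
    (forall x, `|g x| <= 1) -> (forall x, `|h x| <= 1) ->
    Q.-integrable setT (EFin \o (fun w => g (V y k w) * h (y k * Zf k w))).
  move=> mg mh g1 h1; apply: (@bounded_integrable _ _ _ _ _ 1).
    apply: measurable_funM; first exact: measurableT_comp.
    exact: (measurableT_comp (m2 h mh) (mZ k)).
  by move=> w; rewrite normrM mulr_ile1.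
have mc := @measurable_cos R; have ms := @measurable_sin R.
have c1 := @cos_max R; have s1 := @sin_max R.
have dE : damp y k.+1 = damp y k * expR (- (alpha k / 2 * ln (1 + y k ^+ 2))).
  by rewrite /damp big_nat_recr//= -expRD; congr expR; field.
have pE : phase y k.+1 = phase y k + alpha k * atan (y k) by rewrite /phase big_nat_recr.
have hc := gamma_cos (alpha_ge0 k) (lawZ kn) (y k).
have hs := gamma_sin (alpha_ge0 k) (lawZ kn) (y k).
rewrite dE pE cosD sinD; split.
  transitivity (\int[Q]_w (cos (V y k w) * cos (y k * Zf k w) - sin (V y k w) * sin (y k * Zf k w))).
    by apply: eq_Rintegral => w _; have [-> _] := VS_recr y k w; rewrite cosD.
  rewrite (RintegralB measurableT (iprod _ _ mc mc c1 c1) (iprod _ _ ms ms s1 s1)).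
  by rewrite !prodE// ihc ihs hc hs; ring.
transitivity (\int[Q]_w (sin (V y k w) * cos (y k * Zf k w) + cos (V y k w) * sin (y k * Zf k w))).
  by apply: eq_Rintegral => w _; have [-> _] := VS_recr y k w; rewrite sinD.
rewrite (RintegralD measurableT (iprod _ _ ms mc s1 c1) (iprod _ _ mc ms c1 s1)).
by rewrite !prodE// ihc ihs hc hs; ring.
Qed.

Lemma gamma_sum_laplace (s : R) : -1 < s ->
  (\int[Q]_w (expR (- (s * S n w)))%:E =
   (expR (- ((\sum_(0 <= i < n) alpha i) * ln (1 + s))))%:E)%E.
Proof.
move=> s1; have := @gamma_sums_laplace (fun=> s) n (leqnn n) (fun=> s1).
rewrite big_distrl/= => <-; apply: eq_integral => w _.
by rewrite /wsum /tsum big_distrr.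
Qed.

Lemma gamma_sum_lt0 : Q (S n @^-1` `]-oo, 0[) = 0%E.
Proof.
apply/eqP; rewrite eq_le measure_ge0 andbT.
have mB : measurable (\bigcup_(i < n) (Zf i @^-1` `]-oo, 0[)).
  by apply: bigcup_measurable => i _; exact: measurable_preimageT.
rewrite (@le_trans _ _ (Q (\bigcup_(i < n) (Zf i @^-1` `]-oo, 0[))))//.
  rewrite le_measure ?inE//; first exact: measurable_preimageT.
  move=> w /=; rewrite in_itv/=; apply: contraPP => hw; apply/negP; rewrite -leNgt /tsum.
  rewrite big_seq sumr_ge0// => i; rewrite mem_index_iota => /andP[_ ilt].
  by rewrite leNgt; apply/negP => zi; apply: hw; exists i => //=; rewrite in_itv.
rewrite (@bigcup_mkord _ n (fun i => Zf i @^-1` `]-oo, 0[)).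
have mZ0 i : (i < n)%N -> measurable (Zf i @^-1` `]-oo, 0[).
  by move=> _; exact: measurable_preimageT.
have hB := Boole_inequality Q mZ0.
apply: (le_trans hB).
rewrite big1// => i _; exact: (gamma_lt0 (lawZ (ltn_ord i))).
Qed.

(* The joint Laplace transform of the total and the indicator of an event on
   the ratio factorizes because ratios are invariant under scaling. *)
Lemma indep_gamma_sum_ratio y : indep Q (S n) (fun w => V y n w / S n w).
Proof.
move=> A B mA mB.
have mr : measurable_fun setT (fun z : R * R => z.1 / z.2).
  apply: measurable_funM; first exact: measurable_fst.
  exact: (measurableT_comp (@measurable_inv R) measurable_snd).
have mratio : measurable_fun setT (fun w => V y n w / S n w).
  exact: (measurableT_comp mr (measurable_fun_pair (mV y n) (mS n))).
have mRB : measurable ((fun w => V y n w / S n w) @^-1` B) by exact: measurable_preimageT.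
set E := _ @^-1` B in mRB *.
have c0 : 0 <= fine (Q E) by rewrite fine_ge0.
have QE : (fine (Q E))%:E = Q E by rewrite fineK// fin_num_measure.
(* For a fixed event [E] on the ratio, the law of the total restricted to [E] and [Q E] times the
   law of the total are compared through their Laplace transforms. *)
have h C : measurable C ->
    mrestr Q mRB (S n @^-1` C) = mscale (NngNum c0) Q (S n @^-1` C).
  apply: (laplace_unique (mS n) (mS n)).
  - transitivity (Q (S n @^-1` `]-oo, 0%R[ `&` E)); first by [].
    apply/eqP; rewrite eq_le measure_ge0 andbT -gamma_sum_lt0 le_measure ?inE//.
    + by apply: measurableI => //; exact: measurable_preimageT.
    + exact: measurable_preimageT.
  - transitivity ((fine (Q E))%:E * Q (S n @^-1` `]-oo, 0%R[))%E; first by [].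
    by rewrite gamma_sum_lt0 mule0.
  move=> k.
  have k1 : (-1 : R) < k%:R by rewrite (@lt_le_trans _ _ 0)// ltrN10.
  have me : measurable_fun setT (fun w => (expR (- (k%:R * S n w)))%:E).
    apply/measurable_EFinP; apply: measurableT_comp => //.
    by apply: measurableT_comp => //; exact: measurable_funM.
  rewrite ge0_integral_mscale//= QE gamma_sum_laplace//.
  rewrite (@ge0_integral_density R _ _ (mrestr Q mRB) Q \1_E) //; last first.
    move=> D mD; rewrite /mrestr integral_indic// setIC//.
  have mfB : measurable_fun setT (fun z : R * R => (\1_B (z.1 / z.2) : R)%:E).
    have mI := @measurable_indic _ _ R setT B mB.
    by apply/measurable_EFinP; exact: (measurableT_comp mI mr).
  have := @gamma_sums_scaling y n (fun u v => (\1_B (u / v))%:E) k%:R (leqnn n) k1 mfB.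
  have scaleinv w : V y n w / (1 + k%:R) / (S n w / (1 + k%:R)) = V y n w / S n w.
    by rewrite invf_div mulrA -(mulrA _ _^-1) mulVf// mulr1.
  have -> : (fun w => ((\1_B (V y n w / (1 + k%:R) / (S n w / (1 + k%:R))) : R))%:E) = (fun w => (\1_E w)%:E).
    by apply/funext => w; rewrite scaleinv !indicE.
  rewrite integral_indic// setIT [RHS]muleC => <- //.
  apply: eq_integral => w _; rewrite muleC; congr (_%:E * _)%E; by rewrite !indicE.
have := h A mA; rewrite /mscale/= QE /mrestr => ->; by rewrite muleC.
Qed.

End gamma_sums.

(** * Integrals of simple functions against a Dirichlet process *)

Section simple_partition.
Context {R : realType}.
Import HBNNSimple.

(** Repetitions are removed from the list of values so that the level sets form an indexed
    partition. The last clause allows any finite measure because it is applied both to the base law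
    [H] and to each realization [D w]. *)
Lemma simple_partition (h : {nnsfun R >-> R}) :
  exists n (y : 'I_n -> R),
  [/\ injective y, forall x, exists i, h x = y i, forall i, 0 <= y i &
   forall (mu : {measure set R -> \bar R}) (G : R -> R), (mu setT < +oo)%E ->
     \int[mu]_x G (h x) = \sum_(i < n) G (y i) * fine (mu (h @^-1` [set y i]))].
Proof.
have /finite_seqP[s0 s0E] := fimfunP h.
pose s := undup s0.
have sP x : h x \in s.
  rewrite mem_undup; have : range h (h x) by exists x.
  by rewrite s0E.
exists (size s), (fun i => s`_i).
have inj : injective (fun i : 'I_(size s) => s`_i).
  move=> i j /eqP; rewrite nth_uniq// ?undup_uniq//.
  by move=> /eqP ij; exact/val_inj.
split => //.
- move=> x; have hx := sP x.
  have hi : (index (h x) s < size s)%N by rewrite index_mem.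
  by exists (Ordinal hi); rewrite /= nth_index.
- move=> i; have : s`_i \in s by rewrite mem_nth.
  rewrite mem_undup => si; have : range h s`_i by rewrite s0E.
  by move=> [x _ <-].
move=> mu G foo.
have hE x : G (h x) = \sum_(i < size s) G s`_i * \1_(h @^-1` [set s`_i]) x.
  have hx := sP x.
  have hi : (index (h x) s < size s)%N by rewrite index_mem.
  rewrite (bigD1 (Ordinal hi))//= nth_index// indicE mem_set//= mulr1 big1 ?addr0// => j ji.
  rewrite indicE memNset ?mulr0//= => hj; move/negP: ji; apply; apply/eqP; apply: inj => /=.
  by rewrite nth_index// -hj.
have finA i : mu (h @^-1` [set s`_i]) \is a fin_num.
  rewrite ge0_fin_numE// (le_lt_trans _ foo)// le_measure// inE//.
rewrite /Rintegral; under eq_integral do rewrite hE -sumEFin.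
rewrite integral_sum//; last first.
  move=> i; apply: (@integrableZl _ _ _ mu _ measurableT _ (EFin \o \1_(h @^-1` [set s`_i]))).
  apply/integrableP; split; first exact/measurable_EFinP.
  under eq_integral do rewrite /= ger0_norm//.
  by rewrite integral_indic// setIT ltey_eq finA.
rewrite -[RHS]/(fine (\sum_(i < size s) G s`_i * fine (mu (h @^-1` [set s`_i])))%:E).
congr fine; rewrite -sumEFin; apply: eq_bigr => i _.
under eq_integral do rewrite EFinM.
rewrite integralZl//; last first.
  apply/integrableP; split; first exact/measurable_EFinP.
  under eq_integral do rewrite /= ger0_norm//.
  by rewrite integral_indic// setIT ltey_eq finA.
by rewrite integral_indic// setIT EFinM fineK.
Qed.

End simple_partition.

Section dirichlet_simple.
Context {R : realType} d (T : measurableType d) (P : probability T R).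
Variables (theta : R) (H : probability R R) (D : R.-pker T ~> R).
Hypotheses (theta_ge0 : 0 <= theta) (hD : dirichlet_process P theta H D).
Import HBNNSimple.

(** On the partition into level sets of [h] the process is a vector of normalized Gamma variables,
    so its integral of [h] is a weighted sum over the total. The total has shape [theta] because [H]
    has mass 1. The conclusion collects what is needed of the Gamma variables and hides the
    partition. *)
Lemma dirichlet_simple (h : {nnsfun R >-> R}) :
  exists (d' : measure_display) (T' : measurableType d') (Q : probability T' R)
    (V S : T' -> R),
  (measurable_fun setT V /\ measurable_fun setT S) /\
  [/\ forall U, measurable U ->
        P ((fun w => \int[D w]_x h x) @^-1` U) = Q ((fun w => V w / S w) @^-1` U),
      indep Q S (fun w => V w / S w),
      Q (S @^-1` `]-oo, 0[) = 0%E,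
      forall (f : R -> \bar R) s, measurable_fun setT f -> (forall x, 0 <= f x)%E ->
        -1 < s -> (\int[Q]_w (f (S w) * (expR (- (s * S w)))%:E) =
        (expR (- (theta * ln (1 + s))))%:E * \int[Q]_w f (S w / (1 + s))%R)%E &
      [/\ forall s, 0 <= s -> (\int[Q]_w (expR (- (s * V w)))%:E =
        (expR (- (theta * \int[H]_x ln (1 + s * h x))))%:E)%E,
        forall t, \int[Q]_w cos (t * S w) =
          expR (- (theta / 2 * ln (1 + t ^+ 2))) * cos (theta * atan t) &
        forall t x, \int[Q]_w cos (t * (V w - x * S w)) =
          expR (- (theta / 2 * \int[H]_z ln (1 + (t * (h z - x)) ^+ 2))) *
          cos (theta * \int[H]_z atan (t * (h z - x)))]].
Proof.
have [n [y [inj hy y0 intE]]] := simple_partition h.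
pose A (i : 'I_n) := h @^-1` [set y i].
have mA i : measurable (A i) by exact: measurable_sfunP.
have tA : trivIset setT A.
  by move=> i j _ _ [x [/= hi hj]]; apply: inj; rewrite -hi -hj.
have cA : \bigcup_i A i = setT.
  by apply/seteqP; split => // x _; have [i hi] := hy x; exists i.
have [d' [T' [Q [Z [lawZ indZ nuE]]]]] := hD mA tA cA.
pose alpha i := theta * fine (H (A i)).
have HT : (H setT < +oo)%E by rewrite probability_setT ltry.
have intH (G : R -> R) : theta * \int[H]_x G (h x) = \sum_(i < n) alpha i * G (y i).
  by rewrite intE// big_distrr/=; apply: eq_bigr => i _; rewrite /alpha; ring.
have sumA : \sum_(i < n) alpha i = theta.
  have := intH (fun=> 1); rewrite Rintegral_cst//= probability_setT !mulr1 => ->.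
  by apply: eq_bigr => i _; rewrite mulr1.
(* Families indexed by ['I_n] are prolonged to all integers by the zero variable and the parameter
   0, as the results on partial sums are indexed by [nat]. *)
pose ext (Y : Type) (y0 : Y) (f : 'I_n -> Y) (i : nat) := if insub i is Some j then f j else y0.
have extE (Y : Type) (z : Y) (f : 'I_n -> Y) (i : 'I_n) : ext Y z f i = f i.
  by rewrite /ext valK.
pose Z' : nat -> {RV Q >-> R} := ext _ (cst 0 : {mfun T' >-> R}) Z.
pose al := ext _ 0 alpha.
have al0 i : 0 <= al i.
  by rewrite /al /ext; case: insub => // j; rewrite mulr_ge0// fine_ge0.
have lawZ' i : (i < n)%N -> has_law Q (Z' i) (gamma_law (al i)).
  by move=> ilt; have := lawZ (Ordinal ilt); rewrite -(extE _ (cst 0 : {mfun T' >-> R}) Z) -[theta * _]/(alpha _) -(extE _ 0 alpha).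
have indZ' (B : nat -> set R) : (forall i, measurable (B i)) ->
    (Q (\big[setI/setT]_(0 <= i < n) (Z' i @^-1` B i)) =
    \prod_(0 <= i < n) Q (Z' i @^-1` B i))%E.
  move=> mB; rewrite !big_mkord -(bigcap_mkord n (fun i => Z' i @^-1` B i)).
  have := indZ (fun i : 'I_n => B i) (fun i => mB i).
  have -> : \bigcap_i (Z i @^-1` B i) = \bigcap_(i < n) (Z' i @^-1` B i).
    apply/seteqP; split => w hw i /=.
      by move=> ilt; have := hw (Ordinal ilt) I; rewrite -(extE _ (cst 0 : {mfun T' >-> R}) Z).
    by move=> _; have := hw i (ltn_ord i); rewrite /= /Z' extE.
  by move=> ->; apply: eq_bigr => i _; rewrite /Z' extE.
pose Zf i : T' -> R := Z' i.
have sumE (F : 'I_n -> R) (u : 'I_n -> R) : \sum_(0 <= i < n) ext _ 0 u i * ext _ 0 F i = \sum_(i < n) u i * F i.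
  by rewrite big_mkord; apply: eq_bigr => i _; rewrite !extE.
have wsumE u w : wsum Zf (ext _ 0 u) n w = \sum_(i < n) u i * Z i w.
  by rewrite /wsum big_mkord; apply: eq_bigr => i _; rewrite /Zf /Z' !extE.
have tsumE w : tsum Zf n w = \sum_(i < n) Z i w.
  by rewrite /tsum big_mkord; apply: eq_bigr => i _; rewrite /Zf /Z' !extE.
have alsum : \sum_(0 <= i < n) al i = theta.
  by rewrite big_mkord -sumA; apply: eq_bigr => i _; rewrite /al extE.
exists d', T', Q, (wsum Zf (ext _ 0 y) n), (tsum Zf n); split.
  by split; [exact: measurable_wsum|exact: measurable_tsum].
split.
- move=> U mU.
  pose g (t : n.-tuple R) := \sum_(i < n) y i * tnth t i.
  have mg : measurable_fun setT g.
    by apply: measurable_sum => i; apply: measurable_funM => //; exact: measurable_tnth.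
  have := nuE (g @^-1` U) (measurable_preimageT mg mU).
  rewrite /pushforward.
  have -> : (fun w => [tuple fine (D w (A i)) | i < n]) @^-1` (g @^-1` U) =
      (fun w => \int[D w]_x h x) @^-1` U.
    have gE w : g [tuple fine (D w (A i)) | i < n] = \int[D w]_x h x.
      have DT : (D w setT < +oo)%E by rewrite prob_kernel ltry.
      rewrite (intE (D w) id DT); apply: eq_bigr => i _; by rewrite tnth_mktuple.
    by apply/seteqP; split => w /=; rewrite gE.
  move=> ->; congr (Q _).
  have gE w : g [tuple Z i w / \sum_(j < n) Z j w | i < n] =
      wsum Zf (ext _ 0 y) n w / tsum Zf n w.
    rewrite wsumE tsumE mulr_suml; apply: eq_bigr => i _; by rewrite tnth_mktuple mulrA.
  by apply/seteqP; split => w /=; rewrite gE.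
- exact: (indep_gamma_sum_ratio al0 lawZ' indZ').
- exact: (gamma_sum_lt0 lawZ').
- move=> f s mf f0 s1.
  have mf2 : measurable_fun setT (fun z : R * R => f z.2).
    exact: (measurableT_comp mf measurable_snd).
  have := @gamma_sums_scaling _ _ _ _ _ _ _ al0 lawZ' indZ' (fun=> 0) n (fun _ v => f v) s
    (leqnn n) s1 mf2.
  by rewrite alsum; apply.
split.
- move=> s s0.
  have y1 i : -1 < ext _ 0 (fun j => s * y j) i.
    rewrite /ext; case: insub => [j|]; last by rewrite (ltrN10 R).
    by rewrite (lt_le_trans (ltrN10 R))// mulr_ge0.
  have := gamma_sums_laplace al0 lawZ' indZ' (leqnn n) y1.
  rewrite big_mkord (intH (fun z => ln (1 + s * z))).
  under [X in _ = (expR (- X))%:E -> _]eq_bigr do rewrite /al !extE.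
  move=> <-; apply: eq_integral => w _; rewrite !wsumE big_distrr/=.
  by congr (expR (- _))%:E; apply: eq_bigr => i _; ring.
- move=> t.
  have [+ _] := gamma_sums_trig al0 lawZ' indZ' (ext _ 0 (fun=> t)) (leqnn n).
  rewrite !big_mkord.
  have -> : \sum_(i < n) al i * ln (1 + ext _ 0 (fun=> t) i ^+ 2) = theta * ln (1 + t ^+ 2).
    by rewrite -sumA big_distrl; apply: eq_bigr => i _; rewrite /al !extE.
  have -> : \sum_(i < n) al i * atan (ext _ 0 (fun=> t) i) = theta * atan t.
    by rewrite -sumA big_distrl; apply: eq_bigr => i _; rewrite /al !extE.
  have -> : 2^-1 * (theta * ln (1 + t ^+ 2)) = theta / 2 * ln (1 + t ^+ 2) by ring.
  move=> <-; apply: eq_Rintegral => w _; rewrite wsumE tsumE big_distrr//.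
move=> t x.
have [+ _] := gamma_sums_trig al0 lawZ' indZ' (ext _ 0 (fun j => t * (y j - x))) (leqnn n).
rewrite !big_mkord (intH (fun z => atan (t * (z - x)))).
have -> : theta / 2 * \int[H]_z ln (1 + (t * (h z - x)) ^+ 2) =
    2^-1 * \sum_(i < n) alpha i * ln (1 + (t * (y i - x)) ^+ 2).
  by rewrite -(intH (fun z => ln (1 + (t * (z - x)) ^+ 2))); ring.
under eq_bigr do rewrite /al !extE.
under [X in _ * cos X]eq_bigr do rewrite /al !extE.
move=> <-; apply: eq_Rintegral => w _; rewrite !wsumE tsumE.
congr cos; rewrite mulrBr !big_distrr/= -sumrB; apply: eq_bigr => i _; ring.
Qed.

End dirichlet_simple.

(** * Two improper integrals and the moments of the total *)

Section improper_integrals.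
Context {R : realType}.
Local Notation leb := (@lebesgue_measure R).

(** The integrand is the derivative of [- e^(- a G)], which rises from -1 to 0. The two cases used
    are [G u = u] and [G u = ln (1 + u)]. *)
Lemma integral_expR_primitive (a : R) (G g : R -> R) : 0 < a ->
  (forall x : R, 0 <= x -> is_derive x (1 : R) G (g x)) -> (forall x, 0 <= x -> 0 <= g x) ->
  (forall x, 0 <= x -> {for x, continuous g}) -> G 0 = 0 -> G x @[x --> +oo] --> +oo ->
  (\int[leb]_(u in `[0%R, +oo[) (a * g u * expR (- (a * G u)))%:E = 1)%E.
Proof.
move=> a0 dG g0 cg G0 Gy.
have dE (x : R) : 0 <= x -> is_derive x (1 : R) (fun u => expR (0 + - a * G u)) (expR (0 + - a * G x) * (- a * g x)).
  move=> x0; apply: is_derive_comp1.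
  exact: is_derive_comp1 (is_derive_affine _ _ _) (dG x x0).
have dF (x : R) : 0 <= x -> is_derive x (1 : R) (fun u => 0 + -1 * expR (0 + - a * G u)) (a * g x * expR (- (a * G x))).
  move=> x0; apply: is_derive_eq (is_derive_comp1 (is_derive_affine 0 (-1) _) (dE x x0)) _.
  by rewrite add0r !mulNr; ring.
have cE (x : R) : 0 <= x -> {for x, continuous (fun u => 0 + -1 * expR (0 + - a * G u))}.
  move=> x0; apply: differentiable_continuous; apply/derivable1_diffP.
  exact: (@ex_derive _ _ _ _ _ _ _ (dF x x0)).
have := @ge0_continuous_FTC2y R (fun u => a * g u * expR (- (a * G u)))
  (fun u => 0 + -1 * expR (0 + - a * G u)) 0 0.
rewrite G0 mulr0 addr0 expR0 mulr1 add0r sub0e EFinN oppeK; apply.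
- by move=> x x0; rewrite mulr_ge0 ?expR_ge0// mulr_ge0 ?g0// ltW.
- apply: continuous_in_subspaceT => x; rewrite inE/= in_itv/= andbT => x0.
  apply: cvgM; first by apply: cvgM; [exact: cvg_cst|exact: cg].
  apply: (@continuous_comp _ _ _ (fun u => - (a * G u)) expR); last exact: continuous_expR.
  apply: cvgN; apply: cvgM; first exact: cvg_cst.
  apply: differentiable_continuous; apply/derivable1_diffP.
  exact: (@ex_derive _ _ _ _ _ _ _ (dG x x0)).
- rewrite (_ : (fun u => _) = (fun u => - expR (- (a * G u)))); last first.
    by apply/funext => u; rewrite !add0r mulN1r mulNr.
  rewrite -oppr0; apply: cvgN.
  exact: (cvg_comp _ _ (gt0_cvgMry a0 Gy) (@cvgr_expR R)).
- by move=> x /ltW x0; exact: (@ex_derive _ _ _ _ _ _ _ (dF x x0)).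
- have e : 0 + -1 * expR (0 + - a * G 0) = -1 by rewrite G0 mulr0 addr0 expR0 mulr1 add0r.
  by apply: cvg_at_right_filter; rewrite -[X in _ --> X]e; exact: cE.
- move=> x; rewrite in_itv/= andbT => /ltW x0; rewrite derive1E.
  exact: (@derive_val _ _ _ _ _ _ _ (dF x x0)).
Qed.

Lemma integral_expR_decay (z : R) : 0 < z ->
  (\int[leb]_(u in `[0%R, +oo[) (z * expR (- (u * z)))%:E = 1)%E.
Proof.
move=> z0; have := @integral_expR_primitive z id (cst 1) z0 (fun x _ => is_derive_id x 1) (fun _ _ => ler01) (fun x _ => @cvg_cst _ _ _ _ _) erefl (@cvg_id _ _).
move=> <-; by apply: eq_integral => u _; rewrite mulr1 (mulrC u).
Qed.

Lemma integral_power_decay (c : R) : 0 < c ->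
  (\int[leb]_(u in `[0%R, +oo[) (expR (- ((c + 1) * ln (1 + u))))%:E = c^-1%:E)%E.
Proof.
move=> c0.
have G1 (x : R) : 0 <= x -> 0 < 1 + x by move=> x0; rewrite ltr_pwDl.
have G0 (x : R) : 0 <= x -> 0 <= (1 + x)^-1 by move=> /G1/ltW; rewrite invr_ge0.
have cinv (x : R) : 0 <= x -> {for x, continuous (fun u : R => (1 + u)^-1)}.
  move=> x0; apply: cvgV; first by rewrite gt_eqF ?G1.
  by apply: cvgD; [exact: cvg_cst|exact: cvg_id].
have dG (x : R) : 0 <= x -> is_derive x (1 : R) (fun u => ln (1 + u)) (1 + x)^-1.
  move=> x0; have h : is_derive (1 + x) (1 : R) (@ln R) (1 + x)^-1 by apply: is_derive1_ln; exact: G1.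
  have h1 : is_derive x (1 : R) (fun u : R => 1 + u) 1.
    have := is_derive_affine 1 1 x; under eq_fun do rewrite mul1r.
    by [].
  by apply: is_derive_eq (is_derive_comp1 h h1) _; rewrite mulr1.
have lny : (fun u : R => ln (1 + u)) x @[x --> +oo] --> +oo.
  apply/cvgryPge => A; near=> x.
  have x0 : expR A <= x by near: x; exact: nbhs_pinfty_ge.
  by rewrite -[A]expRK ler_ln ?posrE ?expR_gt0 ?G1// ?(le_trans (expR_ge0 A))// ler_wpDl.
have := integral_expR_primitive c0 dG G0 cinv _ lny; rewrite addr0 ln1 => /(_ erefl) h.
have e1 : (\int[leb]_(u in `[0%R, +oo[) (c * (1 + u)^-1 * expR (- (c * ln (1 + u))))%:E =
   c%:E * \int[leb]_(u in `[0%R, +oo[) (expR (- ((c + 1) * ln (1 + u))))%:E)%E.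
  have f0 (u : R) : `[0, +oo[%classic u -> (0 <= (expR (- ((c + 1) * ln (1 + u))))%:E)%E.
    by move=> _; rewrite lee_fin expR_ge0.
  have mf : measurable_fun (`[0, +oo[%classic : set (measurableTypeR R)) (fun u : R => (expR (- ((c + 1) * ln (1 + u))))%:E).
    apply/measurable_EFinP; apply: measurableT_comp => //; apply: measurableT_comp => //.
    apply: measurable_funM => //; apply: (measurable_funTS (f := fun u : R => ln (1 + u))).
    by apply: (measurableT_comp (@measurable_ln R)); exact: measurable_funD.
  transitivity (\int[leb]_(u in `[0%R, +oo[) (c%:E * (expR (- ((c + 1) * ln (1 + u))))%:E))%E; last first.
    by apply: (@ge0_integralZl_EFin _ (measurableTypeR R) R leb `[0, +oo[%classic _ (fun u : R => (expR (- ((c + 1) * ln (1 + u))))%:E)) => //; exact: ltW.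
  apply: eq_integral => u; rewrite inE/= in_itv/= andbT => u0; rewrite -EFinM; congr EFin.
  rewrite -mulrA; congr (_ * _).
  by rewrite mulrDl mul1r opprD expRD mulrC; congr (_ * _); rewrite expRN lnK// posrE G1.
rewrite -[LHS]mul1e -(_ : c^-1%:E * c%:E = 1)%E; last by rewrite -EFinM mulVf ?gt_eqF.
by rewrite -muleA -e1 h mule1.
Unshelve. all: end_near.
Qed.

End improper_integrals.

Section rising.
Context {R : realType}.

Definition rising (x : R) j := \prod_(i < j) (x + i%:R).

Lemma risingS x j : rising x j.+1 = rising x j * (x + j%:R).
Proof. exact: big_ord_recr. Qed.

Lemma rising_gt0 x j : 0 < x -> 0 < rising x j.
Proof. by move=> x0; apply: prodr_gt0 => i _; rewrite ltr_pwDl. Qed.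

End rising.

Section gamma_moments.
Context {R : realType} d (T : measurableType d) (Q : probability T R).
Local Notation leb := (@lebesgue_measure R).
Variables (theta : R) (S : T -> R).
Hypotheses (theta_gt0 : 0 < theta) (mS : measurable_fun setT S).
Hypothesis S_gt0 : {ae Q, forall w, 0 < S w}.
Hypothesis scaling : forall (f : R -> \bar R) s,
  measurable_fun setT f -> (forall x, 0 <= f x)%E -> -1 < s ->
  (\int[Q]_w (f (S w) * (expR (- (s * S w)))%:E) =
   (expR (- (theta * ln (1 + s))))%:E * \int[Q]_w f (S w / (1 + s))%R)%E.

Let M j := (\int[Q]_w (Num.max 0 (S w) ^+ j)%:E)%E.

Let mpow j : measurable_fun setT (fun x : R => Num.max 0 x ^+ j).
Proof. by apply: measurable_funX; exact: measurable_maxr. Qed.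

Let pow_ge0 (x : R) j : 0 <= Num.max 0 x ^+ j.
Proof. by rewrite exprn_ge0// le_max lexx. Qed.

(* Integrate [S ^+ j = \int_0^oo S ^+ j.+1 * e^(- u S) du] and apply [scaling]. *)
Let moment_rec j : M j = (M j.+1 * (theta + j%:R)^-1%:E)%E.
Proof.
have tj : 0 < theta + j%:R by rewrite ltr_pwDl.
pose F (z : T * measurableTypeR R) :=
  (Num.max 0 (S z.1) ^+ j.+1 * expR (- (z.2 * S z.1)) * \1_(`[0, +oo[%classic) z.2)%:E.
have mS1 : measurable_fun setT (fun z : T * measurableTypeR R => S z.1).
  exact: (measurableT_comp mS measurable_fst).
have mF : measurable_fun setT F.
  apply/measurable_EFinP; apply: measurable_funM; last first.
    by apply: (measurableT_comp _ measurable_snd); exact: measurable_indic.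
  apply: measurable_funM; first exact: (measurableT_comp (mpow j.+1) mS1).
  apply: measurableT_comp => //; apply: measurableT_comp => //.
  by apply: measurable_funM => //; exact: measurable_snd.
have F0 z : (0 <= F z)%E by rewrite lee_fin mulr_ge0// mulr_ge0// expR_ge0.
transitivity (\int[Q]_w \int[leb]_u F (w, u))%E.
  apply: ae_eq_integral => //.
  - exact/measurable_EFinP/(measurableT_comp (mpow j) mS).
  - exact: measurable_fun_fubini_tonelli_F.
  apply: filterS S_gt0 => w Sw _; rewrite /F/=.
  transitivity (\int[leb]_(u in `[0%R, +oo[) ((S w ^+ j)%:E * (S w * expR (- (u * S w)))%:E))%E.
    rewrite ge0_integralZl_EFin//.
    - by rewrite integral_expR_decay// mule1 max_r// ltW.
    - by move=> u _; rewrite lee_fin mulr_ge0 ?expR_ge0// ltW.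
    - apply/measurable_EFinP; apply: measurable_funM => //; apply: measurableT_comp => //.
      by apply: measurableT_comp => //; apply: measurable_funM.
    - by rewrite exprn_ge0// ltW.
  rewrite integral_mkcond; apply: eq_integral => u _; rewrite patchE indicE.
  case: (u \in _); rewrite ?mulr0// mulr1 max_r ?(ltW Sw)// exprSr -EFinM.
  by rewrite mulrA.
rewrite fubini_tonelli//.
transitivity (\int[leb]_(u in `[0%R, +oo[) (M j.+1 * (expR (- ((theta + j%:R + 1) * ln (1 + u))))%:E))%E; last first.
  rewrite ge0_integralZl//.
  - by rewrite integral_power_decay.
  - apply/measurable_EFinP; apply: measurableT_comp => //; apply: measurableT_comp => //.
    apply: measurable_funM => //; apply: (measurable_funTS (f := fun u : R => ln (1 + u))).
    by apply: (measurableT_comp (@measurable_ln R)); exact: measurable_funD.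
  - by apply: integral_ge0 => w _; rewrite lee_fin.
rewrite [RHS]integral_mkcond; apply: eq_integral => u _; rewrite patchE /F/= indicE.
case: ifPn => [|_]; last by under eq_integral do rewrite mulr0; rewrite integral0.
rewrite inE/= in_itv/= andbT => u0; under eq_integral do rewrite mulr1 EFinM.
have u1 : 0 < 1 + u by rewrite ltr_pwDl.
rewrite (scaling (f := fun x => (Num.max 0 x ^+ j.+1)%:E)); last 3 first.
- exact/measurable_EFinP.
- by move=> x; rewrite lee_fin.
- by rewrite (lt_le_trans (ltrN10 R)).
(* Rescaling [S^(j+1)] yields [(1 + u)^(-j-1)], which together with [(1 + u)^(-theta)] has integral
   [1 / (theta + j)] over [u >= 0]. *)
have e w : ((Num.max 0 (S w / (1 + u)) ^+ j.+1)%:E =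
    ((1 + u) ^- j.+1)%:E * (Num.max 0 (S w) ^+ j.+1)%:E)%E.
  rewrite -EFinM; congr EFin; rewrite -exprVn -exprMn; congr (_ ^+ _).
  by rewrite maxr_pMr ?invr_ge0 ?ltW// mulr0 mulrC.
under eq_integral do rewrite e.
rewrite ge0_integralZl_EFin//; last 3 first.
- by move=> w _; rewrite lee_fin.
- exact/measurable_EFinP/(measurableT_comp (mpow j.+1) mS).
- by rewrite -exprVn exprn_ge0// invr_ge0 ltW.
rewrite muleA muleC; congr (_ * _)%E; rewrite -EFinM; congr EFin.
rewrite -[X in _ / X]lnK ?posrE ?exprn_gt0// -expRN -expRD lnXn//; congr expR.
by rewrite -[ln _ *+ _]mulr_natr -natr1; ring.
Qed.

(** [moment_rec] expresses the lower moment by the higher one in the extended reals, so finiteness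
    of the higher moment is obtained rather than assumed. *)
Lemma gamma_moment j : (\int[Q]_w (Num.max 0 (S w) ^+ j)%:E = (rising theta j)%:E)%E.
Proof.
elim: j => [|j IH].
  rewrite /rising big_ord0; under eq_integral do rewrite expr0.
  by rewrite integral_cst//= probability_setT mul1e.
have tj : 0 < theta + j%:R by rewrite ltr_pwDl.
rewrite risingS EFinM -IH -/(M j) moment_rec -muleA -EFinM mulVf ?gt_eqF//.
by rewrite mule1.
Qed.

End gamma_moments.

(** * Transforms and moments of means of simple functions *)

Section simple_mean.
Context {R : realType}.
Import HBNNSimple.

Lemma law_ge0_integral d1 d2 d (T1 : measurableType d1) (T2 : measurableType d2)
    (U : measurableType d)
    (P1 : {measure set T1 -> \bar R}) (P2 : {measure set T2 -> \bar R})
    (X1 : T1 -> U) (X2 : T2 -> U) (f : U -> \bar R) :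
  measurable_fun setT X1 -> measurable_fun setT X2 ->
  (forall A, measurable A -> P1 (X1 @^-1` A) = P2 (X2 @^-1` A)) ->
  measurable_fun setT f -> (forall x, 0 <= f x)%E ->
  (\int[P1]_w f (X1 w) = \int[P2]_w f (X2 w))%E.
Proof.
move=> mX1 mX2 h mf f0.
transitivity (\int[pushforward P1 X1]_x f x)%E; first by rewrite ge0_integral_pushforward.
transitivity (\int[pushforward P2 X2]_x f x)%E; last by rewrite ge0_integral_pushforward.
by apply: eq_measure_integral => A mA _; exact: h.
Qed.

Lemma measurable_kernel_simple d (T : measurableType d) (D : R.-pker T ~> R)
    (h : {nnsfun R >-> R}) : measurable_fun setT (fun w => \int[D w]_x h x).
Proof.
have [n [y [_ _ _ intE]]] := simple_partition h.
rewrite (_ : (fun w => _) = fun w => \sum_(i < n) y i * fine (D w (h @^-1` [set y i]))).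
  apply: measurable_sum => i; apply: measurable_funM => //.
  by apply: measurableT_comp => //; exact: measurable_kernel.
apply/funext => w; have DT : (D w setT < +oo)%E by rewrite prob_kernel ltry.
exact: (intE (D w) id DT).
Qed.

Section one_simple_mean.
Context d (T : measurableType d) (P : probability T R).
Variables (theta : R) (H : probability R R) (D : R.-pker T ~> R).
Hypotheses (theta_gt0 : 0 < theta) (hD : dirichlet_process P theta H D).
Variable h : {nnsfun R >-> R}.

Let X w := \int[D w]_x h x.

Let mX : measurable_fun setT X. Proof. exact: measurable_kernel_simple. Qed.

Let X0 w : 0 <= X w. Proof. by apply: Rintegral_ge0 => x _. Qed.

(* [V] stands for a weighted sum of Gamma variables and [S] for their total. *)
Let ratio_spec d' (T' : measurableType d') (Q : probability T' R) (V S : T' -> R) : Prop :=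
  (measurable_fun setT V /\ measurable_fun setT S) /\
  [/\ forall U, measurable U -> P (X @^-1` U) = Q ((fun w => V w / S w) @^-1` U),
      indep Q S (fun w => V w / S w) &
      {ae Q, forall w, 0 < S w /\ 0 <= V w}] /\
  (forall (f : R -> \bar R) s, measurable_fun setT f -> (forall x, 0 <= f x)%E ->
        -1 < s -> (\int[Q]_w (f (S w) * (expR (- (s * S w)))%:E) =
        (expR (- (theta * ln (1 + s))))%:E * \int[Q]_w f (S w / (1 + s))%R)%E) /\
      [/\ forall s, 0 <= s -> (\int[Q]_w (expR (- (s * V w)))%:E =
        (expR (- (theta * \int[H]_x ln (1 + s * h x))))%:E)%E,
        forall t, \int[Q]_w cos (t * S w) =
          expR (- (theta / 2 * ln (1 + t ^+ 2))) * cos (theta * atan t) &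
        forall t x, \int[Q]_w cos (t * (V w - x * S w)) =
          expR (- (theta / 2 * \int[H]_z ln (1 + (t * (h z - x)) ^+ 2))) *
          cos (theta * \int[H]_z atan (t * (h z - x)))].

Let scaling_laplace d' (T' : measurableType d') (Q : probability T' R) (S : T' -> R) :
  (forall (f : R -> \bar R) s, measurable_fun setT f -> (forall x, 0 <= f x)%E ->
        -1 < s -> (\int[Q]_w (f (S w) * (expR (- (s * S w)))%:E) =
        (expR (- (theta * ln (1 + s))))%:E * \int[Q]_w f (S w / (1 + s))%R)%E) ->
  forall s, -1 < s -> (\int[Q]_w (expR (- (s * S w)))%:E = (expR (- (theta * ln (1 + s))))%:E)%E.
Proof.
move=> sc s s1; have := sc (cst 1%E) s (measurable_cst _).
rewrite [X in (_ * X)%E](_ : _ = 1%E); last first.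
  by rewrite [LHS]integral_cst//= probability_setT mule1.
rewrite mule1 => <- //.
by apply: eq_integral => w _; rewrite mul1e.
Qed.

Let ratio_exists : exists d' (T' : measurableType d') (Q : probability T' R) (V S : T' -> R),
  ratio_spec Q V S.
Proof.
have [d' [T' [Q [V [S [[mV mS] [law ind S0 sc [lapV trS trV]]]]]]]] :=
  dirichlet_simple (ltW theta_gt0) hD h.
exists d', T', Q, V, S; split => //; split => //; split => //.
have lapS := scaling_laplace sc.
have mr : measurable_fun setT (fun w => V w / S w).
  by apply: measurable_funM => //; exact: (measurableT_comp (@measurable_inv R) mS).
(* An atom of mass [q] at 0 would keep the Laplace transform [(1 + s)^(-theta)] at least [q]. With
   [1 + s = e^c] and [theta c >= 1 - ln q] the transform is at most [q / e]. *)
have Sz : Q (S @^-1` [set 0]) = 0%E.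
  apply/eqP; apply/negPn/negP => q0.
  have mSz : measurable (S @^-1` [set 0]) by exact: measurable_preimageT.
  have qf : Q (S @^-1` [set 0]) \is a fin_num by rewrite fin_num_measure.
  pose q := fine (Q (S @^-1` [set 0])).
  have qp : 0 < q.
    by rewrite /q fine_gt0// lt0e q0 measure_ge0/= ltey_eq qf.
  pose c := Num.max 0 ((1 - ln q) / theta).
  have c0 : 0 <= c by rewrite le_max lexx.
  have s1 : -1 < expR c - 1 by have := expR_gt0 c; lra.
  have := lapS _ s1.
  have -> : 1 + (expR c - 1) = expR c by ring.
  rewrite expRK => hl.
  have hle : (q%:E <= \int[Q]_w (expR (- ((expR c - 1) * S w)))%:E)%E.
    rewrite /q fineK//.
    have -> : Q (S @^-1` [set 0]) = (\int[Q]_w (\1_(S @^-1` [set 0]) w)%:E)%E by rewrite integral_indic// setIT.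
    apply: ge0_le_integral => //.
    - exact/measurable_EFinP.
    - by apply/measurable_EFinP; apply: measurableT_comp => //; apply: measurableT_comp => //; exact: measurable_funM.
    - move=> w _; rewrite lee_fin indicE; have [|_] := boolP (w \in _); last exact: expR_ge0.
      by rewrite inE /= => ->; rewrite mulr0 oppr0 expR0.
  move: hle; rewrite hl lee_fin leNgt => /negP; apply.
  rewrite -[ltRHS]lnK ?posrE// ltr_expR ltrNl.
  have : (1 - ln q) / theta <= c by rewrite le_max lexx orbT.
  by rewrite ler_pdivrMr// mulrC; lra.
have m0 : Q ((fun w => V w / S w) @^-1` `]-oo, 0[) = 0%E.
  rewrite -law//; apply/eqP; rewrite eq_le measure_ge0 andbT -(measure0 P) le_measure ?inE//.
    exact: measurable_preimageT.
  by move=> w /=; rewrite in_itv/= ltNge X0.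
exists (S @^-1` `]-oo, 0[ `|` S @^-1` [set 0] `|` (fun w => V w / S w) @^-1` `]-oo, 0[).
have mS1 : measurable (S @^-1` `]-oo, 0[) by exact: measurable_preimageT.
have mS2 : measurable (S @^-1` [set 0]) by exact: measurable_preimageT.
have mS3 : measurable ((fun w => V w / S w) @^-1` `]-oo, 0[) by exact: measurable_preimageT.
split.
- by apply: measurableU => //; exact: measurableU.
- by rewrite null_set_setU// ?null_set_setU//; exact: measurableU.
move=> w /=; rewrite !in_itv/=; apply: contra_notP => /not_orP[/not_orP[/negP]].
rewrite -leNgt => s0 sn0 /negP; rewrite -leNgt => m.
have sp : 0 < S w by rewrite lt_neqAle s0 andbT eq_sym; apply/eqP.
split => //; by move: m; rewrite pmulr_lge0// invr_gt0.
Qed.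

(** With [m = V / S] independent of [S], integrating [e^(-s m S)] over [S] first gives
    [(1 + s m)^(-theta)]. *)
Lemma simple_mean_stieltjes s : 0 <= s ->
  (\int[P]_w (expR (- (theta * ln (1 + s * X w))))%:E =
   (expR (- (theta * \int[H]_x ln (1 + s * h x))))%:E)%E.
Proof.
move=> s0.
have [d' [T' [Q [V [S [[mV mS] [[law ind pos] [sc [lapV _ _]]]]]]]]] := ratio_exists.
have lapS := scaling_laplace sc.
pose m w := V w / S w.
have mm : measurable_fun setT m.
  by apply: measurable_funM => //; exact: (measurableT_comp (@measurable_inv R) mS).
have mmax : measurable_fun setT (fun x : R => Num.max 0 x) by exact: measurable_maxr.
pose F (z : R * R) := (expR (- (s * Num.max 0 z.1 * z.2)))%:E.
have mF : measurable_fun setT F.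
  apply/measurable_EFinP; apply: measurableT_comp => //; apply: measurableT_comp => //.
  apply: measurable_funM; last exact: measurable_snd.
  by apply: measurable_funM => //; exact: (measurableT_comp mmax measurable_fst).
rewrite -(lapV s s0).
transitivity (\int[Q]_w F (m w, S w))%E; last first.
  apply: ae_eq_integral => //.
  - exact: (measurableT_comp mF (measurable_fun_pair mm mS)).
  - by apply/measurable_EFinP; apply: measurableT_comp => //; apply: measurableT_comp => //; exact: measurable_funM.
  apply: filterS pos => w [Sp V0] _; rewrite /F/= max_r; last by rewrite divr_ge0// ltW.
  by rewrite /m mulrA divfK// gt_eqF.
have ind' : indep Q m S.
  by move=> A B mA mB; rewrite setIC ind// muleC.
rewrite (indep_integral mm mS ind' mF); last by move=> z; rewrite lee_fin expR_ge0.
pose G (x : R) := (expR (- (theta * ln (1 + s * Num.max 0 x))))%:E.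
have mG : measurable_fun setT G.
  apply/measurable_EFinP; apply: measurableT_comp => //; apply: measurableT_comp => //.
  apply: measurable_funM => //; apply: (measurableT_comp (@measurable_ln R)).
  by apply: measurable_funD => //; exact: measurable_funM.
transitivity (\int[Q]_w G (m w))%E.
  rewrite -(law_ge0_integral mX mm law mG); last by move=> x; rewrite lee_fin expR_ge0.
  by apply: eq_integral => w _; rewrite /G max_r.
apply: eq_integral => w _; rewrite /F/= lapS//.
by rewrite (lt_le_trans (ltrN10 R))// mulr_ge0// le_max lexx.
Qed.

Lemma simple_mean_poisson t x : theta = 1 ->
  \int[P]_w (1 + (t * (X w - x)) ^+ 2)^-1 =
  expR (- (2^-1 * \int[H]_z ln (1 + (t * (h z - x)) ^+ 2))) *
    cos (\int[H]_z atan (t * (h z - x))).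
Proof.
move=> th1.
have [d' [T' [Q [V [S [[mV mS] [[law ind pos] [_ [_ trS trV]]]]]]]]] := ratio_exists.
pose m w := V w / S w.
have mm : measurable_fun setT m.
  by apply: measurable_funM => //; exact: (measurableT_comp (@measurable_inv R) mS).
have mcos d0 (T0 : measurableType d0) (g : T0 -> R) : measurable_fun setT g -> measurable_fun setT (fun z => cos (g z)).
  by move=> mg; exact: (measurableT_comp (@measurable_cos R) mg).
(* For shape 1 the modulus [(1 + u^2)^(-1/2)] meets the equal factor [cos (atan u)], which produces
   the rational kernel. *)
have cosS u : \int[Q]_w cos (u * S w) = (1 + u ^+ 2)^-1.
  rewrite trS th1 !mul1r cos_atan.
  have u0 : 0 < 1 + u ^+ 2 by rewrite ltr_pwDl// sqr_ge0.
  have -> : expR (- (2^-1 * ln (1 + u ^+ 2))) = (Num.sqrt (1 + u ^+ 2))^-1.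
    by rewrite expRN -powR12_sqrt ?ltW// /powR gt_eqF//.
  by rewrite -invfM -expr2 sqr_sqrtr// ltW.
have icos d0 (T0 : measurableType d0) (Q0 : probability T0 R) (g : T0 -> R) : measurable_fun setT g ->
    Q0.-integrable setT (EFin \o (fun w => cos (g w))).
  by move=> mg; apply: (@bounded_integrable _ _ _ _ _ 1) => [|w]; [exact: mcos|exact: cos_max].
have cosge y : -1 <= cos y :> R by have := cos_max y; rewrite ler_norml => /andP[].
have E1 d0 (T0 : measurableType d0) (Q0 : probability T0 R) (g : T0 -> R) : Q0.-integrable setT (EFin \o g) ->
    (\int[Q0]_w (1 + g w)%:E = (1 + \int[Q0]_w g w)%:E)%E.
  move=> ig; have i1 : Q0.-integrable setT (EFin \o cst 1) by exact: finite_measure_integrable_cst.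
  rewrite -[LHS]fineK; last exact: integrable_fin_num (integrableD measurableT i1 ig).
  congr EFin; rewrite -[LHS]/(\int[Q0]_w (1 + g w)) (RintegralD measurableT i1 ig).
  by rewrite Rintegral_cst//= probability_setT mulr1.
(* Shifting by 1 gives a nonnegative integrand, as required by [indep_integral]. *)
pose F (z : R * R) := (1 + cos (t * (z.1 - x) * z.2))%:E.
have mF : measurable_fun setT F.
  apply/measurable_EFinP; apply: measurable_funD => //; apply: mcos.
  apply: measurable_funM; last exact: measurable_snd.
  by apply: measurable_funM => //; apply: measurable_funB => //; exact: measurable_fst.
have F0 z : (0 <= F z)%E by rewrite lee_fin; have := cosge (t * (z.1 - x) * z.2); lra.
pose G (y : R) := (1 + (1 + (t * (y - x)) ^+ 2)^-1)%:E.
have minv : measurable_fun setT (fun y : R => (1 + (t * (y - x)) ^+ 2)^-1).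
  apply: (measurableT_comp (@measurable_inv R)); apply: measurable_funD => //.
  by apply: measurable_funX; apply: measurable_funM => //; exact: measurable_funB.
have mG : measurable_fun setT G by apply/measurable_EFinP; exact: measurable_funD.
have inv0 y : 0 <= (1 + (t * (y - x)) ^+ 2)^-1 by rewrite invr_ge0 addr_ge0// sqr_ge0.
have G0 y : (0 <= G y)%E by rewrite lee_fin addr_ge0.
have ind' : indep Q m S.
  by move=> A B mA mB; rewrite setIC ind// muleC.
have main : (\int[P]_w G (X w) = \int[Q]_w (1 + cos (t * (V w - x * S w)))%:E)%E.
  rewrite (law_ge0_integral mX mm law mG G0).
  transitivity (\int[Q]_w F (m w, S w))%E.
    rewrite (indep_integral mm mS ind' mF F0); apply: eq_integral => w _.
    rewrite /F/= E1; last by apply: icos; exact: measurable_funM.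
    by rewrite cosS.
  apply: ae_eq_integral => //.
  - exact: (measurableT_comp mF (measurable_fun_pair mm mS)).
  - apply/measurable_EFinP; apply: measurable_funD => //; apply: mcos.
    by apply: measurable_funM => //; apply: measurable_funB => //; exact: measurable_funM.
  apply: filterS pos => w [Sp V0] _; rewrite /F/= /m.
  congr (1 + cos _)%:E; rewrite -mulrA mulrBl divfK// gt_eqF//.
have im : measurable_fun setT (fun w => t * (V w - x * S w)).
  by apply: measurable_funM => //; apply: measurable_funB => //; exact: measurable_funM.
rewrite (E1 _ _ Q (fun w => cos (t * (V w - x * S w))) (icos _ _ Q _ im)) trV in main.
have ii : P.-integrable setT (EFin \o (fun w => (1 + (t * (X w - x)) ^+ 2)^-1)).
  apply: (@bounded_integrable _ _ _ _ _ 1); first exact: (measurableT_comp minv mX).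
  move=> w; rewrite ger0_norm// invf_le1 ?lerDl ?sqr_ge0// ltr_pwDl// sqr_ge0//.
rewrite /G (E1 _ _ P (fun w => (1 + (t * (X w - x)) ^+ 2)^-1) ii) in main.
by move: main => [/addrI ->]; rewrite th1 !mul1r.
Qed.

(** [V] stays in the conclusion together with its Laplace transform: the processes to be compared
    have totals of different shapes, and it is their numerators that match. *)
Lemma simple_mean_moments : exists d' (T' : measurableType d') (Q : probability T' R) (V : T' -> R),
  [/\ measurable_fun setT V, Q (V @^-1` `]-oo, 0[) = 0%E,
      forall s, 0 <= s -> (\int[Q]_w (expR (- (s * V w)))%:E =
        (expR (- (theta * \int[H]_x ln (1 + s * h x))))%:E)%E &
      forall j, (\int[P]_w (X w ^+ j)%:E * (rising theta j)%:E = \int[Q]_w (Num.max 0 (V w) ^+ j)%:E)%E].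
Proof.
have [d' [T' [Q [V [S [[mV mS] [[law ind pos] [sc [lapV _ _]]]]]]]]] := ratio_exists.
exists d', T', Q, V; split => //.
  case: pos => N [mN N0 sub]; apply/eqP; rewrite eq_le measure_ge0 andbT -N0 le_measure ?inE//.
    exact: measurable_preimageT.
  move=> w /=; rewrite in_itv/= => v0; apply: sub => /= -[_]; by rewrite leNgt v0.
move=> j.
pose m w := V w / S w.
have mm : measurable_fun setT m.
  by apply: measurable_funM => //; exact: (measurableT_comp (@measurable_inv R) mS).
pose g (x : R) := (Num.max 0 x ^+ j)%:E.
have mg : measurable_fun setT g.
  by apply/measurable_EFinP; apply: measurable_funX; exact: measurable_maxr.
have g0 x : (0 <= g x)%E by rewrite lee_fin exprn_ge0// le_max lexx.
have -> : (\int[P]_w (X w ^+ j)%:E = \int[Q]_w g (m w))%E.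
  rewrite -(law_ge0_integral mX mm law mg g0).
  by apply: eq_integral => w _; rewrite /g max_r.
have pos' : {ae Q, forall w, 0 < S w} by apply: filterS pos => w [].
rewrite -(gamma_moment theta_gt0 mS pos' sc).
have ind' : indep Q m S.
  by move=> A B mA mB; rewrite setIC ind// muleC.
rewrite -(indep_ge0_mul mm mS ind' mg mg g0 g0).
apply: ae_eq_integral => //.
- by apply: emeasurable_funM; exact: (measurableT_comp mg).
- exact: (measurableT_comp mg).
apply: filterS pos => w [Sp V0] _.
rewrite /g -EFinM -exprMn !max_r ?(ltW Sp)//; last by rewrite divr_ge0// ltW.
by rewrite /m divfK// gt_eqF.
Qed.

End one_simple_mean.

(** The hypothesis on the logarithmic integrals equates the Laplace transforms of the two
    numerators, hence their laws and their moments. *)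
Lemma simple_mean_moment_eq d1 (T1 : measurableType d1) (P1 : probability T1 R)
    (D1 : R.-pker T1 ~> R) d2 (T2 : measurableType d2) (P2 : probability T2 R)
    (D2 : R.-pker T2 ~> R) (s t : R) (K H : probability R R) (h : {nnsfun R >-> R}) :
  0 < s -> 0 < t ->
  dirichlet_process P1 s K D1 -> dirichlet_process P2 t H D2 ->
  (forall u, 0 <= u -> s * \int[K]_x ln (1 + u * h x) = t * \int[H]_x ln (1 + u * h x)) ->
  forall j, (\int[P1]_w ((\int[D1 w]_x h x) ^+ j)%:E * (rising s j)%:E =
             \int[P2]_w ((\int[D2 w]_x h x) ^+ j)%:E * (rising t j)%:E)%E.
Proof.
move=> s0 t0 hD1 hD2 e j.
have [d1' [T1' [Q1 [V1 [mV1 V10 lap1 ->]]]]] := simple_mean_moments s0 hD1 h.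
have [d2' [T2' [Q2 [V2 [mV2 V20 lap2 ->]]]]] := simple_mean_moments t0 hD2 h.
apply: (@law_ge0_integral _ _ _ _ _ _ Q1 Q2 V1 V2 (fun x : R => (Num.max 0 x ^+ j)%:E)) => //.
- by apply: laplace_unique => // k; rewrite lap1// lap2// e.
- by apply/measurable_EFinP; apply: measurable_funX; exact: measurable_maxr.
- by move=> x; rewrite lee_fin exprn_ge0// le_max lexx.
Qed.

End simple_mean.

(** * Moments of the Beta law *)

Section beta.
Context {R : realType} d (T : measurableType d) (Q : probability T R).
Local Notation leb := (@lebesgue_measure R).
Variables (B : {RV Q >-> R}) (a b : R).
Hypotheses (a0 : 0 < a) (b0 : 0 <= b) (hB : has_law Q B (beta_law a b)).

Lemma beta_ae01 : {ae Q, forall w, 0 <= B w <= 1}.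
Proof.
exists (B @^-1` (~` `[0, 1])).
have mC : measurable (~` `[0, 1] : set R) by exact: measurableC.
split; first by rewrite -[X in measurable X]setTI; exact: measurable_funPT.
  transitivity (beta_law a b (~` `[0, 1])); first exact: hB.
  rewrite /beta_law; case: ifP => _.
    rewrite (_ : ~` `[0%R, 1%R] `&` _ = set0) ?integral_set0//.
    rewrite -subset0 => x /= [+ h]; apply; move: h; rewrite !in_itv/= => /andP[x0 x1].
    by rewrite !ltW.
  by rewrite diracE memNset//= in_itv/= lexx ler01; apply.
by move=> w /=; rewrite in_itv.
Qed.

(** The law charges only [[0, 1]], so clamping alters nothing almost surely, while it makes every
    moment the integral of a bounded function. *)
Let clamp (x : R) := Num.min 1 (Num.max 0 x).

Let clampE x : 0 <= x <= 1 -> clamp x = x.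
Proof. by move=> /andP[x0 x1]; rewrite /clamp max_r// min_r. Qed.

Let clamp01 x : 0 <= clamp x <= 1.
Proof. by rewrite /clamp le_min ler01 le_max lexx ge_min lexx. Qed.

Let mclamp k : measurable_fun setT (fun x => clamp x ^+ k).
Proof. by apply: measurable_funX; apply: measurable_minr => //; exact: measurable_maxr. Qed.

Let clamp_pow k x : 0 <= clamp x ^+ k <= 1.
Proof. by have /andP[x0 x1] := clamp01 x; rewrite exprn_ge0// exprn_ile1. Qed.

Let g0 (x : R) := x `^ (a - 1) * (1 - x) `^ (b - 1) / Beta_fun a b.

Let g x := g0 x * \1_(`]0, 1[%classic : set R) x.

Let Beta_ge0 : 0 <= Beta_fun a b.
Proof. by apply: Rintegral_ge0 => z _; rewrite mulr_ge0 ?powR_ge0. Qed.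

Let g0_ge0 x : 0 <= g0 x.
Proof. by rewrite /g0 divr_ge0// mulr_ge0 ?powR_ge0. Qed.

Let ge0_integral_beta (f : R -> \bar R) : 0 < b ->
  measurable_fun setT f -> (forall x, 0 <= f x)%E ->
  (\int[Q]_w f (B w) = \int[leb]_x (f x * (g x)%:E))%E.
Proof.
move=> bp mf f0.
pose B' : {mfun T >-> measurableTypeR R} := HB.pack (B : T -> measurableTypeR R)
  (isMeasurableFun.Build _ _ T (measurableTypeR R) B (measurable_funPT B)).
rewrite -[LHS](@ge0_integral_distribution _ _ _ _ _ Q B' f)//.
apply: (@ge0_integral_density R _ _ (distribution Q B') lebesgue_measure g) => //.
- apply: measurable_funM; last by exact: measurable_indic.
  apply: measurable_funM => //; apply: measurable_funM; first exact: measurable_powR.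
  by apply: (measurableT_comp (measurable_powR _)); exact: measurable_funB.
- by move=> x; rewrite mulr_ge0.
move=> A mA; rewrite -[LHS]/(distribution Q B A) hB// /beta_law bp integral_mkcondr.
by apply: eq_integral => x _; rewrite /g/g0 patchE indicE; case: ifP => _; rewrite ?mulr1 ?mulr0.
Qed.

(** [F j] is a primitive on ]0, 1[ of [f j], a combination of the integrands of two consecutive
    moments. It vanishes at both ends when [a + j > 0] and [b > 0]; integrating gives a recursion in
    which the value of [Beta_fun] is not computed. *)
Let F j (x : R) := x `^ (a + j%:R) * (1 - x) `^ b / Beta_fun a b.

Let f j (x : R) := (a + j%:R) * (x ^+ j * g0 x) - (a + b + j%:R) * (x ^+ j.+1 * g0 x).

Let is_derive_1B (x : R) : is_derive x (1 : R) (fun z => 1 - z) (- 1).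
Proof.
by have := is_derive_affine 1 (-1) x; under eq_fun do rewrite mulN1r.
Qed.

Let is_derive_F j (x : R) : 0 < x < 1 -> is_derive x (1 : R) (F j) (f j x).
Proof.
move=> /andP[x0 x1]; have x1' : 0 < 1 - x by rewrite subr_gt0.
have h1 : is_derive x (1 : R) (fun z => z `^ (a + j%:R)) ((a + j%:R) * x `^ (a + j%:R - 1)).
  exact: is_derive1_powR.
have h2 : is_derive x (1 : R) (fun z => (1 - z) `^ b) (b * (1 - x) `^ (b - 1) * -1).
  exact: (@is_derive_comp1 _ (fun y => y `^ b) (fun z => 1 - z) x _ _ (is_derive1_powR b x1') (is_derive_1B x)).
have h3 := is_derive_mul (is_derive_mul h1 h2) (is_derive_cst (Beta_fun a b)^-1 x 1).
apply: is_derive_eq h3 _; rewrite /f /g0.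
have -> : x `^ (a + j%:R - 1) = x `^ (a - 1) * x ^+ j.
  by rewrite -powR_mulrn ?ltW// -powRD ?(gt_eqF x0) ?implybT//; congr (_ `^ _); ring.
have -> : x `^ (a + j%:R) = x `^ (a - 1) * x ^+ j.+1.
  by rewrite -powR_mulrn ?ltW// -powRD ?(gt_eqF x0) ?implybT// -natr1; congr (_ `^ _); ring.
have -> : (1 - x) `^ b = (1 - x) `^ (b - 1) * (1 - x).
  by rewrite -[X in _ * X]powRr1 ?ltW// -powRD ?(gt_eqF x1') ?implybT//; congr (_ `^ _); ring.
by rewrite /cst exprS; ring.
Qed.

Let cont_g0 j (x : R) : 0 < x < 1 -> {for x, continuous (fun z : R => z ^+ j * g0 z)}.
Proof.
move=> /andP[x0 x1]; have x1' : 0 < 1 - x by rewrite subr_gt0.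
apply: differentiable_continuous; apply/derivable1_diffP.
have h1 : is_derive x (1 : R) (fun z => z `^ (a - 1)) ((a - 1) * x `^ (a - 1 - 1)).
  exact: is_derive1_powR.
have h2 : is_derive x (1 : R) (fun z => (1 - z) `^ (b - 1)) ((b - 1) * (1 - x) `^ (b - 1 - 1) * -1).
  exact: (@is_derive_comp1 _ (fun y => y `^ (b - 1)) (fun z => 1 - z) x _ _ (is_derive1_powR _ x1') (is_derive_1B x)).
have h3 := is_derive_mul (is_derive_mul h1 h2) (is_derive_cst (Beta_fun a b)^-1 x 1).
apply: derivableM; last exact: (@ex_derive _ _ _ _ _ _ _ h3).
exact: exprn_derivable.
Qed.

(** The density may blow up at 0 and at 1, so the fundamental theorem of calculus is first applied
    on [[c, 1 - c]]. *)
Let I (c : R) : set R := `[c, 1 - c].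

Let integrable_I c j : 0 < c < 2^-1 -> leb.-integrable (I c) (EFin \o (fun x => x ^+ j * g0 x)).
Proof.
move=> /andP[c0 c1]; apply: continuous_compact_integrable; first exact: segment_compact.
apply: continuous_in_subspaceT => x; rewrite inE /I/= in_itv/= => /andP[x0 x1].
by apply: cont_g0; lra.
Qed.

Let truncated c j : 0 < b -> 0 < c < 2^-1 ->
  (\int[Q]_w (clamp (B w) ^+ j * \1_(I c) (B w))%:E =
   \int[leb]_(x in I c) (x ^+ j * g0 x)%:E)%E.
Proof.
move=> bp /andP[c0 c1].
rewrite (@ge0_integral_beta (fun x => (clamp x ^+ j * \1_(I c) x)%:E)) //.
- rewrite [RHS]integral_mkcond; apply: eq_integral => x _; rewrite patchE -EFinM /g indicE.
  case: ifPn => [|_]; last by rewrite mulr0 mul0r.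
  rewrite inE /I/= in_itv/= => /andP[x0 x1].
  have x01 : 0 < x < 1 by lra.
  rewrite clampE; last by lra.
  by rewrite indicE mem_set ?in_itv//= !mulr1.
- by apply/measurable_EFinP; apply: measurable_funM => //; apply: measurable_indic; exact: measurable_itv.
- by move=> x; rewrite lee_fin mulr_ge0//; have /andP[] := clamp_pow j x.
Qed.

Let truncated_rec c j : 0 < b -> 0 < c < 2^-1 ->
  (a + j%:R) * \int[Q]_w (clamp (B w) ^+ j * \1_(I c) (B w)) -
  (a + b + j%:R) * \int[Q]_w (clamp (B w) ^+ j.+1 * \1_(I c) (B w)) =
  F j (1 - c) - F j c.
Proof.
move=> bp c01; have /andP[c0 c1] := c01.
rewrite /Rintegral !truncated//.
have i1 := integrable_I j c01; have i2 := integrable_I j.+1 c01.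
have mI : measurable (I c : set (measurableTypeR R)) by exact: measurable_itv.
rewrite -/(Rintegral _ _ _) -/(Rintegral _ _ _).
rewrite -(RintegralZl (a + j%:R) mI i1) -(RintegralZl (a + b + j%:R) mI i2).
have i1' := integrableZl mI (a + j%:R) i1; have i2' := integrableZl mI (a + b + j%:R) i2.
rewrite -(RintegralB mI i1' i2').
have FTC := @continuous_FTC2 R (f j) (F j) c (1 - c).
rewrite /Rintegral (_ : (\int[_]_(x in _) _ = (F j (1 - c))%:E - (F j c)%:E)%E) ?fineB//.
rewrite -FTC//; first lra.
- apply: continuous_in_subspaceT => x; rewrite inE /I/= in_itv/= => /andP[x0 x1].
  by apply: cvgB; apply: cvgM; try exact: cvg_cst; apply: cont_g0; lra.
- have cF (x : R) : 0 < x < 1 -> {for x, continuous (F j)}.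
    move=> x01; apply: differentiable_continuous; apply/derivable1_diffP.
    exact: (@ex_derive _ _ _ _ _ _ _ (is_derive_F j x01)).
  split.
  + move=> x; rewrite in_itv/= => /andP[x0 x1].
    by apply: (@ex_derive _ _ _ _ _ _ _ (is_derive_F j _)); lra.
  + by apply: cvg_at_right_filter; apply: cF; lra.
  + by apply: cvg_at_left_filter; apply: cF; lra.
- move=> x; rewrite in_itv/= => /andP[x0 x1]; rewrite derive1E.
  by apply: (@derive_val _ _ _ _ _ _ _ (is_derive_F j _)); lra.
Qed.

(** A geometric sequence, so that its real powers are geometric too; starting at [e^(-1)] keeps it
    below [1/2]. *)
Let c_ n : R := expR (- n.+1%:R).

Let c01 n : 0 < c_ n < 2^-1.
Proof.
rewrite expR_gt0/= /c_ expRN ltf_pV2 ?posrE ?expR_gt0//.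
apply: le_lt_trans (expR_gt1Dx _); last by rewrite pnatr_eq0.
by rewrite -[2]/(1 + 1) lerD2l ler1n.
Qed.

Let c_powR_cvg0 al : 0 < al -> c_ n `^ al @[n --> \oo] --> 0.
Proof.
move=> al0; rewrite (_ : (fun n => _) = fun n => (expR (- al)) ^+ n.+1).
  have := @cvg_expr R (expR (- al)); rewrite ger0_norm ?expR_ge0//.
  move=> h; rewrite (@cvg_shiftS _ (fun n => expR (- al) ^+ n)); apply: h.
  by rewrite -expR0 ltr_expR oppr_lt0.
by apply/funext => n; rewrite /c_ -expRM -expRM_natl; congr expR; ring.
Qed.

Let c_cvg0 : c_ n @[n --> \oo] --> 0.
Proof.
rewrite (_ : c_ = fun n => c_ n `^ 1); first exact: c_powR_cvg0.
by apply/funext => n; rewrite powRr1 ?expR_ge0.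
Qed.

Let F_cvg0 j : 0 < b -> F j (1 - c_ n) - F j (c_ n) @[n --> \oo] --> 0.
Proof.
move=> bp; have aj : 0 < a + j%:R by rewrite ltr_pwDl.
have pow1 (x al : R) : 0 <= x <= 1 -> 0 < al -> 0 <= x `^ al <= 1.
  move=> /andP[x0 x1] al0; rewrite powR_ge0/= -(congr1 (fun F => F al) (powR1 R))/=.
  by apply: ge0_ler_powR; rewrite ?nnegrE// ltW.
rewrite -[X in _ --> X]subr0; apply: cvgB.
- apply: (@squeeze_cvgr _ _ _ _ (cst 0) (fun n => c_ n `^ b / Beta_fun a b)).
  + apply: nearW => n; rewrite /F subKr; have /andP[h0 h1] := c01 n.
    have /andP[p0 p1] : 0 <= (1 - c_ n) `^ (a + j%:R) <= 1 by apply: pow1 => //; lra.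
    rewrite divr_ge0 ?mulr_ge0 ?powR_ge0//=.
    by rewrite ler_wpM2r ?invr_ge0// ler_piMl ?powR_ge0.
  + exact: cvg_cst.
  + by rewrite -[X in _ --> X](mul0r (Beta_fun a b)^-1); apply: cvgMl; exact: c_powR_cvg0.
- apply: (@squeeze_cvgr _ _ _ _ (cst 0) (fun n => c_ n `^ (a + j%:R) / Beta_fun a b)).
  + apply: nearW => n; rewrite /F; have /andP[h0 h1] := c01 n.
    have /andP[p0 p1] : 0 <= (1 - c_ n) `^ b <= 1 by apply: pow1 => //; lra.
    rewrite divr_ge0 ?mulr_ge0 ?powR_ge0//=.
    by rewrite ler_wpM2r ?invr_ge0// ler_piMr ?powR_ge0.
  + exact: cvg_cst.
  + by rewrite -[X in _ --> X](mul0r (Beta_fun a b)^-1); apply: cvgMl; exact: c_powR_cvg0.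
Qed.

Let beta_in01 : 0 < b -> {ae Q, forall w, 0 < B w < 1}.
Proof.
move=> bp; exists (B @^-1` (~` `]0, 1[)).
have mC : measurable (~` `]0, 1[ : set R) by exact: measurableC.
split; first by rewrite -[X in measurable X]setTI; exact: measurable_funPT.
  transitivity (beta_law a b (~` `]0, 1[)); first exact: hB.
  rewrite /beta_law bp (_ : ~` `]0%R, 1%R[ `&` _ = set0) ?integral_set0//.
  by rewrite -subset0 => x /= [+ h]; apply.
by move=> w /=; rewrite in_itv.
Qed.

Let truncated_cvg j : 0 < b ->
  \int[Q]_w (clamp (B w) ^+ j * \1_(I (c_ n)) (B w)) @[n --> \oo] -->
  \int[Q]_w (clamp (B w) ^+ j).
Proof.
move=> bp.
have mBj : measurable_fun setT (fun w => clamp (B w) ^+ j).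
  exact: (measurableT_comp (mclamp j) (measurable_funPT B)).
have fin : (\int[Q]_w (clamp (B w) ^+ j)%:E)%E \is a fin_num.
  apply: integrable_fin_num => //; apply: (@bounded_integrable _ _ _ _ _ 1) => // w.
  by have /andP[h0 h1] := clamp_pow j (B w); rewrite ger0_norm.
apply: fine_cvg; rewrite fineK//.
apply: (@bounded_cvg_integral _ _ _ _ _ _ 1) => //.
- move=> n; apply: measurable_funM => //.
  by apply: (measurableT_comp (measurable_indic _) (measurable_funPT B)); exact: measurable_itv.
- move=> n w; have /andP[h0 h1] := clamp_pow j (B w).
  by rewrite indicE; case: (_ \in _); rewrite ?mulr1 ?mulr0 ?normr0// ger0_norm.
apply: filterS (beta_in01 bp) => w /andP[w0 w1].
have e0 : 0 < Num.min (B w) (1 - B w) by rewrite lt_min w0 subr_gt0.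
apply: cvg_near_cst; near=> n; rewrite indicE mem_set ?mulr1// /I/= in_itv/=.
have : c_ n < Num.min (B w) (1 - B w).
  near: n; move/cvgrPdist_lt: c_cvg0 => /(_ _ e0); apply: filterS => n.
  by rewrite sub0r normrN ger0_norm ?expR_ge0.
by rewrite lt_min => /andP[h1 h2]; lra.
Unshelve. all: end_near.
Qed.

Let moment_rec j : (a + b + j%:R) * \int[Q]_w (clamp (B w) ^+ j.+1) =
  (a + j%:R) * \int[Q]_w (clamp (B w) ^+ j).
Proof.
have [bp|bN] := ltP 0 b.
  have h1 : (a + j%:R) * \int[Q]_w (clamp (B w) ^+ j * \1_(I (c_ n)) (B w)) -
    (a + b + j%:R) * \int[Q]_w (clamp (B w) ^+ j.+1 * \1_(I (c_ n)) (B w)) @[n --> \oo] -->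
    (a + j%:R) * \int[Q]_w (clamp (B w) ^+ j) - (a + b + j%:R) * \int[Q]_w (clamp (B w) ^+ j.+1).
    by apply: cvgB; apply: cvgM; try exact: cvg_cst; exact: truncated_cvg.
  have h2 := F_cvg0 j bp.
  rewrite (_ : (fun n => F j (1 - c_ n) - F j (c_ n)) = (fun n => (a + j%:R) * \int[Q]_w (clamp (B w) ^+ j * \1_(I (c_ n)) (B w)) -
    (a + b + j%:R) * \int[Q]_w (clamp (B w) ^+ j.+1 * \1_(I (c_ n)) (B w)))) in h2; last first.
    by apply/funext => n; rewrite truncated_rec.
  by apply/esym/eqP; rewrite -subr_eq0; apply/eqP; exact: (cvg_unique _ h1 h2).
(* For [b = 0] the law is the point mass at 1 and every moment is 1. *)
have bE : b = 0 by apply/eqP; rewrite eq_le bN.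
have E1 k : \int[Q]_w (clamp (B w) ^+ k) = 1.
  rewrite /Rintegral (_ : (\int[_]_(w in _) _ = 1)%E)//.
  have mk : measurable_fun setT (fun x => (clamp x ^+ k)%:E) by exact/measurable_EFinP.
  rewrite -[LHS](ge0_integral_distribution B mk); last first.
    by move=> x; rewrite lee_fin; have /andP[] := clamp_pow k x.
  transitivity (\int[\d_(1%R : R)]_x (clamp x ^+ k)%:E)%E; last first.
    by rewrite integral_dirac// diracT mul1e clampE ?expr1n ?ler01 ?lexx.
  apply: eq_measure_integral => A mA _.
  by transitivity (beta_law a b A); [exact: hB|rewrite /beta_law bE ltxx].
by rewrite !E1 bE addr0.
Qed.

Lemma beta_moment j :
  \int[Q]_w (Num.min 1 (Num.max 0 (B w)) ^+ j) * rising (a + b) j = rising a j.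
Proof.
elim: j => [|j IH].
  rewrite /rising !big_ord0 mulr1; under eq_Rintegral do rewrite expr0.
  by rewrite Rintegral_cst//= probability_setT mulr1.
have := moment_rec j; rewrite /clamp !risingS -IH => e.
transitivity (rising (a + b) j * ((a + b + j%:R) * \int[Q]_w (Num.min 1 (Num.max 0 (B w)) ^+ j.+1))).
  by ring.
by rewrite e; ring.
Qed.

End beta.

(** * From simple functions to the mean itself *)

Section mean_approximation.
Context {R : realType}.
Import HBNNSimple.

Lemma dominated_cvg_Rintegral d (T : measurableType d) (mu : {measure set T -> \bar R})
    (f_ : nat -> T -> R) (f g : T -> R) :
  (forall n, measurable_fun setT (f_ n)) -> measurable_fun setT f ->
  mu.-integrable setT (EFin \o g) ->
  {ae mu, forall w, f_ n w @[n --> \oo] --> f w} ->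
  {ae mu, forall w n, `|f_ n w| <= g w} ->
  \int[mu]_w f_ n w @[n --> \oo] --> \int[mu]_w f w.
Proof.
move=> mf_ mf ig fcvg fg.
have [|||||ii _ c] := @dominated_convergence _ _ _ mu _ measurableT
    (fun n w => (f_ n w)%:E) (EFin \o f) (EFin \o g) => //.
- by move=> n; exact/measurable_EFinP.
- exact/measurable_EFinP.
- apply: filterS fcvg => w fw _; apply/fine_cvgP; split; first exact: nearW.
  exact: fw.
- by apply: filterS fg => w h n _; rewrite lee_fin.
apply: fine_cvg; rewrite fineK//.
exact: integrable_fin_num ii.
Qed.

Lemma cvg_ln1Dy : ln (1 + x : R) @[x --> +oo] --> +oo.
Proof.
apply/cvgryPge => A; near=> x.
by rewrite -[A]expRK ler_ln ?posrE ?expR_gt0 ?ltr_pwDl// ler_wpDl.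
Unshelve. all: end_near.
Qed.

Let mmax : measurable_fun setT (fun x : R => (Num.max 0 x)%:E).
Proof. by apply/measurable_EFinP; exact: measurable_maxr. Qed.

(* The laws live on [0, +oo[, where [Num.max 0 x] is [x]. *)
Definition pos_approx n : {nnsfun R >-> R} := nnsfun_approx measurableT mmax n.

Lemma pos_approx_cvg x : pos_approx n x @[n --> \oo] --> Num.max 0 x.
Proof.
have h : (pos_approx n x)%:E @[n --> \oo] --> (Num.max 0 x)%:E.
  apply: (@cvg_nnsfun_approx _ _ _ _ measurableT _ mmax) => // y _.
  by rewrite lee_fin le_max lexx.
by have /fine_cvgP[] := h.
Qed.

Lemma pos_approx_nd x : {homo (fun n => pos_approx n x) : n m / (n <= m)%N >-> n <= m}.
Proof. by move=> n m nm; exact/lefP/nd_nnsfun_approx. Qed.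

Lemma pos_approx_le n x : pos_approx n x <= Num.max 0 x.
Proof.
rewrite -(cvg_lim (@Rhausdorff R) (@pos_approx_cvg x)).
apply: nondecreasing_cvgn_le; first exact: pos_approx_nd.
by apply/cvg_ex; exists (Num.max 0 x); exact: pos_approx_cvg.
Qed.

Lemma pos_approx_ge0 n x : 0 <= pos_approx n x. Proof. by []. Qed.

(* Thinning only adds an atom at 0, hence it multiplies the integral of
   [ln (1 + s * pos_approx n)] by p. *)
Lemma pos_approx0 n : pos_approx n 0 = 0.
Proof.
by apply/eqP; rewrite eq_le pos_approx_ge0 andbT (le_trans (pos_approx_le _ _))// maxxx.
Qed.

Lemma pos_approx_bound n : exists2 c, 0 < c & forall x, pos_approx n x <= c.
Proof.
have [M [_ hM]] := simple_bounded (pos_approx n).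
exists (Num.max 1 (M + 1)); first by rewrite lt_max ltr01.
move=> x; apply: le_trans (ler_norm _) _; apply: (hM _ _ x I).
by rewrite lt_max ltrDl ltr01 orbT.
Qed.

Lemma integrable_ln1D (K : probability R R) (lam : R) : 0 <= lam ->
  K.-integrable setT (EFin \o (fun x => ln (1 + Num.max 0 x))) ->
  K.-integrable setT (EFin \o (fun x => ln (1 + lam * Num.max 0 x))).
Proof.
move=> l0 h.
have hc : K.-integrable setT (EFin \o cst (ln (1 + lam))) by exact: finite_measure_integrable_cst.
apply: (le_integrable measurableT _ _ (integrableD measurableT hc h)).
  apply/measurable_EFinP; apply: (measurableT_comp (@measurable_ln R)).
  by apply: measurable_funD => //; apply: measurable_funM => //; exact: measurable_maxr.
move=> x _; have x0 : 0 <= Num.max 0 x by rewrite le_max lexx.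
have lx : 0 <= lam * Num.max 0 x by rewrite mulr_ge0.
rewrite /= lee_fin !ger0_norm ?addr_ge0 ?ln_ge0 ?lerDl//.
by rewrite -lnM ?posrE ?ltr_pwDl// ler_ln ?posrE ?mulr_gt0 ?ltr_pwDl//; lra.
Qed.

Section one_mean.
Context d (T : measurableType d) (P : probability T R).
Variables (theta : R) (K : probability R R) (D : R.-pker T ~> R).
Hypotheses (theta_gt0 : 0 < theta) (hD : dirichlet_process P theta K D).

Definition approx_mean n w := \int[D w]_x pos_approx n x.

Lemma measurable_approx_mean n : measurable_fun setT (approx_mean n).
Proof. exact: measurable_kernel_simple. Qed.

Lemma approx_mean_ge0 n w : 0 <= approx_mean n w.
Proof. by apply: Rintegral_ge0 => x _. Qed.

(** The mean as an extended real, before [fine] replaces an infinite value by 0. *)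
Let Mbar w := (\int[D w]_x (Num.max 0 x)%:E)%E.

Let Mbar_ge0 w : (0 <= Mbar w)%E.
Proof. by apply: integral_ge0 => x _; rewrite lee_fin le_max lexx. Qed.

Let random_meanE w : random_mean D w = fine (Mbar w).
Proof.
rewrite /random_mean /Rintegral/= integral_mkcond.
congr fine; apply: eq_integral => x _; rewrite patchE mem_setE in_itv/= andbT.
by case: leP => // /ltW/max_idPl ->.
Qed.

Lemma random_mean_ge0 w : 0 <= random_mean D w.
Proof. by rewrite random_meanE fine_ge0. Qed.

Let approx_mean_lee n c w : (forall x, pos_approx n x <= c) ->
  (\int[D w]_x (pos_approx n x)%:E <= c%:E)%E.
Proof.
move=> hc; have c0 : 0 <= c by rewrite (le_trans (pos_approx_ge0 n 0)).
rewrite -[leRHS]mule1 -(@prob_kernel _ _ _ _ _ D w) -integral_cst//.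
apply: ge0_le_integral => //.
- by move=> x _; rewrite lee_fin.
- exact/measurable_EFinP.
- by move=> x _; rewrite lee_fin.
Qed.

Let approx_mean_fin n w : (\int[D w]_x (pos_approx n x)%:E)%E \is a fin_num.
Proof.
have [c c0 hc] := pos_approx_bound n.
rewrite ge0_fin_numE; first exact: le_lt_trans (approx_mean_lee w hc) (ltry _).
by apply: integral_ge0 => x _; rewrite lee_fin.
Qed.

Lemma approx_mean_le n c w : (forall x, pos_approx n x <= c) -> approx_mean n w <= c.
Proof. by move=> hc; rewrite -lee_fin /approx_mean /Rintegral fineK ?approx_mean_lee. Qed.

Let approx_mean_cvg w : (approx_mean n w)%:E @[n --> \oo] --> Mbar w.
Proof.
have -> : (fun n => (approx_mean n w)%:E) = (fun n => \int[D w]_x (pos_approx n x)%:E)%E.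
  by apply/funext => n; exact: (fineK (approx_mean_fin n w)).
rewrite /Mbar (_ : (fun x => (Num.max 0 x)%:E) = (fun x => limn (fun n => (pos_approx n x)%:E))); last first.
  apply/funext => x; apply/esym/cvg_lim => //; apply/fine_cvgP; split; first exact: nearW.
  exact: pos_approx_cvg.
apply: cvg_monotone_convergence => //.
- by move=> n; exact/measurable_EFinP.
- by move=> n x _; rewrite lee_fin.
- by move=> x _ n m nm; rewrite lee_fin pos_approx_nd.
Qed.

Hypothesis lnK : K.-integrable setT (EFin \o (fun x => ln (1 + Num.max 0 x))).

Let L lam := \int[K]_x ln (1 + lam * Num.max 0 x).

Let S lam x := expR (- (theta * ln (1 + lam * x))).

Let S01 lam x : 0 <= lam -> 0 <= x -> `|S lam x| <= 1.
Proof.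
move=> l0 x0; rewrite ger0_norm ?expR_ge0// -expR0 ler_expR lerNl oppr0.
by rewrite mulr_ge0 ?(ltW theta_gt0)// ln_ge0// lerDl mulr_ge0.
Qed.

Let mS lam : measurable_fun setT (S lam).
Proof.
apply: measurableT_comp => //; apply: measurableT_comp => //; apply: measurable_funM => //.
by apply: (measurableT_comp (@measurable_ln R)); apply: measurable_funD => //; exact: measurable_funM.
Qed.

Let contS lam x : 0 <= lam -> 0 <= x -> {for x, continuous (S lam)}.
Proof.
move=> l0 x0.
have h : 0 < 1 + lam * x by rewrite ltr_pwDl// mulr_ge0.
have c1 : {for x, continuous (fun y : R => 1 + lam * y)}.
  by apply: cvgD; [exact: cvg_cst|apply: cvgM; [exact: cvg_cst|exact: cvg_id]].
have c2 : {for x, continuous (fun y => ln (1 + lam * y))}.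
  by apply: (@continuous_comp _ _ _ (fun y : R => 1 + lam * y) (@ln R)) => //; exact: continuous_ln.
apply: (@continuous_comp _ _ _ (fun y => - (theta * ln (1 + lam * y))) expR); last exact: continuous_expR.
by apply: cvgN; apply: cvgM => //; exact: cvg_cst.
Qed.

(** The limit of [S lam (approx_mean n w)]. Where the mean is infinite this limit is 0, whereas the
    default value 0 of [random_mean] would give [S lam 0 = 1]. *)
Let Z lam w := if (Mbar w == +oo)%E then 0 else S lam (random_mean D w).

Let mMbar : measurable_fun setT Mbar.
Proof.
pose k (z : T * R) : \bar R := (Num.max 0 z.2)%:E.
have k0 z : (0 <= k z)%E by rewrite lee_fin le_max lexx.
have mk : measurable_fun setT k by apply/measurable_EFinP; exact: measurable_maxr.
exact: (@measurable_fun_integral_finite_kernel _ _ _ _ _ k D k0 mk).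
Qed.

Let mMoo : measurable [set w | Mbar w = +oo%E].
Proof. by rewrite (_ : mkset _ = Mbar @^-1` [set +oo%E])//; exact: measurable_preimageT. Qed.

Let mZ lam : measurable_fun setT (Z lam).
Proof.
rewrite (_ : Z lam = fun w => S lam (random_mean D w) * \1_(~` [set w | Mbar w = +oo%E]) w).
  apply: measurable_funM; first exact: (measurableT_comp (mS lam) (measurable_random_mean D)).
  by apply: measurable_indic; exact: measurableC.
apply/funext => w; rewrite /Z indicE in_setC; case: eqP => h.
  by rewrite mem_set// mulr0.
by rewrite memNset// mulr1.
Qed.

Let approx_mean_fin_cvg w : (Mbar w < +oo)%E -> approx_mean n w @[n --> \oo] --> random_mean D w.
Proof.
move=> wfin; have := @approx_mean_cvg w; rewrite random_meanE.
rewrite -[Mbar w]fineK; last by rewrite ge0_fin_numE.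
by move=> /fine_cvgP[_].
Qed.

Let Z_cvg lam w : 0 < lam -> S lam (approx_mean n w) @[n --> \oo] --> Z lam w.
Proof.
move=> l0; rewrite /Z; case: eqP => [Moo|/eqP Mfin].
  have := @approx_mean_cvg w; rewrite Moo => /cvgeryP h.
  have h0 : (lam * x : R) @[x --> +oo] --> +oo by apply: gt0_cvgMry => //; exact: cvg_id.
  have h1 := cvg_comp _ _ h0 cvg_ln1Dy.
  have h2 : theta * ln (1 + lam * x) @[x --> +oo] --> +oo by exact: gt0_cvgMry theta_gt0 h1.
  have h3 := cvg_comp _ _ h2 (@cvgr_expR R).
  exact: (cvg_comp _ _ h h3).
apply: (cvg_comp _ _ (approx_mean_fin_cvg _)); first by rewrite lt_neqAle Mfin leey.
by apply: contS; [exact: ltW|exact: random_mean_ge0].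
Qed.

Let stieltjes0 lam : 0 < lam -> (\int[P]_w (Z lam w)%:E = (expR (- (theta * L lam)))%:E)%E.
Proof.
move=> l0.
have h1 : (\int[P]_w (S lam (approx_mean n w))%:E)%E @[n --> \oo] --> (\int[P]_w (Z lam w)%:E)%E.
  apply: (@bounded_cvg_integral _ _ _ _ _ _ 1) => //.
  - by move=> n; exact: (measurableT_comp (mS lam) (measurable_approx_mean n)).
  - by move=> n w; apply: S01; [exact: ltW|exact: approx_mean_ge0].
  - by apply: aeW => w; exact: Z_cvg.
rewrite (_ : (fun n => _) = fun n => (expR (- (theta * \int[K]_x ln (1 + lam * pos_approx n x))))%:E) in h1; last first.
  by apply/funext => n; exact: simple_mean_stieltjes theta_gt0 hD _ _ (ltW l0).
have h2 : expR (- (theta * \int[K]_x ln (1 + lam * pos_approx n x))) @[n --> \oo] --> expR (- (theta * L lam)).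
  apply: continuous_cvg; first exact: continuous_expR.
  apply: cvgN; apply: cvgM; first exact: cvg_cst.
  apply: (@dominated_cvg_Rintegral _ _ K (fun n x => ln (1 + lam * pos_approx n x)) _ (fun x => ln (1 + lam * Num.max 0 x))).
  - move=> n; apply: (measurableT_comp (@measurable_ln R)).
    by apply: measurable_funD => //; exact: measurable_funM.
  - apply: (measurableT_comp (@measurable_ln R)); apply: measurable_funD => //.
    by apply: measurable_funM => //; exact: measurable_maxr.
  - exact: integrable_ln1D (ltW l0) lnK.
  - apply: aeW => x; apply: continuous_cvg.
      by apply: continuous_ln; rewrite ltr_pwDl// mulr_ge0 ?le_max ?lexx// ltW.
    apply: cvgD; first exact: cvg_cst.
    by apply: cvgM; [exact: cvg_cst|exact: pos_approx_cvg].
  - apply: aeW => x n; rewrite ger0_norm; last by rewrite ln_ge0// lerDl mulr_ge0// ltW.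
    have x0 : 0 <= Num.max 0 x by rewrite le_max lexx.
    have l0' := ltW l0.
    rewrite ler_ln ?posrE ?ltr_pwDl ?mulr_ge0//.
    by rewrite lerD2l ler_wpM2l// pos_approx_le.
apply: (cvg_unique _ h1); first exact: ereal_hausdorff.
by apply/fine_cvgP; split; [exact: nearW|exact: h2].
Qed.

(** With [q] the mass of infinite means, the transform at [1/(n+1)] is at most [1 - q]. It tends to
    1, as the integrals [L] tend to 0 by domination with [ln (1 + x)]. *)
Let Moo0 : P [set w | Mbar w = +oo%E] = 0%E.
Proof.
pose q := fine (P [set w | Mbar w = +oo%E]).
have qE : P [set w | Mbar w = +oo%E] = q%:E by rewrite /q fineK// fin_num_measure.
rewrite qE; congr EFin; apply/eqP; rewrite eq_le; apply/andP; split; last by rewrite /q fine_ge0.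
have le1 n : expR (- (theta * L (n.+1%:R^-1))) <= 1 - q.
  have n0 : 0 < n.+1%:R^-1 :> R by rewrite invr_gt0.
  rewrite -lee_fin -(stieltjes0 n0).
  apply: (@le_trans _ _ (\int[P]_w (\1_(~` [set w | Mbar w = +oo%E]) w)%:E)%E).
    apply: ge0_le_integral => //.
    - by move=> w _; rewrite /Z lee_fin; case: ifP => // _; rewrite expR_ge0.
    - exact/measurable_EFinP.
    - by apply/measurable_EFinP; apply: measurable_indic; exact: measurableC.
    move=> w _; rewrite /Z indicE in_setC lee_fin; case: eqP => h; first by rewrite ler0n.
    rewrite memNset//; apply: le_trans (ler_norm _) _.
    by apply: S01; [exact: ltW|exact: random_mean_ge0].
  rewrite integral_indic ?setIT//; last exact: measurableC.
  apply: (@le_trans _ _ (P (~` [set w | Mbar w = +oo%E]))) => //.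
  by rewrite (probability_setC P mMoo) qE.
have Lc : L (n.+1%:R^-1) @[n --> \oo] --> 0.
  rewrite -[X in _ --> X](_ : \int[K]_x (cst 0) x = 0); last by rewrite Rintegral_cst// mul0r.
  apply: (@dominated_cvg_Rintegral _ _ K (fun n x => ln (1 + n.+1%:R^-1 * Num.max 0 x)) (cst 0) (fun x => ln (1 + Num.max 0 x))) => //.
  - move=> n; apply: (measurableT_comp (@measurable_ln R)); apply: measurable_funD => //.
    by apply: measurable_funM => //; exact: measurable_maxr.
  - apply: aeW => x; rewrite /cst -[X in _ --> X](@ln1 R).
    apply: continuous_cvg; first exact: continuous_ln.
    rewrite -[X in _ --> X]addr0; apply: cvgD; first exact: cvg_cst.
    by rewrite -[X in _ --> X](mul0r (Num.max 0 x)); apply: cvgMl; exact: cvg_harmonic.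
  - apply: aeW => x n; have x0 : 0 <= Num.max 0 x by rewrite le_max lexx.
    rewrite ger0_norm; last by rewrite ln_ge0// lerDl mulr_ge0.
    rewrite ler_ln ?posrE ?ltr_pwDl ?mulr_ge0// lerD2l ler_piMl// invf_le1//.
    by rewrite ler1n.
suff : 1 <= 1 - q by rewrite lerBrDl -lerBrDr subrr.
have Ec : expR (- (theta * L (n.+1%:R^-1))) @[n --> \oo] --> (1 : R).
  rewrite -[X in _ --> X](@expR0 R) -[X in expR X]oppr0 -[X in - X](mulr0 theta).
  apply: continuous_cvg; first exact: continuous_expR.
  by apply: cvgN; apply: cvgM => //; exact: cvg_cst.
by apply: (cvgr_to_le Ec); exact: nearW.
Qed.

Lemma approx_mean_ae_cvg : {ae P, forall w, approx_mean n w @[n --> \oo] --> random_mean D w}.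
Proof.
exists [set w | Mbar w = +oo%E]; split => //.
move=> w /=; apply: contra_notP => h; apply: approx_mean_fin_cvg.
by rewrite lt_neqAle leey andbT; apply/eqP.
Qed.

Lemma mean_stieltjes lam : 0 < lam ->
  (\int[P]_w (expR (- (theta * ln (1 + lam * random_mean D w))))%:E =
   (expR (- (theta * \int[K]_x ln (1 + lam * Num.max 0 x))))%:E)%E.
Proof.
move=> l0; rewrite -(stieltjes0 l0); apply: ae_eq_integral => //.
- by apply/measurable_EFinP; exact: (measurableT_comp (mS lam) (measurable_random_mean D)).
- exact/measurable_EFinP.
exists [set w | Mbar w = +oo%E]; split => //.
move=> w /=; apply: contra_notP => h _; rewrite /Z; case: eqP => //.
Qed.

End one_mean.

End mean_approximation.

(** * Equality in law of a mean with a mean times a Beta variable *)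

Section mean_law.
Context {R : realType}.
Import HBNNSimple.

(** [moment_lt] handles events [U < a] while [measure_ray_unique] wants upper rays; negating the
    variables matches the two. *)
Lemma moment_unique d1 d2 (T1 : measurableType d1) (T2 : measurableType d2)
    (P1 : {finite_measure set T1 -> \bar R}) (P2 : {finite_measure set T2 -> \bar R})
    (U1 : T1 -> R) (U2 : T2 -> R) :
  measurable_fun setT U1 -> measurable_fun setT U2 ->
  (forall w, 0 <= U1 w <= 1) -> (forall w, 0 <= U2 w <= 1) ->
  (forall k, \int[P1]_w (U1 w ^+ k)%:E = \int[P2]_w (U2 w ^+ k)%:E)%E ->
  forall A, measurable A -> P1 (U1 @^-1` A) = P2 (U2 @^-1` A).
Proof.
move=> mU1 mU2 U101 U201 mom A mA.
have mopp : measurable_fun setT (-%R : R -> R) by exact: oppr_measurable.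
have mN1 : measurable_fun setT (fun w => - U1 w) by exact: (measurableT_comp mopp mU1).
have mN2 : measurable_fun setT (fun w => - U2 w) by exact: (measurableT_comp mopp mU2).
have PT : P1 setT = P2 setT.
  by have := mom 0%N; under eq_integral do rewrite expr0;
    under [RHS]eq_integral do rewrite expr0; rewrite !integral_cst// !mul1e.
have key B : measurable B -> P1 ((fun w => - U1 w) @^-1` B) = P2 ((fun w => - U2 w) @^-1` B).
  apply: (@measure_ray_unique R (pushforward P1 (fun w => - U1 w)) (pushforward P2 (fun w => - U2 w))) => //.
    by rewrite ltey_eq fin_num_measure// preimage_setT.
  move=> a; rewrite -[LHS]/(P1 ((fun w => - U1 w) @^-1` _)) -[RHS]/(P2 ((fun w => - U2 w) @^-1` _)).
  have E d (T : measurableType d) (U : T -> R) : (fun w => - U w) @^-1` `]a, +oo[ = [set w | U w < - a].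
    by apply/seteqP; split => w /=; rewrite in_itv/= andbT ltrNr.
  rewrite !E; have [a1|a1] := leP (- a) 1; have [a0|a0] := ltP 0 (- a).
  - by apply: moment_lt => //; rewrite a0.
  - have empty d (T : measurableType d) (U : T -> R) : (forall w, 0 <= U w <= 1) -> [set w | U w < - a] = set0.
      move=> U01; apply/seteqP; split => // w /=; have /andP[u0 _] := U01 w.
      by rewrite ltNge (le_trans a0).
    by rewrite !empty// !measure0.
  - have full d (T : measurableType d) (U : T -> R) : (forall w, 0 <= U w <= 1) -> [set w | U w < - a] = setT.
      move=> U01; apply/seteqP; split => // w _ /=; have /andP[_ u1] := U01 w.
      exact: le_lt_trans u1 a1.
    by rewrite !full.
  - by move: (lt_le_trans a1 a0); rewrite ltNge ler01.
have -> : U1 @^-1` A = (fun w => - U1 w) @^-1` (-%R @^-1` A).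
  by apply/seteqP; split => w /=; rewrite opprK.
have -> : U2 @^-1` A = (fun w => - U2 w) @^-1` (-%R @^-1` A).
  by apply/seteqP; split => w /=; rewrite opprK.
by apply: key; exact: measurable_preimageT.
Qed.

Let clamp (x : R) := Num.min 1 (Num.max 0 x).

Let clamp01 x : 0 <= clamp x <= 1.
Proof. by rewrite /clamp le_min ler01 le_max lexx ge_min lexx. Qed.

Let clampE x : 0 <= x <= 1 -> clamp x = x.
Proof. by move=> /andP[x0 x1]; rewrite /clamp max_r// min_r. Qed.

Let mclamp : measurable_fun setT clamp.
Proof. by apply: measurable_minr => //; exact: measurable_maxr. Qed.

Variables (a b : R) (K H : probability R R).
Hypotheses (a0 : 0 < a) (b0 : 0 <= b).
(** Thinning enters this section only through this identity, stated for simple functions that vanish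
    at 0; [pos_approx n] is such a function. *)
Hypothesis KH : forall h : {nnsfun R >-> R}, h 0 = 0 -> forall u, 0 <= u ->
  (a + b) * \int[K]_x ln (1 + u * h x) = a * \int[H]_x ln (1 + u * h x).
Hypothesis lnK : K.-integrable setT (EFin \o (fun x => ln (1 + Num.max 0 x))).
Hypothesis lnH : H.-integrable setT (EFin \o (fun x => ln (1 + Num.max 0 x))).

Section two_processes.
Context d1 (T1 : measurableType d1) (P1 : probability T1 R) (D1 : R.-pker T1 ~> R).
Context d2 (T2 : measurableType d2) (P2 : probability T2 R) (D2 : R.-pker T2 ~> R).
Variable B : {RV P2 >-> R}.
Hypothesis hD1 : dirichlet_process P1 (a + b) K D1.
Hypothesis hD2 : dirichlet_process P2 a H D2.
Hypothesis hB : has_law P2 B (beta_law a b).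

(** [B] is assumed independent of the mean, not of its approximations. On the product space the
    second coordinate supplies an independent copy of [B] for the approximate means. *)
Let PP : probability (T2 * T2)%type R := (P2 \x P2)%E.

Let ab0 : 0 < a + b. Proof. by rewrite ltr_pwDl. Qed.

Let mB1 j : measurable_fun setT (fun w => (clamp (B w) ^+ j)%:E).
Proof.
apply/measurable_EFinP; apply: measurable_funX.
exact: (measurableT_comp mclamp (measurable_funPT B)).
Qed.

Let mX n j : measurable_fun setT (fun w => (approx_mean D2 n w ^+ j)%:E).
Proof. by apply/measurable_EFinP; apply: measurable_funX; exact: measurable_approx_mean. Qed.

Let approx_moment n j :
  (\int[P1]_w (approx_mean D1 n w ^+ j)%:E =
   \int[P2]_w (approx_mean D2 n w ^+ j)%:E * \int[P2]_w (clamp (B w) ^+ j)%:E)%E.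
Proof.
have := simple_mean_moment_eq ab0 a0 hD1 hD2 (KH (@pos_approx0 R n)) j.
have := beta_moment a0 b0 hB j.
have Bfin : (\int[P2]_w (clamp (B w) ^+ j)%:E)%E \is a fin_num.
  apply: integrable_fin_num => //; apply: (@bounded_integrable _ _ _ _ _ 1).
    by have /measurable_EFinP := mB1 j.
  by move=> w; have /andP[h0 h1] := clamp01 (B w); rewrite ger0_norm ?exprn_ge0 ?exprn_ile1.
move=> <- e; have r0 := rising_gt0 j ab0.
have : (\int[P1]_w (approx_mean D1 n w ^+ j)%:E * (rising (a + b) j)%:E * ((rising (a + b) j)^-1)%:E =
   \int[P2]_w (approx_mean D2 n w ^+ j)%:E * \int[P2]_w (clamp (B w) ^+ j)%:E *
   (rising (a + b) j)%:E * ((rising (a + b) j)^-1)%:E)%E.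
  congr (_ * _)%E; rewrite [LHS]e -muleA; congr (_ * _)%E.
  by rewrite EFinM /Rintegral fineK.
by rewrite -!muleA -EFinM divff ?gt_eqF// !mule1.
Qed.

Let approx_law n (f : R -> \bar R) : measurable_fun setT f -> (forall x, 0 <= f x)%E ->
  (\int[P1]_w f (approx_mean D1 n w) =
   \int[P2 \x P2]_z f (approx_mean D2 n z.1 * clamp (B z.2))%R)%E.
Proof.
move=> mf f0; have [c c0 hc] := @pos_approx_bound R n.
have mX2 : measurable_fun setT (fun z : T2 * T2 => approx_mean D2 n z.1).
  exact: (measurableT_comp (measurable_approx_mean D2 n) measurable_fst).
have mB2 : measurable_fun setT (fun z : T2 * T2 => clamp (B z.2)).
  by apply: (measurableT_comp mclamp); exact: (measurableT_comp (measurable_funPT B) measurable_snd).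
(* Dividing by a bound [c] of [pos_approx n] brings both variables into [[0, 1]], where moments
   determine the law. *)
pose U1 w := approx_mean D1 n w / c.
pose U2 (z : T2 * T2) := approx_mean D2 n z.1 * clamp (B z.2) / c.
have mU1 : measurable_fun setT U1 by apply: measurable_funM => //; exact: measurable_approx_mean.
have mU2 : measurable_fun setT U2 by apply: measurable_funM => //; exact: measurable_funM.
have U101 w : 0 <= U1 w <= 1.
  by rewrite /U1 divr_ge0 ?(ltW c0) ?approx_mean_ge0//= ler_pdivrMr// mul1r approx_mean_le.
have U201 z : 0 <= U2 z <= 1.
  have /andP[h0 h1] := clamp01 (B z.2).
  rewrite /U2 divr_ge0 ?(ltW c0) ?mulr_ge0 ?approx_mean_ge0//= ler_pdivrMr// mul1r.
  by rewrite -[c]mulr1 ler_pM ?approx_mean_ge0 ?approx_mean_le.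
have law := @moment_unique _ _ _ _ P1 PP U1 U2 mU1 mU2 U101 U201.
have mfc : measurable_fun setT (fun x : R => f (c * x)).
  by apply: (measurableT_comp mf); exact: measurable_funM.
have cK x : c * (x / c) = x by rewrite mulrCA divff ?mulr1// gt_eqF.
transitivity (\int[P1]_w f (c * U1 w)%R)%E.
  by apply: eq_integral => w _; rewrite /U1 cK.
transitivity (\int[P2 \x P2]_z f (c * U2 z)%R)%E; last first.
  by apply: eq_integral => w _; rewrite /U2 cK.
apply: (law_ge0_integral mU1 mU2 _ mfc) => //; apply: law => j.
have i0 : 0 <= c^-1 ^+ j by rewrite exprn_ge0// invr_ge0 ltW.
transitivity ((c^-1 ^+ j)%:E * \int[P1]_w (approx_mean D1 n w ^+ j)%:E)%E.
  rewrite -ge0_integralZl_EFin//.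
  - by apply: eq_integral => w _; rewrite -EFinM /U1 exprMn mulrC.
  - by move=> w _; rewrite lee_fin exprn_ge0// approx_mean_ge0.
  - by apply/measurable_EFinP; apply: measurable_funX; exact: measurable_approx_mean.
rewrite approx_moment.
rewrite fubini_tonelli1; last 2 first.
- by apply/measurable_EFinP; exact: measurable_funX.
- by move=> z; rewrite lee_fin exprn_ge0//; have /andP[] := U201 z.
rewrite muleA -ge0_integralZl_EFin//; last by move=> w _; rewrite lee_fin exprn_ge0// approx_mean_ge0.
rewrite -ge0_integralZr//; last 3 first.
- by apply: emeasurable_funM.
- by move=> w _; rewrite mule_ge0// lee_fin// exprn_ge0// approx_mean_ge0.
- by apply: integral_ge0 => w _; rewrite lee_fin exprn_ge0//; have /andP[] := clamp01 (B w).
apply: eq_integral => w _; rewrite /fubini_F/=.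
rewrite -ge0_integralZl//; last 2 first.
- by move=> w' _; rewrite lee_fin exprn_ge0//; have /andP[] := clamp01 (B w').
- by rewrite mule_ge0// lee_fin// exprn_ge0// approx_mean_ge0.
by apply: eq_integral => w' _; rewrite /U2 -!EFinM /= !exprMn; congr EFin; ring.
Qed.

Let approx_cvg : {ae (P2 \x P2)%E, forall z, approx_mean D2 n z.1 @[n --> \oo] --> random_mean D2 z.1}.
Proof.
have [N [mN N0 sub]] := approx_mean_ae_cvg a0 hD2 lnH.
exists (N `*` setT); split; first exact: measurableX.
  transitivity (P2 N * P2 setT)%E; first exact: product_measure1E.
  by rewrite N0 mul0e.
by move=> z /= h; split => //; exact: sub.
Qed.

Hypothesis indMB : independent_RV P2 (random_mean D2) B.

Lemma random_mean_eq_law_beta : eq_law P1 P2 (random_mean D1) (random_mean D2 \* B).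
Proof.
pose M1 := random_mean D1; pose M2 := random_mean D2.
have mM1 : measurable_fun setT M1 := measurable_random_mean D1.
have mM2 : measurable_fun setT M2 := measurable_random_mean D2.
have mB : measurable_fun setT B := measurable_funPT B.
have mMB : measurable_fun setT (M2 \* B) by exact: measurable_funM.
have B01 := beta_ae01 hB.
suff h A : measurable A -> P1 (M1 @^-1` A) = P2 ((M2 \* B) @^-1` A) by exact: h.
apply: laplace_unique => //.
- rewrite (_ : _ @^-1` _ = set0) ?measure0//; apply/seteqP; split => // w /=.
  by rewrite in_itv/= ltNge random_mean_ge0.
- case: B01 => N [mN N0 sub]; apply/eqP; rewrite eq_le measure_ge0 andbT -N0 le_measure ?inE//.
    exact: measurable_preimageT.
  move=> w /=; rewrite in_itv/= => v0; apply: sub => /= /andP[h0 _].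
  by move: v0; rewrite ltNge mulr_ge0// random_mean_ge0.
move=> k; pose e (x : R) := expR (- (k%:R * x)).
have me : measurable_fun setT e.
  by apply: measurableT_comp => //; apply: measurableT_comp => //; exact: measurable_funM.
have me' : measurable_fun setT (fun x => (e x)%:E) by exact/measurable_EFinP.
have e0 x : (0 <= (e x)%:E)%E by rewrite lee_fin expR_ge0.
have e1 x : 0 <= x -> `|e x| <= 1.
  move=> x0; rewrite ger0_norm ?expR_ge0// -expR0 ler_expR lerNl oppr0.
  by rewrite mulr_ge0.
have ce : continuous e.
  move=> x; apply: (@continuous_comp _ _ _ (fun x : R => - (k%:R * x)) expR); last exact: continuous_expR.
  by apply: cvgN; apply: cvgM; [exact: cvg_cst|exact: cvg_id].
have c1 : (\int[P1]_w (e (approx_mean D1 n w))%:E)%E @[n --> \oo] --> (\int[P1]_w (e (M1 w))%:E)%E.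
  apply: (@bounded_cvg_integral _ _ _ _ _ _ 1).
  - by move=> n; exact: (measurableT_comp me (measurable_approx_mean D1 n)).
  - exact: (measurableT_comp me mM1).
  - by move=> n w; apply: e1; exact: approx_mean_ge0.
  - by apply: filterS (approx_mean_ae_cvg ab0 hD1 lnK) => w h; exact: (cvg_comp _ _ h (ce _)).
have mX2 n : measurable_fun setT (fun z : T2 * T2 => approx_mean D2 n z.1).
  exact: (measurableT_comp (measurable_approx_mean D2 n) measurable_fst).
have mB2 : measurable_fun setT (fun z : T2 * T2 => clamp (B z.2)).
  by apply: (measurableT_comp mclamp); exact: (measurableT_comp (measurable_funPT B) measurable_snd).
have mM2' : measurable_fun setT (fun z : T2 * T2 => M2 z.1).
  exact: (measurableT_comp mM2 measurable_fst).
have c2 : (\int[P2 \x P2]_z (e (approx_mean D2 n z.1 * clamp (B z.2))%R)%:E)%E @[n --> \oo] -->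
          (\int[P2 \x P2]_z (e (M2 z.1 * clamp (B z.2))%R)%:E)%E.
  apply: (@bounded_cvg_integral _ _ _ PP
    (fun n z => e (approx_mean D2 n z.1 * clamp (B z.2)))
    (fun z => e (M2 z.1 * clamp (B z.2))) 1).
  - by move=> n; apply: (measurableT_comp me); exact: measurable_funM.
  - by apply: (measurableT_comp me); exact: measurable_funM.
  - move=> n z; apply: e1; have /andP[h0 _] := clamp01 (B z.2).
    by rewrite mulr_ge0// approx_mean_ge0.
  - apply: filterS approx_cvg => z h.
    have h' : approx_mean D2 n z.1 * clamp (B z.2) @[n --> \oo] --> M2 z.1 * clamp (B z.2).
      by apply: cvgMl.
    exact: (cvg_comp _ _ h' (ce _)).
rewrite (_ : (fun n => _) = (fun n => \int[P1]_w (e (approx_mean D1 n w))%:E)%E) in c2; last first.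
  by apply/funext => n; rewrite (approx_law n me').
rewrite (cvg_unique _ c1 c2); last exact: ereal_hausdorff.
pose F (z : R * R) := (e (z.1 * clamp z.2))%:E.
have mF : measurable_fun setT F.
  apply/measurable_EFinP; apply: (measurableT_comp me); apply: measurable_funM.
    exact: measurable_fst.
  exact: (measurableT_comp mclamp measurable_snd).
(* In the limit the product space can be left: the mean itself is independent of [B] under [P2]. *)
transitivity (\int[P2]_w F (M2 w, B w))%E.
  rewrite (indep_integral mM2 mB indMB mF); last by move=> z; exact: e0.
  by rewrite fubini_tonelli1//; apply/measurable_EFinP; apply: (measurableT_comp me); exact: measurable_funM.
apply: ae_eq_integral => //.
- exact: (measurableT_comp mF (measurable_fun_pair mM2 mB)).
- exact: (measurableT_comp me' mMB).
by apply: filterS B01 => w w01 _; rewrite /F/= clampE.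
Qed.

End two_processes.

Lemma mean_eq_law_mean_betaP : mean_eq_law_mean_beta (a + b) K a H a b.
Proof.
move=> d1 T1 P1 D1 d2 T2 P2 D2 B hD1 hD2 hB ind.
exact: random_mean_eq_law_beta.
Qed.

End mean_law.

Section laws_of_integrals.
Context {R : realType}.

Lemma integral_law d1 d2 d (T1 : measurableType d1) (T2 : measurableType d2)
    (U : measurableType d) (P1 : {measure set T1 -> \bar R}) (P2 : {measure set T2 -> \bar R})
    (X1 : T1 -> U) (X2 : T2 -> U) (f : U -> \bar R) :
  measurable_fun setT X1 -> measurable_fun setT X2 ->
  (forall A, measurable A -> P1 (X1 @^-1` A) = P2 (X2 @^-1` A)) ->
  measurable_fun setT f ->
  (\int[P1]_w f (X1 w) = \int[P2]_w f (X2 w))%E.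
Proof.
move=> mX1 mX2 h mf; rewrite integralE [RHS]integralE; congr (_ - _)%E.
  under eq_integral do rewrite funeposE; under [RHS]eq_integral do rewrite funeposE.
  apply: (law_ge0_integral mX1 mX2 h (f := fun x => maxe (f x) 0%E)).
    rewrite (_ : (fun x => _) = f^\+%E); first exact: measurable_funepos.
    by apply/funext => x; rewrite funeposE.
  by move=> x; rewrite le_max lexx orbT.
under eq_integral do rewrite funenegE; under [RHS]eq_integral do rewrite funenegE.
apply: (law_ge0_integral mX1 mX2 h (f := fun x => maxe (- f x)%E 0%E)).
  rewrite (_ : (fun x => _) = f^\-%E); first exact: measurable_funeneg.
  by apply/funext => x; rewrite funenegE.
by move=> x; rewrite le_max lexx orbT.
Qed.

End laws_of_integrals.

(** * Integration against the thinned law *)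

Section thinning_theory.
Context {R : realType} (p : R) (H : probability R R).
Hypotheses (p0 : 0 < p) (p1 : p <= 1).

Let q0 : 0 <= 1 - p. Proof. by rewrite subr_ge0. Qed.

Lemma thinningE A : thinning p H A = (p%:E * H A + (1 - p)%:E * \d_(0%R : R) A)%E.
Proof. by rewrite /thinning (ltW p0) p1. Qed.

Lemma ge0_integral_thinning (f : R -> \bar R) : measurable_fun setT f ->
  (forall x, 0 <= f x)%E ->
  (\int[thinning p H]_x f x = p%:E * \int[H]_x f x + (1 - p)%:E * f 0%R)%E.
Proof.
move=> mf f0.
transitivity (\int[measure_add (mscale (NngNum (ltW p0)) H) (mscale (NngNum q0) (\d_(0%R : R)))]_x f x)%E.
  apply: eq_measure_integral => A mA _.
  transitivity (p%:E * H A + (1 - p)%:E * \d_(0%R : R) A)%E; first exact: thinningE.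
  exact/esym/measure_addE.
rewrite ge0_integral_measure_add// !ge0_integral_mscale// integral_dirac//.
by rewrite diracT mul1e.
Qed.

(** The logarithmic potential may be [-oo], so the formula is needed beyond integrable functions. A
    finite positive part and a finite value at 0 exclude [+oo] from every sum, and if the negative
    part is infinite both sides are [-oo] because [p > 0]. *)
Lemma integral_thinning (f : R -> \bar R) : measurable_fun setT f ->
  (\int[H]_x f^\+ x < +oo)%E -> f 0%R \is a fin_num ->
  (\int[thinning p H]_x f x = p%:E * \int[H]_x f x + (1 - p)%:E * f 0%R)%E.
Proof.
move=> mf fin f0fin; rewrite integralE [X in (p%:E * X)%E]integralE.
rewrite !ge0_integral_thinning//; [|exact: measurable_funeneg|exact: measurable_funepos].
have : (0 <= \int[H]_x f^\+ x)%E by exact: integral_ge0.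
have : (0 <= \int[H]_x f^\- x)%E by exact: integral_ge0.
move: f0fin; case f0E : (f 0%R) => [v| |]// _.
rewrite funeposE funenegE f0E -EFinN -!EFin_max.
have vE : v = Num.max v 0 - Num.max (- v) 0.
  have [v0|v0] := leP v 0; first by rewrite max_l ?oppr_ge0//; ring.
  by rewrite max_r ?oppr_le0 ?(ltW v0)//; ring.
move: fin; rewrite {3}vE; move: (Num.max v 0) (Num.max (- v) 0) => a c.
case: (\int[H]_x f^\+ x)%E => [u| |]// _; case: (\int[H]_x f^\- x)%E => [w| |]// _ _.
  apply: (congr1 EFin (x := p * u + (1 - p) * a - (p * w + (1 - p) * c))
    (y := p * (u - w) + (1 - p) * (a - c))); ring.
by rewrite /= gt0_muley// gt0_muleNy.
Qed.

Lemma Rintegral_thinning (f : R -> R) : H.-integrable setT (EFin \o f) ->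
  \int[thinning p H]_x f x = p * \int[H]_x f x + (1 - p) * f 0.
Proof.
move=> fi; rewrite /Rintegral integral_thinning//; last 2 first.
- exact: measurable_int fi.
- rewrite -ge0_fin_numE; first by apply: integrable_pos_fin_num fi.
  exact: integral_ge0.
have ff : (\int[H]_x (f x)%:E)%E \is a fin_num by exact: integrable_fin_num fi.
by rewrite -(fineK ff) -!EFinM -EFinD.
Qed.

Lemma integrable_thinning (f : R -> R) : H.-integrable setT (EFin \o f) ->
  (thinning p H).-integrable setT (EFin \o f).
Proof.
move=> fi; have /integrableP[mf fin] := fi.
apply/integrableP; split => //; rewrite ge0_integral_thinning//; last exact: measurableT_comp.
by rewrite lte_add_pinfty// lte_mul_pinfty ?lee_fin ?(ltW p0)//= ltry.
Qed.

End thinning_theory.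

(** * Logarithmic integrals and generalized gamma convolutions *)

Section logarithmic_moment.
Context {R : realType}.

(** Below 0 the clamped integrand is [ln 1 = 0]. This links the restricted integrals in the
    logarithmic moment and in [GGC] with integrals over the whole line. *)
Lemma integral_itv0y_max (K : probability R R) (lam : R) :
  (\int[K]_(x in `[0%R, +oo[) (ln (1 + lam * x))%:E =
   \int[K]_x (ln (1 + lam * Num.max 0 x))%:E)%E.
Proof.
rewrite integral_mkcond; apply: eq_integral => x _; rewrite patchE.
case: ifPn; first by rewrite inE/= in_itv/= andbT => x0; rewrite max_r.
rewrite notin_setE/= in_itv/= andbT => /negP; rewrite -ltNge => x0.
by rewrite max_l ?(ltW x0)// mulr0 addr0 ln1.
Qed.

Lemma measurable_ln1Dmax (lam : R) : measurable_fun setT (fun x : R => ln (1 + lam * Num.max 0 x)).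
Proof.
apply: (measurableT_comp (@measurable_ln R)); apply: measurable_funD => //.
by apply: measurable_funM => //; exact: measurable_maxr.
Qed.

Lemma ln1Dmax_ge0 (lam x : R) : 0 <= lam -> 0 <= ln (1 + lam * Num.max 0 x).
Proof. by move=> l0; rewrite ln_ge0// lerDl mulr_ge0// le_max lexx. Qed.

Lemma integrable_ln_max (K : probability R R) :
  (\int[K]_(x in `[0%R, +oo[) (ln (1 + x))%:E < +oo)%E ->
  K.-integrable setT (EFin \o (fun x => ln (1 + Num.max 0 x))).
Proof.
have e x : ln (1 + x) = ln (1 + 1 * x) :> R by rewrite mul1r.
under eq_integral do rewrite e; rewrite integral_itv0y_max => h.
apply/integrableP; split.
  apply/measurable_EFinP; rewrite (_ : (fun x => _) = fun x => ln (1 + 1 * Num.max 0 x)); first exact: measurable_ln1Dmax.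
  by apply/funext => x; rewrite mul1r.
apply: le_lt_trans h; rewrite le_eqVlt; apply/orP; left; apply/eqP.
apply: eq_integral => x _; rewrite /= mul1r ger0_norm//.
by have := @ln1Dmax_ge0 1 x ler01; rewrite mul1r.
Qed.

Section thinning_log.
Variables (p : R) (H : probability R R).
Hypotheses (p0 : 0 < p) (p1 : p <= 1).

Lemma ge0_integral_ln_thinning (lam : R) : 0 <= lam ->
  (\int[thinning p H]_(x in `[0%R, +oo[) (ln (1 + lam * x))%:E =
   p%:E * \int[H]_(x in `[0%R, +oo[) (ln (1 + lam * x))%:E)%E.
Proof.
move=> l0; rewrite !integral_itv0y_max ge0_integral_thinning//.
- by rewrite maxxx mulr0 addr0 ln1 mule0 adde0.
- by apply/measurable_EFinP; exact: measurable_ln1Dmax.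
- by move=> x; rewrite lee_fin ln1Dmax_ge0.
Qed.

Lemma GGC_thinning (theta : R) : GGC theta (thinning p H) = GGC (theta * p) H.
Proof.
apply/seteqP; split => mu [mu1 h]; split => // lam l0; rewrite h// ge0_integral_ln_thinning ?ltW//.
  by rewrite EFinM muleA.
by rewrite EFinM muleA.
Qed.

Lemma Rintegral_ln_thinning (f : R -> R) : H.-integrable setT (EFin \o f) -> f 0 = 0 ->
  \int[thinning p H]_x f x = p * \int[H]_x f x.
Proof. by move=> fi f0; rewrite Rintegral_thinning// f0 mulr0 addr0. Qed.

End thinning_log.

End logarithmic_moment.

(** * Gamma multiples of the mean *)

Section gamma_mean.
Context {R : realType}.
Context d (T : measurableType d) (P : probability T R).
Variables (theta : R) (K : probability R R) (D : R.-pker T ~> R) (G : {RV P >-> R}).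
Hypotheses (theta_gt0 : 0 < theta) (hD : dirichlet_process P theta K D).
Hypothesis hG : has_law P G (gamma_law theta).
Hypothesis ind : independent_RV P G (random_mean D).
Hypothesis lnK : K.-integrable setT (EFin \o (fun x => ln (1 + Num.max 0 x))).

Let mM : measurable_fun setT (random_mean D) := measurable_random_mean D.

Let mG : measurable_fun setT G := measurable_funPT G.

(** Conditioning on the mean [m] integrates [e^(- lam m G)] to [(1 + lam m)^(- theta)], which
    reduces the claim to [mean_stieltjes]. *)
Lemma gamma_mean_laplace lam : 0 < lam ->
  (\int[P]_w (expR (- (lam * (G w * random_mean D w))))%:E =
   (expR (- (theta * \int[K]_x ln (1 + lam * Num.max 0 x))))%:E)%E.
Proof.
move=> l0; rewrite -(mean_stieltjes theta_gt0 hD lnK l0).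
pose F (z : R * R) := (expR (- (lam * z.1 * z.2)))%:E.
have mF : measurable_fun setT F.
  apply/measurable_EFinP; apply: measurableT_comp => //; apply: measurableT_comp => //.
  apply: measurable_funM; last exact: measurable_snd.
  by apply: measurable_funM => //; exact: measurable_fst.
transitivity (\int[P]_w F (random_mean D w, G w))%E.
  by apply: eq_integral => w _; rewrite /F/=; congr (expR (- _))%:E; ring.
have ind' : indep P (random_mean D) G.
  by move=> A B mA mB; rewrite setIC ind// muleC.
rewrite (indep_integral mM mG ind' mF); last by move=> z; rewrite lee_fin expR_ge0.
apply: eq_integral => w _; rewrite /F/= (gamma_laplace (ltW theta_gt0) hG)//.
by rewrite (lt_le_trans (ltrN10 R))// mulr_ge0 ?random_mean_ge0// ltW.
Qed.

Lemma gamma_mean_lt0 : P ((G \* random_mean D) @^-1` `]-oo, 0[) = 0%E.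
Proof.
apply/eqP; rewrite eq_le measure_ge0 andbT -(gamma_lt0 hG) le_measure ?inE//.
- by apply: measurable_preimageT => //; exact: measurable_funM.
- exact: measurable_preimageT.
move=> w /=; rewrite !in_itv/=; apply: contraTT; rewrite -!leNgt => g0.
by rewrite mulr_ge0// random_mean_ge0.
Qed.

Lemma gamma_mean_GGC : GGC theta K (distribution P (G \* random_mean D)).
Proof.
have mGM : measurable_fun setT (G \* random_mean D) by exact: measurable_funM.
have lt0 := gamma_mean_lt0.
split.
  have mN : measurable ((G \* random_mean D) @^-1` `]-oo, 0[) by exact: measurable_preimageT.
  transitivity (P (~` ((G \* random_mean D) @^-1` `]-oo, 0[))).
    by rewrite preimage_setC setCitvl.
  by rewrite (probability_setC P mN) lt0 sube0.
move=> lam l0.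
have mpatch : measurable_fun setT ((fun x : R => (expR (- (lam * x)))%:E) \_ `[0%R, +oo[).
  have me : measurable_fun (`[0%R, +oo[%classic : set R) (fun x : R => (expR (- (lam * x)))%:E).
    apply/measurable_EFinP; apply: measurable_funTS.
    by apply: measurableT_comp => //; apply: measurableT_comp => //; exact: measurable_funM.
  exact: (measurable_restrictT _ (measurable_itv _)).1 me.
rewrite integral_mkcond.
transitivity (\int[P]_w (((fun x => (expR (- (lam * x)))%:E) \_ `[0%R, +oo[) (G w * random_mean D w)%R))%E.
  rewrite ge0_integral_distribution//.
  by move=> x; rewrite patchE; case: ifP => // _; rewrite lee_fin expR_ge0.
(* The logarithmic integral is finite, so [expeR] reduces to the real exponential. *)
have Lfin := integrable_fin_num measurableT (integrable_ln1D (ltW l0) lnK).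
rewrite integral_itv0y_max -(fineK Lfin).
transitivity (expR (- (theta * \int[K]_x ln (1 + lam * Num.max 0 x))))%:E; last by [].
rewrite -(gamma_mean_laplace l0).
apply: ae_eq_integral => //.
- exact: (measurableT_comp mpatch mGM).
- apply/measurable_EFinP.
  by apply: measurableT_comp => //; apply: measurableT_comp => //; exact: measurable_funM.
exists ((G \* random_mean D) @^-1` `]-oo, 0[); split => //; first exact: measurable_preimageT.
move=> w /=; apply: contra_notP; rewrite in_itv/= => /negP; rewrite -leNgt => h _.
by rewrite patchE mem_set//= in_itv/= andbT.
Qed.

End gamma_mean.

Lemma measurable_ln_dist {R : realType} d (T : measurableType d) (f g : T -> R) :
  measurable_fun setT f -> measurable_fun setT g ->
  measurable_fun setT (fun w => (ln `|f w - g w| * (g w != f w)%:R)%:E).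
Proof.
move=> mf mg; have mfg : measurable_fun setT (fun w => f w - g w) by exact: measurable_funB.
apply/measurable_EFinP; apply: measurable_funM.
  by apply: (measurableT_comp (@measurable_ln R)); exact: (measurableT_comp (@normr_measurable R setT)).
rewrite (_ : (fun w => _) = \1_((fun w => f w - g w) @^-1` ~` [set 0])).
  by apply: measurable_indic; apply: measurable_preimageT => //; exact: measurableC.
apply/funext => w; rewrite indicE eq_sym -subr_eq0; congr (nat_of_bool _)%:R.
by apply/idP/idP => [/eqP h|]; [rewrite inE|rewrite inE => /eqP].
Qed.

(** * The product with a Bernoulli variable and its potential *)

Section bernoulli_product.
Context {R : realType} d (T : measurableType d) (P : probability T R).
Variables (X Y : {RV P >-> R}) (H : probability R R) (p : R).
Hypotheses (hXH : has_law P X H) (p0 : 0 < p) (p1 : p <= 1).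
Hypotheses (hY : has_law P Y (bernoulli_law p)) (hXY : independent_RV P X Y).

Lemma has_law_thinning : has_law P (X \* Y) (thinning p H).
Proof.
move=> A mA.
have mX : measurable_fun setT X := measurable_funPT X.
have mY : measurable_fun setT Y := measurable_funPT Y.
rewrite -[LHS]/(P ((X \* Y) @^-1` A)).
have mA' : measurable ((X \* Y) @^-1` A) by exact: measurable_preimageT.
transitivity (\int[P]_w (\1_((X \* Y) @^-1` A) w)%:E)%E; first by rewrite integral_indic// setIT.
pose F (z : R * R) := (\1_A (z.1 * z.2))%:E : \bar R.
have mF : measurable_fun setT F.
  apply/measurable_EFinP; apply: (measurableT_comp (measurable_indic mA)).
  by apply: measurable_funM; [exact: measurable_fst|exact: measurable_snd].
have F0 z : (0 <= F z)%E by rewrite lee_fin.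
transitivity (\int[P]_w F (X w, Y w))%E; first by [].
rewrite (indep_integral mX mY hXY mF F0).
have p01 : 0 <= p <= 1 by rewrite (ltW p0).
have EY x : (\int[P]_w F (x, Y w) = p%:E * (\1_A x)%:E + (1 - p)%:E * (\1_A 0)%:E)%E.
  have mFx : measurable_fun setT (fun y => F (x, y)).
    by apply: (measurableT_comp mF); exact: pair1_measurable.
  rewrite (@law_ge0_integral _ _ _ _ _ _ _ P (bernoulli_prob p) Y (fun b : bool => b%:R : R) (fun y => F (x, y)))//.
  by rewrite integral_bernoulli_prob// /F/= mulr1 mulr0.
under eq_integral do rewrite EY.
have mAX : measurable_fun setT (fun w => (\1_A (X w) : R)%:E).
  by apply/measurable_EFinP; exact: (measurableT_comp (measurable_indic mA) mX).
have f1 w : (0 <= p%:E * (\1_A (X w) : R)%:E)%E by rewrite mule_ge0// lee_fin// ltW.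
have f2 : (0 <= (1 - p)%:E * (\1_A 0 : R)%:E)%E by rewrite mule_ge0// lee_fin// subr_ge0.
have mf1 : measurable_fun setT (fun w => p%:E * (\1_A (X w) : R)%:E)%E by exact: emeasurable_funM.
rewrite ge0_integralD//.
rewrite ge0_integralZl_EFin ?(ltW p0)//.
have -> : (\int[P]_w ((1 - p)%:E * (\1_A 0 : R)%:E) = (1 - p)%:E * (\1_A 0 : R)%:E)%E.
  by rewrite integral_cst//= probability_setT mule1.
rewrite thinningE//; congr (_ * _ + _ * _)%E.
rewrite -hXH// -[RHS]/(P (X @^-1` A)) -[X @^-1` A]setIT -integral_indic//.
exact: measurable_preimageT.
Qed.

Hypothesis hX : {ae P, forall w, 0 < X w}.
Hypothesis lnH : H.-integrable setT (EFin \o (fun x => ln (1 + Num.max 0 x))).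

Lemma law_ae_gt0 : {ae H, forall x, 0 < x}.
Proof.
exists `]-oo, 0]%classic; split => //.
  rewrite -hXH//; case: hX => N [mN N0 sub].
  apply/eqP; rewrite -[X in X == _]/(P (X @^-1` _)) eq_le measure_ge0 andbT -N0 le_measure ?inE//.
    by apply: measurable_preimageT => //; exact: measurable_funPT.
  by move=> w /=; rewrite in_itv/= => x0; apply: sub => /=; rewrite ltNge x0.
by move=> x /=; rewrite in_itv/= => /negP; rewrite -leNgt.
Qed.

Let phi (t x : R) := ln `|t - x| * (x != t)%:R.

Let mphi t : measurable_fun setT (fun x => (phi t x)%:E).
Proof. exact: (@measurable_ln_dist _ _ _ (cst t) id). Qed.

Lemma log_potentialE t : log_potential P X t = (\int[H]_x (phi t x)%:E)%E.
Proof.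
rewrite /log_potential unlock.
apply: (@integral_law _ _ _ _ _ _ _ P H X id (fun x => (phi t x)%:E)) => //.
Qed.

(** [|t - x| <= (1 + t) (1 + x)] for [x > 0] bounds the positive part by an integrable function; the
    negative part may have an infinite integral. *)
Lemma log_potential_pos_fin t : 0 <= t -> (\int[H]_x (fun x => (phi t x)%:E)^\+ x < +oo)%E.
Proof.
move=> t0.
have hc : H.-integrable setT (EFin \o cst (ln (1 + t))) by exact: finite_measure_integrable_cst.
have hi := integrableD measurableT hc lnH.
have /integrableP[_ hfin] := hi; apply: le_lt_trans hfin.
apply: ae_ge0_le_integral => //.
- exact: measurable_funepos.
- by apply: measurableT_comp => //; exact: measurable_int hi.
apply: filterS law_ae_gt0 => x x0 _.
rewrite funeposE /= [Num.max 0 x]max_r ?(ltW x0)// ger0_norm; last by rewrite addr_ge0// ln_ge0// lerDl// ltW.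
have l1 : 0 <= ln (1 + t) + ln (1 + x) by rewrite addr_ge0// ln_ge0// lerDl// ltW.
rewrite ge_max !lee_fin l1 andbT /phi.
have [xt|xt] := eqVneq x t; first by rewrite mulr0.
rewrite mulr1 -lnM ?posrE ?ltr_pwDl ?(ltW x0)// ler_ln ?posrE ?mulr_gt0 ?ltr_pwDl ?(ltW x0)//.
  rewrite ler_norml; apply/andP; split; nra.
by rewrite normr_gt0 subr_eq0 eq_sym.
Qed.

Lemma log_potential_thinning t : 0 <= t ->
  log_potential P (X \* Y) t =
  (p%:E * log_potential P X t + ((1 - p) * ln t * (t != 0)%:R)%:E)%E.
Proof.
move=> t0; rewrite log_potentialE.
transitivity (\int[thinning p H]_x (phi t x)%:E)%E.
  rewrite /log_potential unlock.
  apply: (@integral_law _ _ _ _ _ _ _ P (thinning p H) (X \* Y) id (fun x => (phi t x)%:E)) => //.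
  by move=> A mA; exact: has_law_thinning.
rewrite integral_thinning ?log_potential_pos_fin//; congr (_ + _)%E.
by rewrite -EFinM /phi subr0 ger0_norm// [0 == t]eq_sym mulrA.
Qed.

End bernoulli_product.

Section gamma_mean_law.
Context {R : realType}.
Variables (s t : R) (K H : probability R R).
Hypotheses (s_gt0 : 0 < s) (t_gt0 : 0 < t).
Hypothesis lnK : K.-integrable setT (EFin \o (fun x => ln (1 + Num.max 0 x))).
Hypothesis lnH : H.-integrable setT (EFin \o (fun x => ln (1 + Num.max 0 x))).
Hypothesis KH : forall u, 0 < u ->
  s * \int[K]_x ln (1 + u * Num.max 0 x) = t * \int[H]_x ln (1 + u * Num.max 0 x).

Lemma gamma_mean_eq_lawP : gamma_mean_eq_law s K t H.
Proof.
move=> d1 T1 P1 D1 G1 d2 T2 P2 D2 G2 hD1 hG1 ind1 hD2 hG2 ind2.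
suff h A : measurable A -> P1 ((G1 \* random_mean D1) @^-1` A) = P2 ((G2 \* random_mean D2) @^-1` A).
  by exact: h.
apply: laplace_unique => //.
- exact: gamma_mean_lt0 hG1.
- exact: gamma_mean_lt0 hG2.
(* The transforms are known for positive arguments; at 0 both are total masses. *)
move=> [|k].
  have E d (T : measurableType d) (P : probability T R) (Z : T -> R) :
      (\int[P]_w (expR (- (0%:R * Z w)))%:E = 1)%E.
    under eq_integral do rewrite mul0r oppr0 expR0.
    by rewrite integral_cst//= probability_setT mul1e.
  by rewrite !E.
have k0 : 0 < k.+1%:R :> R by [].
by rewrite (gamma_mean_laplace s_gt0 hD1 hG1 ind1 lnK k0)
  (gamma_mean_laplace t_gt0 hD2 hG2 ind2 lnH k0) KH.
Qed.

End gamma_mean_law.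

(** * Jensen's inequality and the Poisson kernel of the mean *)

Section jensen.
Context {R : realType} d (T : measurableType d) (P : probability T R).

(** The tangent of the exponential at the mean [m] gives [e^f >= e^m (1 + f - m)], whose right side
    integrates to [e^m]. The claim is stated in extended reals because [e^f] may fail to be
    integrable. *)
Lemma expR_Rintegral_le (f : T -> R) : P.-integrable setT (EFin \o f) ->
  ((expR (\int[P]_w f w))%:E <= \int[P]_w (expR (f w))%:E)%E.
Proof.
move=> fi; have mf : measurable_fun setT f by apply/measurable_EFinP; exact: measurable_int fi.
have mef : measurable_fun setT (fun w => (expR (f w))%:E).
  by apply/measurable_EFinP; exact: measurableT_comp.
have [fin|] := boolP (\int[P]_w (expR (f w))%:E < +oo)%E; last first.
  by rewrite -leNgt => h; rewrite (le_trans _ h)// leey.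
have ei : P.-integrable setT (EFin \o (fun w => expR (f w))).
  apply/integrableP; split => //; apply: le_lt_trans fin.
  rewrite le_eqVlt; apply/orP; left; apply/eqP.
  by apply: eq_integral => w _; rewrite /= ger0_norm// expR_ge0.
pose m := \int[P]_w f w.
have i1 : P.-integrable setT (EFin \o cst (expR m * (1 - m))) by exact: finite_measure_integrable_cst.
have i2 := integrableZl measurableT (expR m) fi.
have : \int[P]_w (expR m * (1 - m) + expR m * f w) <= \int[P]_w expR (f w).
  apply: (le_Rintegral measurableT (integrableD measurableT i1 i2) ei) => w _.
  have := expR_ge1Dx (f w - m); rewrite -(ler_pM2l (expR_gt0 m)) -expRD => h.
  by rewrite [m + _]addrC subrK in h; apply: le_trans h; rewrite /cst -mulrDr addrA addrAC.
rewrite (RintegralD measurableT i1 i2) (RintegralZl _ measurableT fi) Rintegral_cst//= probability_setT mulr1.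
rewrite -/m => h; rewrite -[leRHS]fineK; last exact: integrable_fin_num ei.
rewrite lee_fin; apply: le_trans h; rewrite le_eqVlt; apply/orP; left; apply/eqP; ring.
Qed.

End jensen.

Section poisson_mean.
Context {R : realType}.
Import HBNNSimple.
Context d (T : measurableType d) (P : probability T R).
Variables (K : probability R R) (D : R.-pker T ~> R).
Hypotheses (hD : dirichlet_process P 1 K D).
Hypothesis lnK : K.-integrable setT (EFin \o (fun x => ln (1 + Num.max 0 x))).

Local Notation M := (random_mean D).

Lemma norm_atan_le (x : R) : `|atan x| <= pi / 2.
Proof.
by rewrite ler_norml; apply/andP; split; apply: ltW; [exact: atan_gtNpi2|exact: atan_ltpi2].
Qed.

(** [1 + |t (y - x)|] is at most [(1 + |t|) (1 + |x|) (1 + m)], and squaring gives the factor 2.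
    With [m] the limit of the increasing approximations, one bound dominates them all. *)
Lemma ln1Dsqr_le (t x y m : R) : 0 <= y <= m ->
  0 <= ln (1 + (t * (y - x)) ^+ 2) <= 2 * (ln ((1 + `|t|) * (1 + `|x|)) + ln (1 + m)).
Proof.
move=> /andP[y0 ym]; rewrite ln_ge0 ?lerDl ?sqr_ge0//=.
have m0 : 0 <= m by exact: le_trans ym.
have m1 : 0 < 1 + m by rewrite ltr_pwDl.
rewrite -lnM ?posrE ?mulr_gt0// mulr_natl -lnXn ?mulr_gt0//.
rewrite ler_ln ?posrE ?exprn_gt0 ?mulr_gt0//; last by rewrite ltr_pwDl// sqr_ge0.
have h : `|t * (y - x)| <= `|t| * (m + `|x|).
  rewrite normrM ler_wpM2l// (le_trans (ler_normB _ _))// lerD2r ger0_norm//.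
rewrite -real_normK ?num_real//.
have n0 := normr_ge0 (t * (y - x)).
have h1 : 1 + `|t * (y - x)| <= (1 + `|t|) * (1 + `|x|) * (1 + m).
  apply: le_trans (_ : 1 + `|t| * (m + `|x|) <= _); first by rewrite lerD2l.
  have := normr_ge0 t; have := normr_ge0 x; move: (`|t|) (`|x|) => u v v0 u0.
  have := mulr_ge0 u0 v0; have := mulr_ge0 u0 m0; have := mulr_ge0 v0 m0.
  have := mulr_ge0 (mulr_ge0 u0 v0) m0; nra.
apply: le_trans (_ : (1 + `|t * (y - x)|) ^+ 2 <= _); first by rewrite sqrrD; nra.
by rewrite lerXn2r ?nnegrE ?addr_ge0// (le_trans _ h1)// addr_ge0.
Qed.

Lemma mean_poisson t x :
  \int[P]_w (1 + (t * (M w - x)) ^+ 2)^-1 =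
  expR (- (2^-1 * \int[K]_y ln (1 + (t * (Num.max 0 y - x)) ^+ 2))) *
    cos (\int[K]_y atan (t * (Num.max 0 y - x))).
Proof.
have mlin : measurable_fun setT (fun y : R => t * (y - x)).
  by apply: measurable_funM => //; exact: measurable_funB.
have msqr : measurable_fun setT (fun y : R => 1 + (t * (y - x)) ^+ 2).
  by apply: measurable_funD => //; exact: measurable_funX.
have mmax : measurable_fun setT (fun y : R => Num.max 0 y) by exact: measurable_maxr.
have minv : measurable_fun setT (fun y : R => (1 + (t * (y - x)) ^+ 2)^-1).
  exact: (measurableT_comp (@measurable_inv R) msqr).
have s0 y : 0 < 1 + (t * (y - x)) ^+ 2 by rewrite ltr_pwDl// sqr_ge0.
have clin y : {for y, continuous (fun y : R => t * (y - x))}.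
  by apply: cvgM; [exact: cvg_cst|apply: cvgB; [exact: cvg_id|exact: cvg_cst]].
have csqr y : {for y, continuous (fun y : R => 1 + (t * (y - x)) ^+ 2)}.
  by apply: cvgD; [exact: cvg_cst|apply: cvgM; exact: clin].
have c1 : \int[P]_w (1 + (t * (approx_mean D n w - x)) ^+ 2)^-1 @[n --> \oo] -->
    \int[P]_w (1 + (t * (M w - x)) ^+ 2)^-1.
  apply: (@dominated_cvg_Rintegral _ _ _ P (fun n w => (1 + (t * (approx_mean D n w - x)) ^+ 2)^-1)
    (fun w => (1 + (t * (M w - x)) ^+ 2)^-1) (cst 1)).
  - by move=> n; exact: (measurableT_comp minv (measurable_approx_mean D n)).
  - exact: (measurableT_comp minv (measurable_random_mean D)).
  - exact: finite_measure_integrable_cst.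
  - apply: filterS (approx_mean_ae_cvg ltr01 hD lnK) => w h.
    apply: cvgV; first by rewrite gt_eqF.
    exact: (cvg_comp _ _ h (csqr _)).
  - apply: aeW => w n; rewrite ger0_norm ?invr_ge0 ?(ltW (s0 _))// invf_le1//.
    by rewrite lerDl sqr_ge0.
have c2 : \int[K]_y ln (1 + (t * (pos_approx n y - x)) ^+ 2) @[n --> \oo] -->
    \int[K]_y ln (1 + (t * (Num.max 0 y - x)) ^+ 2).
  pose C := ln ((1 + `|t|) * (1 + `|x|)).
  apply: (@dominated_cvg_Rintegral _ _ _ K (fun n y => ln (1 + (t * (pos_approx n y - x)) ^+ 2))
    (fun y => ln (1 + (t * (Num.max 0 y - x)) ^+ 2)) (fun y => 2 * (C + ln (1 + Num.max 0 y)))).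
  - by move=> n; apply: (measurableT_comp (@measurable_ln R)); exact: (measurableT_comp msqr).
  - by apply: (measurableT_comp (@measurable_ln R)); exact: (measurableT_comp msqr).
  - have hc : K.-integrable setT (EFin \o cst C) by exact: finite_measure_integrable_cst.
    exact: (integrableZl measurableT 2 (integrableD measurableT hc lnK)).
  - apply: aeW => y.
    have h1 := cvg_comp _ _ (@pos_approx_cvg _ y) (csqr (Num.max 0 y)).
    exact: (cvg_comp _ _ h1 (continuous_ln (s0 _))).
  - apply: aeW => y n; have /andP[h0 h1] : 0 <= ln (1 + (t * (pos_approx n y - x)) ^+ 2) <= 2 * (C + ln (1 + Num.max 0 y)).
      by apply: ln1Dsqr_le; rewrite pos_approx_ge0 pos_approx_le.
    by rewrite ger0_norm.
have c3 : \int[K]_y atan (t * (pos_approx n y - x)) @[n --> \oo] -->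
    \int[K]_y atan (t * (Num.max 0 y - x)).
  apply: (@dominated_cvg_Rintegral _ _ _ K (fun n y => atan (t * (pos_approx n y - x)))
    (fun y => atan (t * (Num.max 0 y - x))) (cst (pi / 2))).
  - by move=> n; apply: (measurableT_comp (@measurable_atan R)); exact: (measurableT_comp mlin).
  - by apply: (measurableT_comp (@measurable_atan R)); exact: (measurableT_comp mlin).
  - exact: finite_measure_integrable_cst.
  - apply: aeW => y.
    have h1 := cvg_comp _ _ (@pos_approx_cvg _ y) (clin (Num.max 0 y)).
    by apply: continuous_cvg; [exact: continuous_atan|exact: h1].
  - by apply: aeW => y n; exact: norm_atan_le.
have c4 : expR (- (2^-1 * \int[K]_y ln (1 + (t * (pos_approx n y - x)) ^+ 2))) *
    cos (\int[K]_y atan (t * (pos_approx n y - x))) @[n --> \oo] -->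
  expR (- (2^-1 * \int[K]_y ln (1 + (t * (Num.max 0 y - x)) ^+ 2))) *
    cos (\int[K]_y atan (t * (Num.max 0 y - x))).
  apply: cvgM; last by apply: continuous_cvg; [exact: continuous_cos|exact: c3].
  apply: continuous_cvg; first exact: continuous_expR.
  by apply: cvgN; apply: cvgM => //; exact: cvg_cst.
apply: (cvg_unique _ c1); first exact: Rhausdorff.
rewrite (_ : (fun n => _) = (fun n => expR (- (2^-1 * \int[K]_y ln (1 + (t * (pos_approx n y - x)) ^+ 2))) *
    cos (\int[K]_y atan (t * (pos_approx n y - x)))))//.
by apply/funext => n; exact: (simple_mean_poisson ltr01 hD _ _ _ erefl).
Qed.

End poisson_mean.

(** * Uniform local bounds for the regularized Riesz kernel *)

Section riesz_kernel.
Context {R : realType} (p : R).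
Hypothesis p01 : 0 < p < 1.
Local Notation leb := (@lebesgue_measure R).

(** This is [(c + u^2)^(- p / 2)], a smooth regularization of the Riesz kernel [|u|^(- p)]. *)
Definition riesz (c u : R) := expR (- (p / 2 * ln (c + u ^+ 2))).

Let E c (u : R) := - (p / 2) * ln (c + u * u) + - ((1 - p) / 2) * ln (1 + u * u).

Let E' c (u : R) := - (p / 2) * ((c + u * u)^-1 * (u * 1 + u * 1)) +
  - ((1 - p) / 2) * ((1 + u * u)^-1 * (u * 1 + u * 1)).

(* [F c u = u (c + u^2)^(- p/2) (1 + u^2)^(- (1 - p)/2)] is nondecreasing and
   bounded by 1, and its derivative dominates [riesz c] up to a constant on
   [-1, 1]: integrals of [riesz c] are bounded uniformly in [c]. *)
Let F c u := u * expR (E c u).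

Let F' c u := u * (expR (E c u) * E' c u) + expR (E c u) * 1.

Let is_derive_expE c (u : R) : 0 < c -> is_derive u (1 : R) (fun z => expR (E c z)) (expR (E c u) * E' c u).
Proof.
move=> c0.
have q (e : R) : 0 < e -> 0 < e + u * u by move=> e0; rewrite ltr_pwDl// -expr2 sqr_ge0.
have dsq : is_derive u (1 : R) (fun z => z * z) (u * 1 + u * 1).
  exact: is_derive_mul (is_derive_id _ _) (is_derive_id _ _).
have dq (e : R) : is_derive u (1 : R) (fun z => e + z * z) (u * 1 + u * 1).
  by have := is_derive_add (is_derive_cst e u 1) dsq; rewrite add0r.
have dln (e : R) : 0 < e -> is_derive u (1 : R) (fun z => ln (e + z * z)) ((e + u * u)^-1 * (u * 1 + u * 1)).
  by move=> e0; exact: (@is_derive_comp1 _ (@ln R) (fun z => e + z * z) u _ _ (is_derive1_ln (q e e0)) (dq e)).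
have dcl (a e : R) : 0 < e -> is_derive u (1 : R) (fun z => a * ln (e + z * z)) (a * ((e + u * u)^-1 * (u * 1 + u * 1))).
  move=> e0; have := is_derive_mul (is_derive_cst a u 1) (dln e e0).
  by move=> h; apply: is_derive_eq h _; rewrite mulr0 addr0.
have dE : is_derive u (1 : R) (E c) (E' c u).
  exact: is_derive_add (dcl _ _ c0) (dcl _ _ ltr01).
exact: (@is_derive_comp1 _ expR (E c) u _ _ (is_derive_expR _) dE).
Qed.

Let is_derive_F c (u : R) : 0 < c -> is_derive u (1 : R) (F c) (F' c u).
Proof. by move=> c0; exact: is_derive_mul (is_derive_id _ _) (is_derive_expE u c0). Qed.

Let riesz_E c u : expR (E c u) = riesz c u * expR (- ((1 - p) / 2 * ln (1 + u ^+ 2))).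
Proof. by rewrite /riesz -expRD /E -!expr2 -!mulNr. Qed.

Let F'E c u : 0 < c -> F' c u = expR (E c u) *
  (1 - p * (u ^+ 2 / (c + u ^+ 2)) - (1 - p) * (u ^+ 2 / (1 + u ^+ 2))).
Proof.
move=> c0; have q1 : c + u ^+ 2 != 0 by rewrite gt_eqF// ltr_pwDl// sqr_ge0.
have q2 : 1 + u ^+ 2 != 0 by rewrite gt_eqF// ltr_pwDl// sqr_ge0.
by rewrite /F' /E' -!expr2; field; rewrite q1 q2.
Qed.

Let cont_F' c (u : R) : 0 < c -> {for u, continuous (F' c)}.
Proof.
move=> c0; rewrite (_ : F' c = fun u => expR (E c u) *
  (1 - p * (u ^+ 2 / (c + u ^+ 2)) - (1 - p) * (u ^+ 2 / (1 + u ^+ 2)))); last first.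
  by apply/funext => x; exact: F'E.
have csq : {for u, continuous (fun z : R => z ^+ 2)} by apply: cvgM; exact: cvg_id.
have cfrac (e : R) : 0 < e -> {for u, continuous (fun z : R => z ^+ 2 / (e + z ^+ 2))}.
  move=> e0; apply: cvgM => //; apply: cvgV; first by rewrite gt_eqF// ltr_pwDl// sqr_ge0.
  by apply: cvgD => //; exact: cvg_cst.
have cE : {for u, continuous (fun z => expR (E c z))}.
  apply: differentiable_continuous; apply/derivable1_diffP.
  exact: (@ex_derive _ _ _ _ _ _ _ (is_derive_expE u c0)).
apply: cvgM; first exact: cE.
apply: cvgB; first apply: cvgB; first exact: cvg_cst.
  by apply: cvgM; [exact: cvg_cst|exact: cfrac].
by apply: cvgM; [exact: cvg_cst|exact: cfrac].
Qed.

Let frac_lt c (u : R) : 0 < c -> 0 <= u ^+ 2 / (c + u ^+ 2) <= 1.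
Proof.
move=> c0; have q : 0 < c + u ^+ 2 by rewrite ltr_pwDl// sqr_ge0.
by rewrite divr_ge0 ?sqr_ge0 ?(ltW q)//= ler_pdivrMr// mul1r lerDr ltW.
Qed.

Let F'_ge0 c u : 0 < c -> 0 <= F' c u.
Proof.
move=> c0; have /andP[p0 p1] := p01.
rewrite F'E// mulr_ge0 ?expR_ge0//.
have /andP[a0 a1] := frac_lt u c0; have /andP[b0 b1] := frac_lt u ltr01.
by nra.
Qed.

(** For [|u| <= 1] the last fraction in [F'E] is at most [1/2], so the bracket there is at least
    [(1 - p) / 2]; the remaining factor [(1 + u^2)^(-(1 - p)/2)] is at least [1/2]. *)
Let F'_ge c u : 0 < c -> `|u| <= 1 -> (1 - p) / 4 * riesz c u <= F' c u.
Proof.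
move=> c0 u1; have /andP[p0 p1] := p01.
have u2 : u ^+ 2 <= 1 by rewrite -real_normK ?num_real// expr_le1.
rewrite F'E// riesz_E -[leRHS]mulrA [leLHS]mulrC ler_wpM2l ?expR_ge0//.
have /andP[a0 a1] := frac_lt u c0.
have b : u ^+ 2 / (1 + u ^+ 2) <= 2^-1.
  rewrite ler_pdivrMr; last by rewrite ltr_pwDl// sqr_ge0.
  by have := sqr_ge0 u; lra.
have e2 : 2^-1 <= expR (- ((1 - p) / 2 * ln (1 + u ^+ 2))).
  rewrite -[leLHS]lnK ?posrE ?invr_gt0// lnV ?posrE// ler_expR lerN2 -[leRHS]mul1r ler_pM//.
  - by lra.
  - by rewrite ln_ge0// lerDl sqr_ge0.
  - by lra.
  - by rewrite ler_ln ?posrE ?ltr_pwDl ?sqr_ge0//; lra.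
apply: le_trans (_ : 2^-1 * ((1 - p) / 2) <= _); first by lra.
by apply: ler_pM => //; nra.
Qed.

(** The weights [p / 2] and [(1 - p) / 2] add up to [1/2] and both logarithms are at least
    [2 ln |u|], so the exponential is at most [1 / |u|]. *)
Let F_le1 c u : 0 < c -> `|F c u| <= 1.
Proof.
move=> c0; have /andP[p0 p1] := p01.
have [->|u0] := eqVneq u 0; first by rewrite /F mul0r normr0.
have nu : 0 < `|u| by rewrite normr_gt0.
have u2 : 0 < u ^+ 2 by rewrite exprn_even_gt0.
rewrite /F normrM (ger0_norm (expR_ge0 _)) -[X in X * _]lnK ?posrE// -expRD -expR0 ler_expR.
have lnu : ln (u ^+ 2) = 2 * ln `|u|.
  by rewrite -real_normK ?num_real// lnXn// mulr_natl.
have h (e : R) : 0 < e -> ln (u ^+ 2) <= ln (e + u ^+ 2).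
  move=> e0; rewrite ler_ln ?posrE ?lerDr ?(ltW e0)//.
  by rewrite ltr_pwDl// sqr_ge0.
have h1 := h c c0; have h2 := h 1 ltr01; rewrite /E -!expr2.
rewrite lnu in h1 h2; nra.
Qed.

Lemma riesz_ge0 c u : 0 <= riesz c u. Proof. exact: expR_ge0. Qed.

Lemma riesz_nincr c c' u : 0 < c -> c <= c' -> riesz c' u <= riesz c u.
Proof.
move=> c0 cc'; have /andP[p0 p1] := p01; have c'0 := lt_le_trans c0 cc'.
rewrite ler_expR lerN2 ler_wpM2l//; first by rewrite divr_ge0// ltW.
by rewrite ler_ln ?posrE ?ltr_pwDl ?sqr_ge0// lerD2r.
Qed.

Lemma measurable_riesz c : measurable_fun setT (riesz c).
Proof.
apply: measurableT_comp => //; apply: measurableT_comp => //; apply: measurable_funM => //.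
apply: (measurableT_comp (@measurable_ln R)); by apply: measurable_funD.
Qed.

Let riesz_le c u : 0 < c -> riesz c u <= 1 + 4 / (1 - p) * F' c u.
Proof.
move=> c0; have /andP[p0 p1] := p01; have q0 : 0 < 1 - p by rewrite subr_gt0.
have [u1|u1] := leP `|u| 1.
  have := F'_ge c0 u1; rewrite mulrC -ler_pdivlMr ?divr_gt0// => h.
  apply: le_trans h _; rewrite invf_div mulrC lerDr//.
have u2 : 1 <= u ^+ 2 by rewrite -real_normK ?num_real// expr_ge1// ltW.
apply: le_trans (_ : 1 <= _); last by rewrite lerDl mulr_ge0 ?F'_ge0// divr_ge0// ltW.
rewrite -expR0 ler_expR lerNl oppr0 mulr_ge0//; first by rewrite divr_ge0// ltW.
by rewrite ln_ge0//; lra.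
Qed.

(** By [riesz_le] the integral is at most the length plus [4 / (1 - p)] times an increment of [F],
    which is at most 2. The bound depends on neither [c] nor [y]. *)
Lemma integral_riesz_le c y a b : 0 < c -> a < b ->
  (\int[leb]_(x in `[a, b]) (riesz c (y - x))%:E <= (b - a + 8 / (1 - p))%:E)%E.
Proof.
move=> c0 ab; have /andP[p0 p1] := p01; have q0 : 0 < 1 - p by rewrite subr_gt0.
pose f x := 1 + 4 / (1 - p) * F' c (x - y).
pose G x := x + 4 / (1 - p) * F c (x - y).
have dsh (x : R) : is_derive x (1 : R) (fun z => z - y) 1.
  by have := is_derive_sub (is_derive_id x 1) (is_derive_cst y x 1); rewrite subr0.
have dG (x : R) : is_derive x (1 : R) G (f x).
  have h1 := @is_derive_comp1 _ (F c) (fun z => z - y) x _ _ (is_derive_F (x - y) c0) (dsh x).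
  have h2 := is_derive_mul (is_derive_cst (4 / (1 - p)) x 1) h1.
  apply: is_derive_eq (is_derive_add (is_derive_id x 1) h2) _.
  by rewrite mulr0 addr0 mulr1.
have cG (x : R) : {for x, continuous G}.
  apply: differentiable_continuous; apply/derivable1_diffP.
  exact: (@ex_derive _ _ _ _ _ _ _ (dG x)).
have cf (x : R) : {for x, continuous f}.
  apply: cvgD; first exact: cvg_cst.
  apply: cvgM; first exact: cvg_cst.
  have sh : {for x, continuous (fun z => z - y)}.
    by apply: cvgB; [exact: cvg_id|exact: cvg_cst].
  by apply: (@continuous_comp _ _ _ (fun z : R => z - y) (F' c)) => //; exact: cont_F'.
have le : (\int[leb]_(x in `[a, b]) (riesz c (y - x))%:E <= \int[leb]_(x in `[a, b]) (f x)%:E)%E.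
  apply: ge0_le_integral => //.
  - by move=> x _; rewrite lee_fin riesz_ge0.
  - apply/measurable_EFinP; apply: measurable_funTS; apply: (measurableT_comp (measurable_riesz c)).
    exact: measurable_funB.
  - by apply/measurable_EFinP; apply: measurable_funTS; exact: continuous_measurable_fun.
  - move=> x _; rewrite lee_fin /f (_ : riesz c (y - x) = riesz c (x - y)); first exact: riesz_le.
    by rewrite /riesz -sqrrN opprB.
apply: le_trans le _.
rewrite (@continuous_FTC2 R f G a b ab); first last.
- by move=> x _; rewrite derive1E; exact: (@derive_val _ _ _ _ _ _ _ (dG x)).
- split.
  + by move=> x _; exact: (@ex_derive _ _ _ _ _ _ _ (dG x)).
  + by apply: cvg_at_right_filter; exact: cG.
  + by apply: cvg_at_left_filter; exact: cG.
- by apply: continuous_subspaceT; exact: cf.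
rewrite -EFinB lee_fin /G.
have := F_le1 (b - y) c0; have := F_le1 (a - y) c0.
rewrite !ler_norml => /andP[h1 h2] /andP[h3 h4].
have k0 : 0 < 4 / (1 - p) by rewrite divr_gt0.
have -> : 8 / (1 - p) = 2 * (4 / (1 - p)) by ring.
nra.
Qed.

End riesz_kernel.

(** * The mean under the thinned law has no atoms *)

Section thinned_mean.
Context {R : realType} (p : R) (H : probability R R).
Hypotheses (p01 : 0 < p < 1) (H_gt0 : {ae H, forall y, 0 < y}).
Hypothesis lnH : H.-integrable setT (EFin \o (fun x => ln (1 + Num.max 0 x))).
Context d (T : measurableType d) (P : probability T R) (D : R.-pker T ~> R).
Hypothesis hD : dirichlet_process P 1 (thinning p H) D.
Local Notation M := (random_mean D).
Local Notation leb := (@lebesgue_measure R).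

Let p0 : 0 < p. Proof. by case/andP: p01. Qed.

Let p1 : p < 1. Proof. by case/andP: p01. Qed.

Let mmax : measurable_fun setT (fun y : R => Num.max 0 y).
Proof. exact: measurable_maxr. Qed.

Let mlin (t x : R) : measurable_fun setT (fun y : R => t * (Num.max 0 y - x)).
Proof. by apply: measurable_funM => //; exact: measurable_funB. Qed.

Let mln (t x : R) : measurable_fun setT (fun y : R => ln (1 + (t * (Num.max 0 y - x)) ^+ 2)).
Proof.
apply: (measurableT_comp (@measurable_ln R)); apply: measurable_funD => //.
exact: measurable_funX.
Qed.

Lemma integrable_ln1Dsqr (t x : R) :
  H.-integrable setT (EFin \o (fun y => ln (1 + (t * (Num.max 0 y - x)) ^+ 2))).
Proof.
pose C := ln ((1 + `|t|) * (1 + `|x|)).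
have hc : H.-integrable setT (EFin \o cst C) by exact: finite_measure_integrable_cst.
apply: (le_integrable measurableT _ _ (integrableZl measurableT 2 (integrableD measurableT hc lnH))).
  exact/measurable_EFinP.
move=> y _; have /andP[h0 h1] : 0 <= ln (1 + (t * (Num.max 0 y - x)) ^+ 2) <= 2 * (C + ln (1 + Num.max 0 y)).
  by apply: ln1Dsqr_le; rewrite le_max !lexx.
rewrite /= lee_fin (ger0_norm h0); apply: le_trans h1 _.
exact: ler_norm.
Qed.

Lemma integrable_atan (t x : R) :
  H.-integrable setT (EFin \o (fun y => atan (t * (Num.max 0 y - x)))).
Proof.
apply: (@bounded_integrable _ _ _ _ _ (pi / 2)).
  exact: (measurableT_comp (@measurable_atan R)).
by move=> y; exact: norm_atan_le.
Qed.

Lemma mean_poisson_thinning (t x : R) :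
  \int[P]_w (1 + (t * (M w - x)) ^+ 2)^-1 =
  expR (- (2^-1 * (p * \int[H]_y ln (1 + (t * (Num.max 0 y - x)) ^+ 2) +
                   (1 - p) * ln (1 + (t * x) ^+ 2)))) *
  cos (p * \int[H]_y atan (t * (Num.max 0 y - x)) - (1 - p) * atan (t * x)).
Proof.
have lnK := integrable_thinning p0 (ltW p1) lnH.
rewrite (mean_poisson hD lnK).
rewrite (Rintegral_thinning p0 (ltW p1) (integrable_ln1Dsqr t x)).
rewrite (Rintegral_thinning p0 (ltW p1) (integrable_atan t x)).
rewrite maxxx sub0r mulrN sqrrN; congr (_ * cos _).
by rewrite atanN mulrN.
Qed.

Let pos1 (u : R) : 0 < 1 + u ^+ 2. Proof. by rewrite ltr_pwDl// sqr_ge0. Qed.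

Let mM : measurable_fun setT M := measurable_random_mean D.

Let minv (t x : R) : measurable_fun setT (fun w => (1 + (t * (M w - x)) ^+ 2)^-1).
Proof.
apply: (measurableT_comp (@measurable_inv R)); apply: measurable_funD => //.
by apply: measurable_funX; apply: measurable_funM => //; exact: measurable_funB.
Qed.

Let iinv (t x : R) : P.-integrable setT (EFin \o (fun w => (1 + (t * (M w - x)) ^+ 2)^-1)).
Proof.
apply: (@bounded_integrable _ _ _ _ _ 1) => // w.
by rewrite ger0_norm ?invr_ge0 ?(ltW (pos1 _))// invf_le1// lerDl sqr_ge0.
Qed.

(** The indicator of the atom lies below the kernel for every [t], and the cosine in
    [mean_poisson_thinning] is at most 1. *)
Let atom_le (t x : R) : (P (M @^-1` [set x]) <=
  (expR (- (2^-1 * (p * \int[H]_y ln (1 + (t * (Num.max 0 y - x)) ^+ 2) +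
                   (1 - p) * ln (1 + (t * x) ^+ 2)))))%:E)%E.
Proof.
apply: (@le_trans _ _ (\int[P]_w ((1 + (t * (M w - x)) ^+ 2)^-1)%:E)%E).
  have -> : P (M @^-1` [set x]) = (\int[P]_w (\1_(M @^-1` [set x]) w)%:E)%E.
    by rewrite integral_indic// setIT.
  apply: ge0_le_integral => //.
  - exact/measurable_EFinP.
  - exact/measurable_EFinP.
  - move=> w _; rewrite lee_fin indicE; have [|_] := boolP (w \in _); last first.
      by rewrite invr_ge0 ltW.
    by rewrite inE /= => ->; rewrite subrr mulr0 expr0n addr0 invr1.
rewrite -[X in (X <= _)%E]fineK; last exact: integrable_fin_num (iinv t x).
rewrite lee_fin -[leLHS]/(\int[P]_w _) mean_poisson_thinning.
by rewrite ler_piMr ?expR_ge0// (le_trans (ler_norm _))// cos_max.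
Qed.

Lemma cvg_sqr_natr_mul (v : R) : v != 0 -> (n.+1%:R * v) ^+ 2 @[n --> \oo] --> +oo.
Proof.
move=> v0; have v2 : 0 < v ^+ 2 by rewrite exprn_even_gt0.
apply/cvgryPge => A; near=> n.
have h : A / v ^+ 2 <= n%:R by near: n; exact: nbhs_infty_ger.
move: h; rewrite ler_pdivrMr// => h; apply: le_trans h _.
rewrite exprMn ler_wpM2r ?(ltW v2)// expr2 -natrM ler_nat.
by rewrite (leq_trans (leqnSn n))// leq_pmulr.
Unshelve. all: end_near.
Qed.

Lemma cvg_expRN_ln1Dsqr (q v : R) : 0 < q -> v != 0 ->
  expR (- (q * ln (1 + (n.+1%:R * v) ^+ 2))) @[n --> \oo] --> 0.
Proof.
move=> q0 v0.
have h1 := cvg_comp _ _ (cvg_sqr_natr_mul v0) (@cvg_ln1Dy R).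
have h2 : q * x @[x --> +oo] --> +oo by apply: gt0_cvgMry => //; exact: cvg_id.
have h3 := cvg_comp _ _ h1 h2.
exact: (cvg_comp _ _ h3 (@cvgr_expR R)).
Qed.

(** [atom_le] is used along [t = n + 1]. For [x] nonzero the atom of the thinned law at 0 alone
    makes the bound tend to 0. For [x = 0] that atom contributes nothing; the decay then comes from
    [H], which charges positive reals only, through Jensen's inequality and dominated
    convergence. *)
Lemma random_mean_no_atom x : 0 <= x -> P (M @^-1` [set x]) = 0%E.
Proof.
move=> x0; have qfin : P (M @^-1` [set x]) \is a fin_num by rewrite fin_num_measure.
suff [e e0 he] : exists2 e : nat -> R, e n @[n --> \oo] --> 0 & forall n, (P (M @^-1` [set x]) <= (e n)%:E)%E.
  rewrite -(fineK qfin); congr EFin; apply/eqP; rewrite eq_le fine_ge0// andbT.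
  apply: (cvgr_to_ge e0); apply: nearW => n.
  by rewrite -lee_fin fineK.
have I0 t : 0 <= \int[H]_y ln (1 + (t * (Num.max 0 y - x)) ^+ 2).
  by apply: Rintegral_ge0 => y _; rewrite ln_ge0// lerDl sqr_ge0.
have [xE|xn0] := eqVneq x 0; last first.
  exists (fun n => expR (- ((1 - p) / 2 * ln (1 + (n.+1%:R * x) ^+ 2)))).
    by apply: cvg_expRN_ln1Dsqr => //; rewrite divr_gt0// subr_gt0.
  move=> n; apply: le_trans (atom_le n.+1%:R x) _.
  rewrite lee_fin ler_expR lerN2.
  have := mulr_ge0 (ltW p0) (I0 n.+1%:R); lra.
have mr n : measurable_fun setT (fun y : R => expR (- (p / 2 * ln (1 + (n.+1%:R * Num.max 0 y) ^+ 2)))).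
  apply: measurableT_comp => //; apply: measurableT_comp => //; apply: measurable_funM => //.
  apply: (measurableT_comp (@measurable_ln R)); apply: measurable_funD => //.
  by apply: measurable_funX; exact: measurable_funM.
have bd n y : `|expR (- (p / 2 * ln (1 + (n.+1%:R * Num.max 0 y) ^+ 2)))| <= 1.
  rewrite ger0_norm ?expR_ge0// -[leRHS]expR0 ler_expR lerNl oppr0 mulr_ge0 ?divr_ge0 ?(ltW p0)//.
  by rewrite ln_ge0// lerDl sqr_ge0.
exists (fun n => \int[H]_y expR (- (p / 2 * ln (1 + (n.+1%:R * Num.max 0 y) ^+ 2)))).
  rewrite -[X in _ --> X](_ : \int[H]_y (cst 0) y = 0); last by rewrite Rintegral_cst// mul0r.
  apply: (@dominated_cvg_Rintegral _ _ _ H _ (cst 0) (cst 1)) => //.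
  - exact: finite_measure_integrable_cst.
  - apply: filterS H_gt0 => y y0; rewrite /cst max_r ?(ltW y0)//.
    by apply: cvg_expRN_ln1Dsqr; rewrite ?divr_gt0// gt_eqF.
  - by apply: aeW => y n; exact: bd.
move=> n; apply: le_trans (atom_le n.+1%:R x) _; rewrite xE mulr0 expr0n addr0 ln1 mulr0 addr0.
have ii : H.-integrable setT (EFin \o (fun y => expR (- (p / 2 * ln (1 + (n.+1%:R * Num.max 0 y) ^+ 2))))).
  exact: (@bounded_integrable _ _ _ _ _ 1).
rewrite [X in (_ <= EFin X)%E]/Rintegral fineK; last exact: integrable_fin_num ii.
have il := integrableZl measurableT (- (p / 2)) (integrable_ln1Dsqr n.+1%:R 0).
have := expR_Rintegral_le il; rewrite (RintegralZl _ measurableT (integrable_ln1Dsqr n.+1%:R 0)).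
rewrite (_ : - (2^-1 * _) = - (p / 2) * \int[H]_y ln (1 + (n.+1%:R * (Num.max 0 y - 0)) ^+ 2)); last first.
  by ring.
move=> h; apply: le_trans h _; rewrite le_eqVlt; apply/orP; left; apply/eqP.
by apply: eq_integral => y _; rewrite subr0 mulNr.
Qed.

End thinned_mean.

(** * Domination and limit of the smoothed densities *)

Section poisson_limit.
Context {R : realType} (p : R) (H : probability R R).
Hypotheses (p01 : 0 < p < 1) (H_gt0 : {ae H, forall y, 0 < y}).
Hypothesis lnH : H.-integrable setT (EFin \o (fun x => ln (1 + Num.max 0 x))).
Local Notation leb := (@lebesgue_measure R).

Let p0 : 0 < p. Proof. by case/andP: p01. Qed.

Let p1 : p < 1. Proof. by case/andP: p01. Qed.

Let q0 : 0 < 1 - p. Proof. by rewrite subr_gt0. Qed.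

Let ph0 : 0 < p / 2. Proof. by rewrite divr_gt0. Qed.

(** With [t = n + 1], [1 + t^2 v^2 = t^2 (c n + v^2)]: the Poisson parameter becomes the
    regularization of the Riesz kernel. *)
Let c n : R := (n.+1%:R ^+ 2)^-1.

Let c0 n : 0 < c n. Proof. by rewrite invr_gt0 exprn_gt0. Qed.

Let c_nincr m n : (m <= n)%N -> c n <= c m.
Proof. by move=> mn; rewrite lef_pV2 ?posrE ?exprn_gt0// lerXn2r ?nnegrE// ler_nat. Qed.

Let c_cvg0 : c n @[n --> \oo] --> 0.
Proof.
rewrite -[X in _ --> X](mulr0 0); rewrite (_ : c = fun n => n.+1%:R^-1 * n.+1%:R^-1).
  by apply: cvgM; exact: cvg_harmonic.
by apply/funext => n; rewrite /c expr2 invfM.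
Qed.

Let u n x (y : R) := ln (c n + (Num.max 0 y - x) ^+ 2).

Let lnc n (v : R) : ln (c n + v ^+ 2) = ln (1 + (n.+1%:R * v) ^+ 2) - 2 * ln n.+1%:R.
Proof.
have s0 : 0 < 1 + (n.+1%:R * v) ^+ 2 by rewrite ltr_pwDl// sqr_ge0.
have -> : c n + v ^+ 2 = (1 + (n.+1%:R * v) ^+ 2) / n.+1%:R ^+ 2.
  by rewrite /c; field; rewrite gt_eqF.
rewrite ln_div ?posrE ?exprn_gt0//; congr (_ - _).
by rewrite lnXn// mulr_natl.
Qed.

Let mmax : measurable_fun setT (fun y : R => Num.max 0 y).
Proof. exact: measurable_maxr. Qed.

Let iu n x : H.-integrable setT (EFin \o u n x).
Proof.
have h1 := @integrable_ln1Dsqr _ H lnH n.+1%:R x.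
have h2 : H.-integrable setT (EFin \o cst (2 * ln (n.+1%:R : R))) by exact: finite_measure_integrable_cst.
apply: eq_integrable (integrableB measurableT h1 h2) => //.
by move=> y _; rewrite /= /u lnc.
Qed.

Let mu n x : measurable_fun setT (u n x).
Proof. by apply/measurable_EFinP; exact: measurable_int (iu n x). Qed.

Let U n x := \int[H]_y u n x y.

Let UE n x : U n x = \int[H]_y ln (1 + (n.+1%:R * (Num.max 0 y - x)) ^+ 2) - 2 * ln n.+1%:R.
Proof.
have h1 := @integrable_ln1Dsqr _ H lnH n.+1%:R x.
have h2 : H.-integrable setT (EFin \o cst (2 * ln (n.+1%:R : R))) by exact: finite_measure_integrable_cst.
have := RintegralB measurableT h1 h2.
rewrite Rintegral_cst//= probability_setT mulr1 => <-.
by apply: eq_Rintegral => y _; rewrite /u lnc.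
Qed.

Let W n x := \int[H]_y atan (n.+1%:R * (Num.max 0 y - x)).

(** For a process with the thinned law as shape, this is [pi] times the density at [x] of its mean
    plus an independent Cauchy variable of scale [1 / (n + 1)]. *)
Definition poisson_density n x :=
  expR (- (p / 2 * U n x)) * expR (- ((1 - p) / 2 * ln (c n + x ^+ 2))) *
  cos (p * W n x - (1 - p) * atan (n.+1%:R * x)).

Local Notation f := poisson_density.

(** Replacing [1 + t^2 v^2] by [t^2 (c n + v^2)] releases the powers [t^(- p)] from [H] and
    [t^(-(1 - p))] from the atom at 0; together they cancel the prefactor [t = n + 1]. *)
Lemma poisson_densityE d (T : measurableType d) (P : probability T R) (D : R.-pker T ~> R) n x :
  dirichlet_process P 1 (thinning p H) D ->
  n.+1%:R * \int[P]_w (1 + (n.+1%:R * (random_mean D w - x)) ^+ 2)^-1 = f n x.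
Proof.
move=> hD; rewrite (mean_poisson_thinning p01 lnH hD) /f mulrA; congr (_ * _).
rewrite -[X in X * _ = _]lnK ?posrE// -!expRD UE lnc; congr expR.
by rewrite -/(W n x); field.
Qed.

Let g n x := (\int[H]_y (riesz p (c n) (Num.max 0 y - x))%:E)%E.

Let g_ge0 n x : (0 <= g n x)%E.
Proof. by apply: integral_ge0 => y _; rewrite lee_fin riesz_ge0. Qed.

Let expU_le n x : ((expR (- (p / 2 * U n x)))%:E <= g n x)%E.
Proof.
have il := integrableZl measurableT (- (p / 2)) (iu n x).
have := expR_Rintegral_le il; rewrite (RintegralZl _ measurableT (iu n x)) mulNr => h.
apply: le_trans h _; rewrite le_eqVlt; apply/orP; left; apply/eqP.
by apply: eq_integral => y _; rewrite /riesz /u mulNr.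
Qed.

(** [expU_le] bounds the contribution of [H] by the regularized potential [g]. The atom at 0
    contributes at most [x^(-(1 - p))], which is bounded only away from 0; hence [a > 0]. *)
Let f_le n a x : 0 < a <= x ->
  ((`|f n x|)%:E <= g n x * (expR (- ((1 - p) / 2 * ln (a ^+ 2))))%:E)%E.
Proof.
move=> /andP[a0 ax].
have h : `|f n x| <= expR (- (p / 2 * U n x)) * expR (- ((1 - p) / 2 * ln (a ^+ 2))).
  rewrite /f !normrM !(ger0_norm (expR_ge0 _)) -[leRHS]mulr1 ler_pM ?mulr_ge0 ?expR_ge0//.
    rewrite ler_wpM2l ?expR_ge0// ler_expR lerN2 ler_wpM2l ?divr_ge0 ?(ltW q0)//.
    rewrite ler_ln ?posrE ?exprn_gt0//; last by rewrite ltr_pwDl// sqr_ge0.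
    have x2 : a ^+ 2 <= x ^+ 2 by rewrite lerXn2r// nnegrE ltW// (lt_le_trans a0).
    by apply: le_trans x2 _; rewrite lerDr ltW.
  exact: cos_max.
apply: (@le_trans _ _ ((expR (- (p / 2 * U n x)))%:E * (expR (- ((1 - p) / 2 * ln (a ^+ 2))))%:E)%E).
  by rewrite -EFinM lee_fin.
by apply: lee_wpmul2r; [rewrite lee_fin expR_ge0|exact: expU_le].
Qed.

Let g_nd x : {homo (fun n => g n x) : m n / (m <= n)%N >-> (m <= n)%E}.
Proof.
move=> m n mn; apply: ge0_le_integral => //.
- by move=> y _; rewrite lee_fin riesz_ge0.
- apply/measurable_EFinP; apply: (measurableT_comp (measurable_riesz _ _)).
  exact: measurable_funB.
- apply/measurable_EFinP; apply: (measurableT_comp (measurable_riesz _ _)).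
  exact: measurable_funB.
- by move=> y _; rewrite lee_fin riesz_nincr// c_nincr.
Qed.

(** The Riesz potential of [H], possibly infinite, is obtained as a monotone limit so that the
    uniform bound on the integrals of [g n] passes to it. *)
Let G x := limn (fun n => g n x).

Let g_cvg x : g n x @[n --> \oo] --> G x.
Proof. exact: ereal_nondecreasing_is_cvgn. Qed.

Let g_le n x : (g n x <= G x)%E.
Proof.
rewrite /G (cvg_lim _ (ereal_nondecreasing_cvgn (@g_nd x)))//.
by apply: ereal_sup_ubound; exists n.
Qed.

Let kernel n (z : measurableTypeR R * R) := (riesz p (c n) (Num.max 0 z.2 - z.1))%:E.

Let mkernel n : measurable_fun setT (kernel n).
Proof.
apply/measurable_EFinP; apply: (measurableT_comp (measurable_riesz _ _)).
apply: measurable_funB; first exact: (measurableT_comp mmax measurable_snd).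
exact: measurable_fst.
Qed.

Let kernel_ge0 n z : (0 <= kernel n z)%E.
Proof. by rewrite lee_fin riesz_ge0. Qed.

Let mg n : measurable_fun setT (fun x : measurableTypeR R => g n x).
Proof. exact: (measurable_fun_fubini_tonelli_F (m2 := H) _ (mkernel n)). Qed.

Let integral_g_le n a b : a < b ->
  (\int[leb]_(x in `[a, b]) g n x <= (b - a + 8 / (1 - p))%:E)%E.
Proof.
move=> ab.
have mab : measurable (`[a, b] : set (measurableTypeR R)) by exact: measurable_itv.
pose k (z : measurableTypeR R * R) := (kernel n z * (\1_(`[a, b]%classic : set R) z.1)%:E)%E.
have mk : measurable_fun setT k.
  apply: emeasurable_funM => //; apply/measurable_EFinP.
  by apply: (measurableT_comp _ measurable_fst); exact: measurable_indic.
have k0 z : (0 <= k z)%E by rewrite mule_ge0// lee_fin.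
have -> : (\int[leb]_(x in `[a, b]) g n x = \int[leb]_x \int[H]_y k (x, y))%E.
  rewrite integral_mkcond; apply: eq_integral => x _; rewrite patchE /k/= indicE.
  case: (x \in _); first by apply: eq_integral => y _; rewrite mule1.
  by under eq_integral do rewrite mule0; rewrite integral0.
rewrite (fubini_tonelli k mk k0).
apply: (@le_trans _ _ (\int[H]_y (cst (b - a + 8 / (1 - p))%:E y))%E); last first.
  by rewrite integral_cst//= probability_setT mule1.
apply: ge0_le_integral => //.
- by move=> y _; exact: integral_ge0.
- exact: (measurable_fun_fubini_tonelli_G (m1 := leb) _ mk).
- move=> y _; rewrite /cst; apply: le_trans (integral_riesz_le p01 (Num.max 0 y) (c0 n) ab).
  rewrite [X in (_ <= X)%E]integral_mkcond le_eqVlt; apply/orP; left; apply/eqP.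
  apply: eq_integral => x _; rewrite patchE /k/= indicE.
  by case: (x \in _); rewrite ?mule1 ?mule0.
Qed.

Let mG : measurable_fun setT (fun x : measurableTypeR R => G x).
Proof. by apply: (emeasurable_fun_cvg (fun n (x : measurableTypeR R) => g n x)) => // x _; exact: g_cvg. Qed.

Let G_ge0 x : (0 <= G x)%E.
Proof. exact: le_trans (g_ge0 0 x) (g_le 0 x). Qed.

Let integral_G_le a b : a < b ->
  (\int[leb]_(x in `[a, b]) G x <= (b - a + 8 / (1 - p))%:E)%E.
Proof.
move=> ab.
have mab : measurable (`[a, b] : set (measurableTypeR R)) by exact: measurable_itv.
have h := @cvg_monotone_convergence _ _ _ leb _ mab (fun n x => g n x)
  (fun n => measurable_funTS (mg n)) (fun n x _ => g_ge0 n x) (fun x _ => @g_nd x).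
rewrite -(cvg_lim (@ereal_hausdorff _) h).
apply: lime_le; first by apply/cvg_ex; eexists; exact: h.
by apply: nearW => n; exact: integral_g_le.
Qed.

Let poisson_density_dominated a b : 0 < a -> a < b -> exists2 g : R -> R,
  leb.-integrable `[a, b] (EFin \o g) &
  {ae leb, forall x, `[a, b]%classic x -> (G x < +oo)%E /\ forall n, `|f n x| <= g x}.
Proof.
move=> a0 ab; pose A := expR (- ((1 - p) / 2 * ln (a ^+ 2))).
have mab : measurable (`[a, b] : set (measurableTypeR R)) by exact: measurable_itv.
have iG : leb.-integrable `[a, b] (fun x => G x).
  apply/integrableP; split; first exact: measurable_funTS.
  apply: le_lt_trans (ltry (b - a + 8 / (1 - p))); apply: le_trans (integral_G_le ab).
  rewrite le_eqVlt; apply/orP; left; apply/eqP.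
  by apply: eq_integral => x _; rewrite gee0_abs.
exists (fun x => fine (G x) * A).
  have iA := integrableZr mab A iG.
  apply: (le_integrable mab _ _ iA).
    apply/measurable_EFinP; apply: measurable_funM => //.
    by apply: measurable_funTS; exact: measurableT_comp.
  move=> x _; have := G_ge0 x; rewrite /cst /=; case: (G x) => [r| |]//= _.
  by rewrite mul0r normr0 abse_ge0.
have [N [mN N0 sub]] := integrable_ae mab iG.
exists N; split => // x /= h; apply: sub => /= gfin; apply: h => xab.
have Gfin := gfin xab.
split; first by rewrite ltey_eq Gfin.
move=> n; rewrite -lee_fin EFinM fineK//.
have /andP[ax _] : a <= x <= b by move: xab; rewrite in_itv.
apply: le_trans (@f_le n a x _) _; first by rewrite a0.
by apply: lee_wpmul2r; [rewrite lee_fin expR_ge0|exact: g_le].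
Qed.

Let l x (y : R) := ln ((Num.max 0 y - x) ^+ 2).

(** This is [pi] times the expected density, written with logarithms of squares and halved
    exponents, the form in which the limit of [poisson_density] appears. *)
Definition limit_density x :=
  expR (- (p / 2 * \int[H]_y l x y)) * expR (- ((1 - p) / 2 * ln (x ^+ 2))) *
  sin (pi * (p * (1 - fine (H `[0, x]%classic)))).

Section pointwise_limit.
Variable x : R.
Hypotheses (x0 : 0 < x) (Gx : (G x < +oo)%E).

Let N : set R := [set y | Num.max 0 y = x].

Let mN : measurable N.
Proof. by rewrite (_ : N = Num.max 0 @^-1` [set x])//; exact: measurable_preimageT. Qed.

Let v n y := u 0 x y - u n x y.

Let c_le1 n : c n <= c 0. Proof. exact: c_nincr. Qed.

Let s0 n y : 0 < c n + (Num.max 0 y - x) ^+ 2.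
Proof. by rewrite ltr_pwDl// sqr_ge0. Qed.

Let v_nd y : {homo (fun n => v n y) : m n / (m <= n)%N >-> m <= n}.
Proof. by move=> m n mn; rewrite lerD2l lerN2 ler_ln ?posrE// lerD2r c_nincr. Qed.

Let v_ge0 n y : 0 <= v n y.
Proof. by rewrite -(subrr (u 0 x y)); exact: (@v_nd y 0%N n). Qed.

Let iv n : H.-integrable setT (EFin \o v n).
Proof. exact: (integrableB measurableT (iu 0 x) (iu n x)). Qed.

(** From [-(p/2) U n x <= e^(-(p/2) U n x) <= G x] comes the bound [(2/p) G x] on [- U n x] for all
    [n]. *)
Let B := U 0 x + 2 / p * fine (G x).

Let int_v_le n : (\int[H]_y (v n y)%:E <= B%:E)%E.
Proof.
rewrite -[leLHS]fineK; last exact: integrable_fin_num (iv n).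
rewrite lee_fin -[leLHS]/(\int[H]_y (u 0 x y - u n x y)) (RintegralB measurableT (iu 0 x) (iu n x)).
rewrite -/(U 0 x) -/(U n x) lerD2l.
have h1 : expR (- (p / 2 * U n x)) <= fine (G x).
  rewrite -lee_fin fineK; last by rewrite ge0_fin_numE.
  exact: le_trans (expU_le n x) (g_le n x).
have := le_trans (expR_ge1Dx (- (p / 2 * U n x))) h1 => h2.
have : - (p / 2 * U n x) <= fine (G x) by lra.
rewrite -mulrN mulrC -ler_pdivlMr// => h; apply: le_trans h _.
by rewrite invf_div mulrC.
Qed.

(* The bound [int_v_le] does not depend on [n], while an atom of [H] at [x]
   would contribute [2 * ln n.+1 * H {x}]; the same bound makes
   [ln ((y - x) ^+ 2)] integrable. *)
Let N0 : H N = 0%E.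
Proof.
have Nfin : H N \is a fin_num by rewrite fin_num_measure.
apply/eqP/negPn/negP => hN.
pose q := fine (H N).
have qp : 0 < q by rewrite /q fine_gt0// lt0e hN measure_ge0/= ltey_eq Nfin.
pose n := Num.truncn (expR (B / (2 * q))).
have hn : expR (B / (2 * q)) < n.+1%:R by exact: truncnS_gt.
have : ((2 * ln n.+1%:R * q)%:E <= B%:E)%E.
  apply: le_trans (int_v_le n).
  have -> : (2 * ln n.+1%:R * q)%:E = (\int[H]_y ((2 * ln (n.+1%:R : R))%:E * (\1_N y)%:E))%E.
    rewrite ge0_integralZl_EFin//; first by rewrite integral_indic// setIT EFinM /q fineK.
      by apply/measurable_EFinP; exact: measurable_indic.
    by rewrite mulr_ge0// ln_ge0// ler1n.
  apply: ge0_le_integral => //.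
  - by move=> y _; rewrite -EFinM lee_fin mulr_ge0// mulr_ge0// ln_ge0// ler1n.
  - by apply: emeasurable_funM => //; apply/measurable_EFinP; exact: measurable_indic.
  - exact: measurable_int (iv n).
  - move=> y _; rewrite -EFinM lee_fin indicE; have [|_] := boolP (y \in N); last by rewrite mulr0.
    rewrite inE /N/= => yx; rewrite mulr1 /v /u yx subrr expr0n !addr0 /c expr1n invr1 ln1 sub0r.
    by rewrite lnV ?posrE ?exprn_gt0// opprK lnXn// mulr_natl.
rewrite lee_fin leNgt => /negP; apply.
have : ln (expR (B / (2 * q))) < ln n.+1%:R by rewrite ltr_ln ?posrE ?expR_gt0.
by rewrite expRK ltr_pdivrMr ?mulr_gt0// => h; apply: lt_le_trans h _; rewrite le_eqVlt; apply/orP; left; apply/eqP; ring.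
Qed.

Let notN y : ~ N y -> 0 < (Num.max 0 y - x) ^+ 2.
Proof.
move=> h; rewrite exprn_even_gt0//= subr_eq0; by apply/eqP.
Qed.

Let u_cvg y : ~ N y -> u n x y @[n --> \oo] --> l x y.
Proof.
move=> /notN h; rewrite /u /l -[X in ln X]add0r.
apply: continuous_cvg; first by apply: continuous_ln; rewrite add0r.
by apply: cvgD; [exact: c_cvg0|exact: cvg_cst].
Qed.

Let ml : measurable_fun setT (l x).
Proof.
by apply: (measurableT_comp (@measurable_ln R)); apply: measurable_funX; exact: measurable_funB.
Qed.

Let vlim y := limn (fun n => (v n y)%:E).

Let vlim_cvg y : (v n y)%:E @[n --> \oo] --> vlim y.
Proof. by apply: ereal_nondecreasing_is_cvgn => m n mn; rewrite lee_fin v_nd. Qed.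

Let il : H.-integrable setT (EFin \o l x).
Proof.
have mvlim : measurable_fun setT vlim.
  apply: (emeasurable_fun_cvg (fun n y => (v n y)%:E)) => [n|y _]; last exact: vlim_cvg.
  exact: measurable_int (iv n).
have vlim0 y : (0 <= vlim y)%E.
  by apply: lime_ge; [apply/cvg_ex; eexists; exact: vlim_cvg|apply: nearW => n; rewrite lee_fin].
have ivlim : H.-integrable setT vlim.
  apply/integrableP; split => //; apply: le_lt_trans (ltry B).
  have h := @cvg_monotone_convergence _ _ _ H _ measurableT (fun n y => (v n y)%:E)
    (fun n => measurable_int _ (iv n)) (fun n y _ => v_ge0 n y) (fun y _ m n mn => v_nd y mn).
  under eq_integral do rewrite gee0_abs//.
  rewrite -(cvg_lim (@ereal_hausdorff _) h).
  apply: lime_le; first by apply/cvg_ex; eexists; exact: h.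
  by apply: nearW => n; exact: int_v_le.
have iw : H.-integrable setT (EFin \o (fun y => u 0 x y - l x y)).
  apply: (le_integrable measurableT _ _ ivlim).
    by apply/measurable_EFinP; exact: measurable_funB.
  move=> y _; rewrite [leRHS]gee0_abs//=; have [yN|yN] := pselect (N y).
    (* On [N] both logarithms are 0: [c 0 = 1], and [ln 0] has the default value 0. *)
    rewrite /u /l yN subrr expr0n addr0 /c expr1n invr1 ln1 ln0// subrr normr0.
    exact: vlim0.
  have h : (v n y)%:E @[n --> \oo] --> (u 0 x y - l x y)%:E.
    apply/fine_cvgP; split; first exact: nearW.
    by apply: cvgB; [exact: cvg_cst|exact: u_cvg].
  have e : vlim y = (u 0 x y - l x y)%:E by apply/cvg_lim.
  rewrite e lee_fin ger0_norm// -lee_fin -e; exact: vlim0.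
apply: eq_integrable (integrableB measurableT (iu 0 x) iw) => //.
by move=> y _; rewrite /= -EFinB opprB addrC subrK.
Qed.

Let ae_notN : {ae H, forall y, ~ N y}.
Proof. by exists N; split => // y /= /contrapT. Qed.

(** Off the null set [N], [l <= u n <= u 0] with both ends integrable. *)
Let U_cvg : U n x @[n --> \oo] --> \int[H]_y l x y.
Proof.
have inl := integrable_norm il.
apply: (@dominated_cvg_Rintegral _ _ _ H (fun n => u n x) (l x) (fun y => `|l x y| + u 0 x y)) => //.
- exact: (integrableD measurableT inl (iu 0 x)).
- by apply: filterS ae_notN => y; exact: u_cvg.
- apply: filterS ae_notN => y yN n.
  have h1 : l x y <= u n x y.
    by rewrite /l /u ler_ln ?posrE ?notN// lerDr ltW.
  have h2 : u n x y <= u 0 x y by rewrite ler_ln ?posrE// lerD2r.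
  have h3 : 0 <= u 0 x y by rewrite ln_ge0// /c expr1n invr1 lerDl sqr_ge0.
  have := ler_norm (- l x y); rewrite normrN => h4; have h5 := normr_ge0 (l x y).
  by rewrite ler_norml; apply/andP; split; lra.
Qed.

Let h := fine (H `[0, x]%classic).

(** [atan (t (y - x))] tends to [pi / 2] for [y > x] and to [- pi / 2] for [y < x]. The point
    [y = x] is negligible by [N0] and [y > 0] holds almost surely, so [h] is the mass where the
    limit is negative. *)
Let W_cvg : W n x @[n --> \oo] --> pi / 2 * (1 - 2 * h).
Proof.
have mi : measurable (`[0, x]%classic : set R) by [].
have i1 := integrable_indic H mi.
have i2 := integrableZl measurableT 2 i1.
have i3 : H.-integrable setT (EFin \o cst 1) by exact: finite_measure_integrable_cst.
have -> : pi / 2 * (1 - 2 * h) = \int[H]_y (pi / 2 * (1 - 2 * (\1_(`[0, x]%classic : set R) y))).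
  rewrite (RintegralZl _ measurableT (integrableB measurableT i3 i2)).
  rewrite (RintegralB measurableT i3 i2) (RintegralZl _ measurableT i1) Rintegral_cst//= probability_setT mulr1.
  by rewrite /Rintegral integral_indic// setIT.
apply: (@dominated_cvg_Rintegral _ _ _ H (fun n y => atan (n.+1%:R * (Num.max 0 y - x))) _ (cst (pi / 2))).
- move=> n; apply: (measurableT_comp (@measurable_atan R)); apply: measurable_funM => //.
  exact: measurable_funB.
- apply: measurable_funM => //; apply: measurable_funB => //; exact: measurable_funM.
- exact: finite_measure_integrable_cst.
- have : {ae H, forall y, ~ N y /\ 0 < y} by apply: filterS2 ae_notN H_gt0 => y.
  apply: filterS => y [yN y0].
  have yx : y != x by apply/eqP => e; apply: yN; rewrite /N/= max_r// ltW.
  rewrite max_r ?(ltW y0)// indicE mem_setE in_itv/= (ltW y0)/=.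
  have tinf (r : R) : 0 < r -> atan (n.+1%:R * r) @[n --> \oo] --> pi / 2.
    move=> r0; have hh : n.+1%:R * r @[n --> \oo] --> +oo.
      apply/cvgryPge => A; near=> n.
      have : A / r <= n%:R by near: n; exact: nbhs_infty_ger.
      rewrite ler_pdivrMr// => hA; apply: le_trans hA _.
      by rewrite ler_wpM2r ?(ltW r0)// ler_nat.
    exact: (cvg_comp _ _ hh (@cvgy_atan R)).
  have [yx'|yx'] := leP y x.
    rewrite mulr1 [1 - 2](_ : _ = -1) ?mulrN1; last by ring.
    have e n : atan (n.+1%:R * (y - x)) = - atan (n.+1%:R * (x - y)) by rewrite -atanN -mulrN opprB.
    under eq_fun do rewrite e.
    by apply: cvgN; apply: tinf; rewrite subr_gt0 lt_neqAle yx.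
  by rewrite mulr0 subr0 mulr1; apply: tinf; rewrite subr_gt0.
- by apply: aeW => y n; exact: norm_atan_le.
Unshelve. all: end_near.
Qed.

Lemma poisson_density_cvg : f n x @[n --> \oo] --> limit_density x.
Proof.
apply: cvgM; first apply: cvgM.
- apply: continuous_cvg; first exact: continuous_expR.
  by apply: cvgN; apply: cvgM; [exact: cvg_cst|exact: U_cvg].
- apply: continuous_cvg; first exact: continuous_expR.
  apply: cvgN; apply: cvgM; first exact: cvg_cst.
  rewrite -[X in ln X]add0r; apply: continuous_cvg.
    by apply: continuous_ln; rewrite add0r exprn_gt0.
  by apply: cvgD; [exact: c_cvg0|exact: cvg_cst].
(* The limit phase [p (pi / 2) (1 - 2 h) - (1 - p) pi / 2] equals [pi p (1 - h) - pi / 2], and the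
   shift by [pi / 2] turns the cosine into a sine. *)
have -> : sin (pi * (p * (1 - fine (H `[0, x]%classic)))) = cos (p * (pi / 2 * (1 - 2 * h)) - (1 - p) * (pi / 2)).
  rewrite -[X in sin X](subrK (pi / 2)) sinDpihalf; congr cos.
  by rewrite /h; field.
apply: continuous_cvg; first exact: continuous_cos.
apply: cvgB; apply: cvgM; try exact: cvg_cst; first exact: W_cvg.
have hh : n.+1%:R * x @[n --> \oo] --> +oo.
  apply/cvgryPge => A; near=> n.
  have : A / x <= n%:R by near: n; exact: nbhs_infty_ger.
  rewrite ler_pdivrMr// => hA; apply: le_trans hA _.
  by rewrite ler_wpM2r ?(ltW x0)// ler_nat.
exact: (cvg_comp _ _ hh (@cvgy_atan R)).
Unshelve. all: end_near.
Qed.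

Lemma limit_densityE :
  ((x `^ (- (1 - p)) * sin (pi * p * (1 - fine (H `[0, x]%classic))))%:E *
     expeR (- (p%:E * \int[H]_y (ln `|x - y| * (y != x)%:R)%:E)) = (limit_density x)%:E)%E.
Proof.
have e : (\int[H]_y (ln `|x - y| * (y != x)%:R)%:E = (2^-1 * \int[H]_y l x y)%:E)%E.
  rewrite -(RintegralZl _ measurableT il) /Rintegral fineK; last first.
    exact: integrable_fin_num (integrableZl measurableT 2^-1 il).
  apply: ae_eq_integral => //.
  - exact: (@measurable_ln_dist _ _ _ (cst x) id).
  - exact: measurable_int (integrableZl measurableT 2^-1 il).
  have : {ae H, forall y, ~ N y /\ 0 < y} by apply: filterS2 ae_notN H_gt0 => y.
  apply: filterS => y [yN y0] _; congr EFin.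
  have yx : y != x by apply/eqP => e; apply: yN; rewrite /N/= max_r// ltW.
  rewrite yx mulr1 /l max_r ?(ltW y0)// -[(y - x) ^+ 2]real_normK ?num_real// lnXn ?normr_gt0 ?subr_eq0//.
  by rewrite distrC; field.
rewrite e -EFinM; transitivity ((x `^ (- (1 - p)) * sin (pi * p * (1 - fine (H `[0, x]%classic))) *
  expR (- (p * (2^-1 * \int[H]_y l x y))))%:E); first by [].
congr EFin; rewrite /limit_density.
rewrite /powR gt_eqF// lnXn// [ln x *+ 2](_ : _ = 2 * ln x); last by rewrite mulr_natl.
rewrite [- ((1 - p) / 2 * _)](_ : _ = - (1 - p) * ln x); last by field.
rewrite [- (p / 2 * _)](_ : _ = - (p * (2^-1 * \int[H]_y l x y))); last by field.
by rewrite mulrC mulrA -!mulrA.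
Qed.

End pointwise_limit.

Lemma poisson_density_limit a b : 0 < a -> a < b -> exists2 g : R -> R,
  leb.-integrable `[a, b] (EFin \o g) &
  {ae leb, forall x, `[a, b]%classic x ->
    [/\ forall n, `|f n x| <= g x, f n x @[n --> \oo] --> limit_density x &
     ((x `^ (- (1 - p)) * sin (pi * p * (1 - fine (H `[0%R, x]%classic))))%:E *
     expeR (- (p%:E * \int[H]_y (ln `|x - y| * (y != x)%:R)%:E)) = (limit_density x)%:E)%E]}.
Proof.
move=> a0 ab; have [e ie he] := poisson_density_dominated a0 ab.
exists e => //; have [N [mN N0 sub]] := he.
exists N; split => // x /= nh; apply: sub => /= hx; apply: nh => xab; have [Gx gx] := hx xab.
have x0 : 0 < x by move: xab; rewrite /= in_itv/= => /andP[/(lt_le_trans a0)].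
by split => //; [exact: poisson_density_cvg|exact: limit_densityE].
Qed.

End poisson_limit.

(** * From intervals away from 0 to all Borel sets *)

Section density_law.
Context {R : realType}.
Local Notation leb := (@lebesgue_measure R).
Variables (m : {measure set R -> \bar R}) (f : R -> \bar R).
Hypothesis mf : measurable_fun setT (f : measurableTypeR R -> \bar R).
Hypothesis f0 : forall x, (0 <= f x)%E.
Hypothesis mfin : (m setT < +oo)%E.
Hypothesis m_npos : m `]-oo, 0%R]%classic = 0%E.
Hypothesis m_oc : forall a b : R, 0 < a -> a < b -> m `]a, b]%classic = (\int[leb]_(x in `]a, b]) f x)%E.

Let m2 (A : set R) := (\int[leb]_(x in A) (f \_ `]0%R, +oo[) x)%E.

Let mpatch : measurable_fun setT (f \_ `]0%R, +oo[ : measurableTypeR R -> \bar R).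
Proof. by apply/(measurable_restrictT _ _).1 => //; exact: measurable_funTS. Qed.

Let patch0 x : (0 <= (f \_ `]0%R, +oo[) x)%E.
Proof. by rewrite patchE; case: ifP. Qed.

Let m2_0 : m2 set0 = 0%E. Proof. exact: integral_set0. Qed.

Let m2_ge0 A : (0 <= m2 A)%E. Proof. exact: integral_ge0. Qed.

Let m2_sigma : semi_sigma_additive m2.
Proof. by apply: (@semi_sigma_additive_nng_induced _ (measurableTypeR R) R leb). Qed.

HB.instance Definition _ := isMeasure.Build _ R R m2 m2_0 m2_ge0 m2_sigma.

Let m2E A : m2 A = (\int[leb]_(x in A `&` `]0%R, +oo[) f x)%E.
Proof. by rewrite integral_mkcondr. Qed.

Let m2_oc a b : 0 < a -> a < b -> m2 `]a, b]%classic = m `]a, b]%classic.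
Proof.
move=> a0 ab; rewrite m2E m_oc//; congr (\int[_]_(_ in _) _)%E.
apply/setIidPl => x /=; rewrite !in_itv/= andbT => /andP[ax _]; exact: lt_trans ax.
Qed.

Let ray_pos a : 0 < a -> m2 `]a, +oo[%classic = m `]a, +oo[%classic.
Proof.
move=> a0; pose F n : set R := `]a, a + n.+1%:R]%classic.
have FE : \bigcup_n F n = `]a, +oo[%classic.
  apply/seteqP; split => x /=; rewrite in_itv/= andbT.
    by move=> [n _]; rewrite /F/= in_itv/= => /andP[].
  move=> ax; exists (Num.truncn (x - a)) => //; rewrite /F/= in_itv/= ax/=.
  by rewrite -lerBlDl ltW// truncnS_gt.
have mF n : measurable (F n) by exact: measurable_itv.
have mU : measurable (\bigcup_n F n) by rewrite FE; exact: measurable_itv.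
have ndF : nondecreasing_seq F.
  move=> i j ij; apply/subsetPset => x; rewrite /F/= !in_itv/= => /andP[-> h]/=.
  by apply: le_trans h _; rewrite lerD2l ler_nat.
have h1 := nondecreasing_cvg_mu (mu := m) mF mU ndF.
have h2 := nondecreasing_cvg_mu (mu := m2) mF mU ndF.
rewrite -FE -(cvg_lim (@ereal_hausdorff _) h1) -(cvg_lim (@ereal_hausdorff _) h2).
congr (limn _); apply/funext => n /=; rewrite m2_oc// ltrDl//.
Qed.

Let ray_0 : m2 `]0%R, +oo[%classic = m `]0%R, +oo[%classic.
Proof.
pose F n : set R := `]n.+1%:R^-1, +oo[%classic.
have FE : \bigcup_n F n = `]0, +oo[%classic.
  apply/seteqP; split => x /=; rewrite in_itv/= andbT.
    by move=> [n _]; rewrite /F/= in_itv/= andbT; apply: lt_trans; rewrite invr_gt0.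
  move=> x0; exists (Num.truncn x^-1) => //; rewrite /F/= in_itv/= andbT.
  by rewrite invf_plt ?posrE// truncnS_gt.
have mF n : measurable (F n) by exact: measurable_itv.
have mU : measurable (\bigcup_n F n) by rewrite FE; exact: measurable_itv.
have ndF : nondecreasing_seq F.
  move=> i j ij; apply/subsetPset => x; rewrite /F/= !in_itv/= !andbT; apply: le_lt_trans.
  by rewrite lef_pV2 ?posrE// ler_nat.
have h1 := nondecreasing_cvg_mu (mu := m) mF mU ndF.
have h2 := nondecreasing_cvg_mu (mu := m2) mF mU ndF.
rewrite -FE -(cvg_lim (@ereal_hausdorff _) h1) -(cvg_lim (@ereal_hausdorff _) h2).
by congr (limn _); apply/funext => n /=; rewrite ray_pos// invr_gt0.
Qed.

(** The density is known only on intervals away from 0. Rays from [a > 0] are increasing unions of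
    such intervals, the ray from 0 is an increasing union of rays, and rays from [a < 0] add nothing
    since [m] does not charge []-oo, 0]]. *)
Lemma density_law A : measurable A -> m A = (\int[leb]_(x in A `&` `]0%R, +oo[) f x)%E.
Proof.
move=> mA; rewrite -m2E; apply: measure_ray_unique => // a.
have [a0|a0] := ltP 0 a; first exact/esym/ray_pos.
have m1 : m `]a, +oo[%classic = m `]0%R, +oo[%classic.
  apply/eqP; rewrite eq_le; apply/andP; split.
    apply: (@le_trans _ _ (m (`]-oo, 0%R]%classic `|` `]0%R, +oo[%classic))).
      rewrite le_measure ?inE//; first exact: measurableU.
      move=> x _ /=; rewrite !in_itv/= andbT.
      by have [x0|x0] := leP x 0; [left|right].
    rewrite (le_trans (measureU2 _ _ _))//.
    by rewrite [X in (X + _)%E](_ : _ = 0%E) ?add0e.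
  rewrite le_measure ?inE// => x /=; rewrite !in_itv/= !andbT.
  exact: le_lt_trans.
transitivity (m2 `]a, +oo[%classic); last by [].
rewrite m1 -ray_0 !m2E; congr (\int[_]_(_ in _) _)%E.
rewrite setIid; apply/esym/setIidPr => x /=; rewrite !in_itv/= !andbT.
exact: le_lt_trans.
Qed.

End density_law.

(** * The density of the mean for [theta = 1] *)

Section thinned_mean_density.
Context {R : realType} (p : R) (H : probability R R).
Hypotheses (p01 : 0 < p < 1) (H_gt0 : {ae H, forall y, 0 < y}).
Hypothesis lnH : H.-integrable setT (EFin \o (fun x => ln (1 + Num.max 0 x))).
Context d (T : measurableType d) (P : probability T R) (D : R.-pker T ~> R).
Hypothesis hD : dirichlet_process P 1 (thinning p H) D.
Local Notation M := (random_mean D).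
Local Notation leb := (@lebesgue_measure R).
Local Notation f := (poisson_density p H).

Let phi (x y : R) := ln `|x - y| * (y != x)%:R.

Let dens (x : R) : \bar R :=
  ((pi^-1 * x `^ (- (1 - p)) * sin (pi * p * (1 - fine (H `[0%R, x]%classic))))%:E *
   expeR (- (p%:E * \int[H]_y (phi x y)%:E)))%E.

Let cdf01 x : 0 <= fine (H `[0%R, x]%classic) <= 1.
Proof.
have fin : H `[0%R, x]%classic \is a fin_num by rewrite fin_num_measure.
by rewrite fine_ge0//= -lee_fin fineK// probability_le1.
Qed.

Let dens_ge0 x : (0 <= dens x)%E.
Proof.
have /andP[p0 p1] := p01; have /andP[h0 h1] := cdf01 x.
rewrite mule_ge0 ?expeR_ge0// lee_fin mulr_ge0 ?mulr_ge0 ?powR_ge0 ?invr_ge0 ?pi_ge0//.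
apply: sin_ge0_pi; rewrite -mulrA mulr_ge0 ?pi_ge0//=; last by rewrite mulr_ge0 ?subr_ge0// ltW.
rewrite -[leRHS]mulr1 ler_wpM2l ?pi_ge0//; nra.
Qed.

Let mcdf : measurable_fun setT (fun x : R => fine (H `[0%R, x]%classic)).
Proof.
apply: nondecreasing_measurable => // x y xy.
have fin z : H `[0%R, z]%classic \is a fin_num by rewrite fin_num_measure.
rewrite fine_le// le_measure ?inE// => z /=; rewrite !in_itv/= => /andP[-> zx]/=.
exact: le_trans xy.
Qed.

Let mphi2 : measurable_fun setT (fun z : measurableTypeR R * R => (phi z.1 z.2)%:E).
Proof.
by apply: measurable_ln_dist; [exact: measurable_fst|exact: measurable_snd].
Qed.

(** Tonelli's theorem gives measurability for nonnegative kernels, hence the splitting into positive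
    and negative parts. *)
Let mPhi : measurable_fun setT (fun x : measurableTypeR R => \int[H]_y (phi x y)%:E)%E.
Proof.
have e : (fun x : measurableTypeR R => \int[H]_y (phi x y)%:E)%E =
  (fun x => \int[H]_y (maxe (phi x y)%:E 0%E) - \int[H]_y (maxe (- (phi x y)%:E)%E 0%E))%E.
  apply/funext => x; rewrite integralE; congr (_ - _)%E; apply: eq_integral => y _.
    by rewrite funeposE.
  by rewrite funenegE.
rewrite e; apply: emeasurable_funB.
  have mk : measurable_fun setT (fun z : measurableTypeR R * R => maxe (phi z.1 z.2)%:E 0%E).
    rewrite (_ : (fun z => _) = (fun z : measurableTypeR R * R => (phi z.1 z.2)%:E)^\+%E).
      exact: measurable_funepos.
    by apply/funext => z; rewrite funeposE.
  by apply: (measurable_fun_fubini_tonelli_F (m2 := H) _ mk) => z; rewrite le_max lexx orbT.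
have mk : measurable_fun setT (fun z : measurableTypeR R * R => maxe (- (phi z.1 z.2)%:E)%E 0%E).
  rewrite (_ : (fun z => _) = (fun z : measurableTypeR R * R => (phi z.1 z.2)%:E)^\-%E).
    exact: measurable_funeneg.
  by apply/funext => z; rewrite funenegE.
by apply: (measurable_fun_fubini_tonelli_F (m2 := H) _ mk) => z; rewrite le_max lexx orbT.
Qed.

Let measurable_expeR : measurable_fun setT (@expeR R).
Proof.
move=> _; apply: (measurability _ (ErealGenOInfty.measurableE R)) => //.
move=> _ [_ [x ->] <-]; rewrite setTI; have [x0|x0] := ltP x 0.
  rewrite (_ : _ @^-1` _ = setT)//; apply/seteqP; split => // y _ /=.
  by rewrite in_itv/= andbT (lt_le_trans _ (expeR_ge0 y))// lte_fin.
have [y0 y0x] := @expeR_total R x%:E x0.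
rewrite (_ : _ @^-1` _ = `]y0, +oo[%classic); first exact: emeasurable_itv.
by apply/seteqP; split => y /=; rewrite !in_itv/= !andbT -y0x lte_expeR.
Qed.

Let mdens : measurable_fun setT (dens : measurableTypeR R -> \bar R).
Proof.
apply: emeasurable_funM.
  apply/measurable_EFinP; apply: measurable_funM.
    by apply: measurable_funM => //; exact: measurable_powR.
  apply: (measurableT_comp (@measurable_sin R)); apply: measurable_funM => //.
  exact: measurable_funB.
apply: (measurableT_comp measurable_expeR); apply: measurableT_comp => //.
by apply: emeasurable_funM; [exact: measurable_cst|exact: mPhi].
Qed.

Let mM : measurable_fun setT M := measurable_random_mean D.

Let t n : R := n.+1%:R.

(** Measurability in [x] is read off the probabilistic form of [f n], an integral of a jointly
    measurable kernel over [P]. *)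
Let mf n : measurable_fun setT (f n : measurableTypeR R -> R).
Proof.
pose k (z : measurableTypeR R * T) := ((1 + (t n * (M z.2 - z.1)) ^+ 2)^-1)%:E.
have k0 z : (0 <= k z)%E by rewrite lee_fin invr_ge0 addr_ge0// sqr_ge0.
have mk : measurable_fun setT k.
  apply/measurable_EFinP; apply: (measurableT_comp (@measurable_inv R)).
  apply: measurable_funD => //; apply: measurable_funX; apply: measurable_funM => //.
  apply: measurable_funB; first exact: (measurableT_comp mM measurable_snd).
  exact: measurable_fst.
rewrite (_ : f n = fun x => t n * fine (\int[P]_w k (x, w))%E); last first.
  by apply/funext => x; rewrite -(poisson_densityE p01 lnH n x hD).
apply: measurable_funM => //; apply: measurableT_comp => //.
by apply: (measurable_fun_fubini_tonelli_F (m2 := P) _ mk).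
Qed.

(** The integral over [[a, b]] of the kernel centred at [M w], whose primitive is an arctangent. *)
Let A n a b w := atan (t n * (b - M w)) - atan (t n * (a - M w)).

Let integral_f n a b : a < b ->
  (\int[leb]_(x in `[a, b]) (f n x)%:E = \int[P]_w (A n a b w)%:E)%E.
Proof.
move=> ab.
have t0 : 0 < t n by [].
pose k (z : measurableTypeR R * T) := ((t n * (1 + (t n * (M z.2 - z.1)) ^+ 2)^-1) *
  \1_(`[a, b]%classic : set R) z.1)%:E.
have s0 u : 0 < 1 + u ^+ 2 :> R by rewrite ltr_pwDl// sqr_ge0.
have mk : measurable_fun setT k.
  apply/measurable_EFinP; apply: measurable_funM.
    apply: measurable_funM => //; apply: (measurableT_comp (@measurable_inv R)).
    apply: measurable_funD => //; apply: measurable_funX; apply: measurable_funM => //.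
    apply: measurable_funB; first exact: (measurableT_comp mM measurable_snd).
    exact: measurable_fst.
  by apply: (measurableT_comp _ measurable_fst); exact: measurable_indic.
have k0 z : (0 <= k z)%E.
  by rewrite lee_fin mulr_ge0// mulr_ge0 ?(ltW t0)// invr_ge0 ltW.
transitivity (\int[leb]_x \int[P]_w k (x, w))%E.
  rewrite integral_mkcond; apply: eq_integral => x _; rewrite patchE /k/= indicE.
  case: (x \in _); last by under eq_integral do rewrite mulr0; rewrite integral0.
  rewrite -(poisson_densityE p01 lnH n x hD).
  have i1 : P.-integrable setT (EFin \o (fun w => (1 + (t n * (M w - x)) ^+ 2)^-1)).
    apply: (@bounded_integrable _ _ _ _ _ 1) => [|w].
      apply: (measurableT_comp (@measurable_inv R)); apply: measurable_funD => //.
      by apply: measurable_funX; apply: measurable_funM => //; exact: measurable_funB.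
    by rewrite ger0_norm ?invr_ge0 ?(ltW (s0 _))// invf_le1// lerDl sqr_ge0.
  rewrite -(RintegralZl _ measurableT i1) /Rintegral fineK.
    by apply: eq_integral => w _; rewrite mulr1.
  exact: integrable_fin_num (integrableZl measurableT (t n) i1).
rewrite (fubini_tonelli k mk k0); apply: eq_integral => w _.
pose g (x : R) := t n * (1 + (t n * (x - M w)) ^+ 2)^-1.
pose F (x : R) := atan (- (t n * M w) + t n * x).
have dF (x : R) : is_derive x (1 : R) F (g x).
  have h := @is_derive_comp1 _ (@atan R) (fun z => - (t n * M w) + t n * z) x _ _
    (is_derive1_atan _) (is_derive_affine _ _ _).
  apply: is_derive_eq h _; rewrite /g mulrC; congr (_ * (1 + _ ^+ 2)^-1); ring.
have cF (x : R) : {for x, continuous F}.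
  apply: differentiable_continuous; apply/derivable1_diffP.
  exact: (@ex_derive _ _ _ _ _ _ _ (dF x)).
have cg (x : R) : {for x, continuous g}.
  apply: cvgM; first exact: cvg_cst.
  apply: cvgV; first by rewrite gt_eqF.
  apply: cvgD; first exact: cvg_cst.
  have cl : {for x, continuous (fun z => t n * (z - M w))}.
    by apply: cvgM; [exact: cvg_cst|apply: cvgB; [exact: cvg_id|exact: cvg_cst]].
  by apply: cvgM; exact: cl.
transitivity (\int[leb]_(x in `[a, b]) (g x)%:E)%E.
  rewrite [RHS]integral_mkcond; apply: eq_integral => x _; rewrite patchE /k/= indicE.
  case: (x \in _); last by rewrite mulr0.
  by rewrite mulr1 /g -sqrrN -mulrN opprB.
rewrite (@continuous_FTC2 R g F a b ab); first last.
- by move=> x _; rewrite derive1E; exact: (@derive_val _ _ _ _ _ _ _ (dF x)).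
- split.
  + by move=> x _; exact: (@ex_derive _ _ _ _ _ _ _ (dF x)).
  + by apply: cvg_at_right_filter; exact: cF.
  + by apply: cvg_at_left_filter; exact: cF.
- by apply: continuous_subspaceT; exact: cg.
rewrite -EFinB /F /A; congr (atan _ - atan _)%:E; ring.
Qed.

Let cvg_f a b : 0 < a -> a < b ->
  (\int[leb]_(x in `[a, b]) (f n x)%:E)%E @[n --> \oo] --> (pi%:E * \int[leb]_(x in `]a, b]) dens x)%E.
Proof.
move=> a0 ab; have [g ig [N [mN N0 sub]]] := poisson_density_limit p01 H_gt0 lnH a0 ab.
have mab : measurable (`[a, b] : set (measurableTypeR R)) by exact: measurable_itv.
have -> : (pi%:E * \int[leb]_(x in `]a, b]) dens x = \int[leb]_(x in `[a, b]) (pi%:E * dens x))%E.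
  rewrite integral_itv_obnd_cbnd; last exact: (measurable_funTS mdens).
  by rewrite ge0_integralZl_EFin ?pi_ge0//; exact: (measurable_funTS mdens).
have [|||||_ _] := @dominated_convergence _ _ _ leb _ mab
    (fun n x => (f n x)%:E) (fun x => pi%:E * dens x)%E (EFin \o g) => //.
- by move=> n; apply/measurable_EFinP; exact: (measurable_funTS (mf n)).
- by apply: emeasurable_funM => //; exact: (measurable_funTS mdens).
- exists N; split => // x /= nh; apply: sub => /= h; apply: nh => xab.
  have [_ h2 h3] := h xab.
  have -> : (pi%:E * dens x = (limit_density p H x)%:E)%E.
    rewrite -h3 /dens muleA -EFinM; congr (_%:E * _)%E.
    by rewrite !mulrA divff ?mul1r// gt_eqF// pi_gt0.
  by apply/fine_cvgP; split; [exact: nearW|exact: h2].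
- exists N; split => // x /= nh; apply: sub => /= h; apply: nh => n xab.
  by have [h1 _ _] := h xab; rewrite lee_fin.
Qed.

(** The limit is [pi] when [M] lies inside the interval but only [pi / 2] when it sits at an
    endpoint; [random_mean_no_atom] discards both endpoints. *)
Let cvg_A a b : 0 < a -> a < b ->
  (\int[P]_w (A n a b w)%:E)%E @[n --> \oo] --> (pi%:E * P (M @^-1` `]a, b]))%E.
Proof.
move=> a0 ab; have b0 := lt_trans a0 ab.
have mab : measurable (M @^-1` `]a, b]) by exact: measurable_preimageT.
have -> : (pi%:E * P (M @^-1` `]a, b]) = \int[P]_w (pi * \1_(M @^-1` `]a, b]) w)%:E)%E.
  under eq_integral do rewrite EFinM.
  rewrite ge0_integralZl_EFin ?pi_ge0//; last by apply/measurable_EFinP; exact: measurable_indic.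
  by rewrite integral_indic// setIT.
have mlin n c : measurable_fun setT (fun w => atan (t n * (c - M w))).
  by apply: (measurableT_comp (@measurable_atan R)); apply: measurable_funM => //; exact: measurable_funB.
apply: (@bounded_cvg_integral _ _ _ _ _ _ pi).
- by move=> n; exact: measurable_funB.
- by apply: measurable_funM => //; exact: measurable_indic.
- move=> n w; rewrite (le_trans (ler_normB _ _))//.
  have := norm_atan_le (t n * (b - M w)); have := norm_atan_le (t n * (a - M w)); lra.
have ncN c : 0 < c -> {ae P, forall w, M w != c}.
  move=> c0; exists (M @^-1` [set c]); split.
  - exact: measurable_preimageT.
  - exact: (random_mean_no_atom p01 H_gt0 lnH hD (ltW c0)).
  - by move=> w /= /negP; rewrite negbK => /eqP.
have cvgs c w : M w != c -> atan (t n * (c - M w)) @[n --> \oo] --> (if M w < c then pi / 2 else - (pi / 2)).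
  have tinf (r : R) : 0 < r -> atan (t n * r) @[n --> \oo] --> pi / 2.
    move=> r0; have hh : t n * r @[n --> \oo] --> +oo.
      apply/cvgryPge => B; near=> n.
      have : B / r <= n%:R by near: n; exact: nbhs_infty_ger.
      rewrite ler_pdivrMr// => hB; apply: le_trans hB _.
      by rewrite ler_wpM2r ?(ltW r0)// ler_nat.
    exact: (cvg_comp _ _ hh (@cvgy_atan R)).
  move=> Mc; case: ltP => h; first by apply: tinf; rewrite subr_gt0.
  have e n : atan (t n * (c - M w)) = - atan (t n * (M w - c)) by rewrite -atanN -mulrN opprB.
  under eq_fun do rewrite e.
  by apply: cvgN; apply: tinf; rewrite subr_gt0 lt_neqAle eq_sym Mc.
apply: filterS2 (ncN a a0) (ncN b b0) => w wa wb.
have e : (\1_(M @^-1` `]a, b]) w : R) = ((a < M w <= b)%R)%:R.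
  by rewrite indicE; congr (nat_of_bool _)%:R; apply/idP/idP; rewrite inE /= in_itv.
pose s (x : R) : R := if M w < x then pi / 2 else - (pi / 2).
rewrite {}e; have -> : (pi * ((a < M w <= b)%R)%:R : R) = s b - s a.
  rewrite /s.
  case: (ltP (M w) b) => hb; case: (ltP (M w) a) => ha.
  - by rewrite ltNge (ltW ha) mulr0 subrr.
  - by rewrite lt_neqAle eq_sym wa ha (ltW hb) mulr1; field.
  - by have := lt_trans (lt_le_trans ab hb) ha; rewrite ltxx.
  - rewrite [M w <= b](_ : _ = false) ?andbF ?mulr0 ?subrr//.
    by apply/negbTE; rewrite -ltNge lt_neqAle eq_sym wb hb.
by apply: cvgB; exact: cvgs.
Unshelve. all: end_near.
Qed.

Lemma thinned_mean_density (B : set R) : measurable B ->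
  P (M @^-1` B) = (\int[leb]_(x in B `&` `]0%R, +oo[) dens x)%E.
Proof.
move=> mB.
pose M' : {mfun T >-> R} := HB.pack M (isMeasurableFun.Build _ _ _ _ _ mM).
apply: (@density_law R (distribution P M') dens mdens dens_ge0 _ _ _ B mB).
- by rewrite -[X in (X < _)%E]/(P (M @^-1` setT)) preimage_setT probability_setT ltry.
(* The mean is nonnegative, so this event is its atom at 0. *)
- rewrite -[LHS]/(P (M @^-1` `]-oo, 0%R]%classic)).
  rewrite -(random_mean_no_atom p01 H_gt0 lnH hD (lexx 0)); congr (P _).
  apply/seteqP; split => w /=; rewrite in_itv/=; last by move=> ->.
  by move=> w0; apply/eqP; rewrite eq_le w0 random_mean_ge0.
move=> a b a0 ab; rewrite -[LHS]/(P (M @^-1` `]a, b]%classic)).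
have h1 := cvg_f a0 ab; have h2 := cvg_A a0 ab.
rewrite (_ : (fun n => _) = (fun n => \int[P]_w (A n a b w)%:E)%E) in h1; last first.
  by apply/funext => n; exact: integral_f.
have e : (pi%:E * P (M @^-1` `]a, b]) = pi%:E * \int[leb]_(x in `]a, b]) dens x)%E.
  by apply: (cvg_unique _ h2 h1); exact: ereal_hausdorff.
have := congr1 (fun z => (pi^-1)%:E * z)%E e.
by rewrite !muleA -!EFinM mulVf ?mul1e// gt_eqF// pi_gt0.
Qed.

End thinned_mean_density.

(** * The Beta identity for the thinned law, and conclusion *)

Section thinned_mean_law.
Context {R : realType}.
Import HBNNSimple.

(** The case [a = theta p] and [b = theta (1 - p)] of [mean_eq_law_mean_betaP], so that
    [a + b = theta]. A simple [h] is bounded, hence [ln (1 + u h)] is integrable, and it vanishes at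
    the atom 0. *)
Lemma mean_eq_law_mean_beta_thinning (p : R) (H : probability R R) (theta : R) :
  0 < p -> p <= 1 -> 0 < theta ->
  H.-integrable setT (EFin \o (fun x => ln (1 + Num.max 0 x))) ->
  mean_eq_law_mean_beta theta (thinning p H) (theta * p) H
    (theta * p) (theta * (1 - p)).
Proof.
move=> p0 p1 th0 lnH.
have e : theta * p + theta * (1 - p) = theta by ring.
rewrite -[X in mean_eq_law_mean_beta X]e; apply: mean_eq_law_mean_betaP => //.
- exact: mulr_gt0.
- by rewrite mulr_ge0 ?subr_ge0// ltW.
- move=> h h0 u u0; have [M [_ hM]] := simple_bounded h.
  have hb y : 0 <= ln (1 + u * h y) <= ln (1 + u * Num.max 1 (M + 1)).
    rewrite ln_ge0 ?lerDl ?mulr_ge0//= ler_ln ?posrE ?ltr_pwDl ?mulr_ge0 ?le_max ?ler01//.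
    rewrite lerD2l ler_wpM2l//; apply: le_trans (ler_norm _) _; apply: (hM _ _ y I).
    by rewrite lt_max ltrDl ltr01 orbT.
  rewrite e Rintegral_ln_thinning//; first by rewrite mulrA.
    apply: (@bounded_integrable _ _ _ _ _ (ln (1 + u * Num.max 1 (M + 1)))).
      apply: (measurableT_comp (@measurable_ln R)); apply: measurable_funD => //.
      exact: measurable_funM.
    by move=> y; have /andP[h1 h2] := hb y; rewrite ger0_norm.
  by rewrite h0 mulr0 addr0 ln1.
- exact: integrable_thinning.
Qed.

End thinned_mean_law.

Theorem theorem3p1 (R : realType) (d : measure_display) (T : measurableType d)
    (P : probability T R) (X Y : {RV P >-> R})
    (H : probability R R) (p : R)
    (hXH : has_law P X H)
    (hX : {ae P, forall w, 0 < X w})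
    (hlog : (\int[H]_(x in `[0%R, +oo[) (ln (1 + x))%:E < +oo)%E)
    (hp0 : 0 < p) (hp1 : p <= 1)
    (hY : has_law P Y (bernoulli_law p))
    (hXY : independent_RV P X Y) :
  has_law P (X \* Y) (thinning p H)
  /\
  (forall t : R, 0 <= t ->
     log_potential P (X \* Y) t =
     (p%:E * log_potential P X t + ((1 - p) * ln t * (t != 0)%:R)%:E)%E)
  /\
  (forall theta : R, 0 < theta ->
     mean_eq_law_mean_beta theta (thinning p H) (p * theta) H
       (theta * p) (theta * (1 - p)) /\
     gamma_mean_eq_law theta (thinning p H) (theta * p) H)
  /\
  (forall theta : R, 0 < theta -> p < 1 ->
     GGC theta (thinning p H) = GGC (theta * p) H /\
     forall (d1 : measure_display) (T1 : measurableType d1)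
       (P1 : probability T1 R) (D1 : R.-pker T1 ~> R)
       (G1 : {RV P1 >-> R}),
       dirichlet_process P1 theta (thinning p H) D1 ->
       has_law P1 G1 (gamma_law theta) ->
       independent_RV P1 G1 (random_mean D1) ->
       GGC theta (thinning p H) (distribution P1 (G1 \* random_mean D1)))
  /\
  (mean_eq_law_mean_beta 1 (thinning p H) p H p (1 - p) /\
   (p < 1 ->
    forall (d1 : measure_display) (T1 : measurableType d1)
      (P1 : probability T1 R) (D1 : R.-pker T1 ~> R),
      dirichlet_process P1 1 (thinning p H) D1 ->
      has_law P1 (random_mean D1) (fun A =>
        \int[lebesgue_measure]_(x in A `&` `]0%R, +oo[)
          ((pi^-1 * x `^ (- (1 - p)) *
            sin (pi * p * (1 - fine (H `[0%R, x]%classic))))%:E *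
           expeR (- (p%:E * log_potential P X x))))%E))
  /\
  mean_eq_law_mean_beta p^-1 (thinning p H) 1 H 1 ((1 - p) / p).
Proof.
have lnH := integrable_ln_max hlog.
have lnK := integrable_thinning hp0 hp1 lnH.
(* This family gives the general identity, special case (i) at [theta = 1], and special case (ii) at
   [theta = 1 / p], where [theta p = 1]. *)
have beta theta : 0 < theta -> mean_eq_law_mean_beta theta (thinning p H) (theta * p) H
    (theta * p) (theta * (1 - p)).
  by move=> th0; exact: mean_eq_law_mean_beta_thinning.
have H_gt0 := law_ae_gt0 hXH hX.
split; first exact: has_law_thinning.
split; first by move=> t t0; exact: (log_potential_thinning hXH hp0 hp1 hY hXY hX lnH).
split.
  move=> theta th0; split; first by rewrite [p * theta]mulrC; exact: beta.
  apply: gamma_mean_eq_lawP => //; first exact: mulr_gt0.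
  move=> u u0; rewrite Rintegral_ln_thinning ?mulrA//.
  - exact: integrable_ln1D (ltW u0) lnH.
  - by rewrite maxxx mulr0 addr0 ln1.
split.
  move=> theta th0 p1; split; first exact: GGC_thinning.
  by move=> d1 T1 P1 D1 G1 hD hG ind; exact: gamma_mean_GGC.
split.
  split; first by have := beta 1 ltr01; rewrite !mul1r.
  move=> p1 d1 T1 P1 D1 hD A mA.
  have p01 : 0 < p < 1 by rewrite hp0.
  transitivity (P1 (random_mean D1 @^-1` A)); first by [].
  rewrite (thinned_mean_density p01 H_gt0 lnH hD mA).
  apply: eq_integral => x _; congr (_ * expeR (- (_ * _)))%E.
  exact/esym/(log_potentialE hXH).
have := beta p^-1; rewrite invr_gt0 mulVf ?gt_eqF// [p^-1 * (1 - p)]mulrC.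
exact.
Qed.
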